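(* In the RoPE setup below, assume $\beta_nn^{-\alpha}\to\gamma\in(0,\infty)$. Let $\mathcal X$ be a Poisson point process on $\mathbb R_+$ with intensity $\overline\Lambda([0,y])=\overline C(q)(y/\gamma)^{1/\alpha}$ and atoms $0<Y_1<Y_2<\cdots$. Then for every fixed $k\ge1$, $(A_{(1)},\dots,A_{(k)})\to(W_1,\dots,W_k)$ in distribution, where $W_i=e^{-Y_i}/\sum_{j\ge1}e^{-Y_j}$.
   Context: RoPE setup: Let $d=2L\ge 2$, $\alpha=2/(d-1)$, $q\in\mathbb S^{d-1}\subset\mathbb R^d$ with surface measure $\sigma$. For frequencies $\vartheta_1,\dots,\vartheta_L\in\mathbb R$ let $r(\phi)=\begin{pmatrix}\cos\phi&-\sin\phi\\ \sin\phi&\cos\phi\end{pmatrix}$, $R_p=\mathrm{diag}(r(p\vartheta_1),\dots,r(p\vartheta_L))$, and $u_i=R_i^\top q$. Let $\mathbb T=\mathbb R/\mathbb Z$, $\theta=(\vartheta_l/2\pi)_{l}\in\mathbb T^L$, $\Phi_q(x)=\mathrm{diag}(r(-2\pi x_1),\dots,r(-2\pi x_L))q$, $\mathcal H_q=\overline{\{i\theta\bmod1:i\in\mathbb Z\}}$, $m_{\mathcal H_q}$ its Haar probability measure, $\pi_q=(\Phi_q)_\#m_{\mathcal H_q}$, and $\mathcal O_q=\overline{\{u_i:i\in\mathbb Z\}}$. Assumption: $(x_i)_{i\in\mathbb Z}$ is a stationary sequence in $\mathbb S^{d-1}$ such that (i) it is $m$-dependent for some integer $m\ge0$; (ii) $x_i$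 has density $\rho$ w.r.t. $\sigma$, continuous and strictly positive on a neighborhood of $\mathcal O_q$; (iii) for each $1\le\ell\le m$, $(x_0,x_\ell)$ has a density w.r.t. $\sigma\otimes\sigma$ bounded on a neighborhood of $\mathcal O_q\times\mathcal O_q$. Define $U_i=1-\langle u_i,x_i\rangle$, weights $A_i=e^{-\beta_nU_i}/\sum_{j=1}^ne^{-\beta_nU_j}$ ($1\le i\le n$) with decreasing rearrangement $A_{(1)}\ge\cdots\ge A_{(n)}$, and $\overline C(q)=\frac{2^{1/\alpha}\sigma_{d-2}}{d-1}\int_{\mathbb S^{d-1}}\rho(u)\,\pi_q(du)$, with $\sigma_{d-2}$ the surface area of $\mathbb S^{d-2}$. *)

(* Defs.v *)
From HB Require Import structures.
From mathcomp Require Import all_boot all_order all_algebra.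
From mathcomp Require Import all_classical all_reals all_analysis.

Set Implicit Arguments.
Unset Strict Implicit.
Unset Printing Implicit Defensive.

Import Order.TTheory GRing.Theory Num.Theory.
Import numFieldNormedType.Exports.
Local Open Scope classical_set_scope.
Local Open Scope ring_scope.

Section RoPE.
Context {R : realType}.

(** Points of R^n are n-tuples of reals, carrying the product (= Borel)
    sigma-algebra [measure_tuple_display]. *)
Definition vec (n : nat) := n.-tuple R.

Definition coord {n} (x : vec n) (k : nat) : R := nth 0 (tval x) k.

Definition vdot {n} (x y : vec n) : R := \sum_(i < n) tnth x i * tnth y i.

Definition vdist {n} (x y : vec n) : R :=
  Num.sqrt (\sum_(i < n) (tnth x i - tnth y i) ^+ 2).

Definition mapply {n} (M : 'M[R]_n) (x : vec n) : vec n :=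
  [tuple \sum_(j < n) M i j * tnth x j | i < n].

Definition sphere n : set (vec n) := [set x | vdot x x = 1].

Definition rot2 (phi : R) (a b : nat) : R :=
  match a, b with
  | 0, 0 => cos phi
  | 0, _ => - sin phi
  | _, 0 => sin phi
  | _, _ => cos phi
  end%N.

Definition blockrot (L : nat) (phi : nat -> R) : 'M[R]_(2 * L) :=
  \matrix_(i, j) (if (i %/ 2 == j %/ 2)%N
                  then rot2 (phi (i %/ 2)%N) (i %% 2)%N (j %% 2)%N else 0).

Definition Rmat (L : nat) (th : L.-tuple R) (p : int) : 'M[R]_(2 * L) :=
  @blockrot L (fun l => p%:~R * nth 0 (tval th) l).

Definition uvec (L : nat) (th : L.-tuple R) (q : vec (2 * L)) (i : int)
  : vec (2 * L) := mapply (Rmat th i)^T q.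

Definition orbit_closure (L : nat) (th : L.-tuple R) (q : vec (2 * L))
  : set (vec (2 * L)) :=
  [set y | forall eps : R, 0 < eps -> exists i : int, vdist y (uvec th q i) < eps].

Definition nbhd_set n (S : set (vec n)) (delta : R) : set (vec n) :=
  [set y | exists2 z, S z & vdist y z < delta].

(** ---------- torus T^L = (R/Z)^L, represented by [0,1)^L ---------- *)
Definition fracR (x : R) : R := x - (Num.floor x)%:~R.
Definition distZ (x : R) : R := Num.min (fracR x) (1 - fracR x).

Definition torus_pts (L : nat) : set (vec L) :=
  [set x | forall l : 'I_L, 0 <= tnth x l < 1].

Definition torus_add (L : nat) (h x : vec L) : vec L :=
  [tuple fracR (tnth x l + tnth h l) | l < L].

Definition theta (L : nat) (th : L.-tuple R) : vec L :=
  [tuple tnth th l / (2 * pi) | l < L].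

(** H_q = closure of { i theta mod 1 : i in Z } in T^L *)
Definition Hq (L : nat) (th : L.-tuple R) : set (vec L) :=
  [set x | @torus_pts L x /\
     forall eps : R, 0 < eps -> exists i : int,
       forall l : 'I_L, distZ (tnth x l - i%:~R * tnth (theta th) l) < eps].

Definition is_Haar_Hq (L : nat) (th : L.-tuple R)
    (m : probability (vec L) R) : Prop :=
  m (Hq th) = 1%E /\
  forall h, Hq th h -> forall A, measurable A ->
    m (torus_add h @^-1` A) = m A.

Definition Phi (L : nat) (q : vec (2 * L)) (x : vec L) : vec (2 * L) :=
  mapply (@blockrot L (fun l => - (2 * pi * coord x l))) q.

(** surface area of the k-sphere S^k (in R^{k+1}) *)
Fixpoint sphere_area (k : nat) : R :=
  match k with
  | 0%N => 2
  | 1%N => 2 * pi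
  | (k'.+1 as k1).+1 => 2 * pi * sphere_area k' / k1%:R
  end.

Definition orthogonal_mx n (O : 'M[R]_n) : Prop := O^T *m O = 1%:M.

Definition is_surface_measure n
    (sigma : {measure set (vec n) -> \bar R}) : Prop :=
  sigma (~` @sphere n) = 0%E /\
  sigma (@sphere n) = (sphere_area n.-1)%:E /\
  forall O : 'M[R]_n, orthogonal_mx O ->
    forall A, measurable A -> sigma (mapply O @^-1` A) = sigma A.

Section seq_assumptions.
Context {dT} {T : measurableType dT} (P : probability T R).

Definition stationary n (x : int -> T -> vec n) : Prop :=
  forall (t : int) (k : nat) (idx : 'I_k -> int) (A : 'I_k -> set (vec n)),
    (forall j, measurable (A j)) ->
    P [set w | forall j, A j (x (idx j + t) w)] =
    P [set w | forall j, A j (x (idx j) w)].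

(** m-dependence: sigma(x_i, i <= s) and sigma(x_i, i >= s+m+1) are
    independent (checked on the generating pi-systems of finite cylinders) *)
Definition m_dependent n (m : nat) (x : int -> T -> vec n) : Prop :=
  forall (s : int) (a b : nat) (i1 : 'I_a -> int) (A : 'I_a -> set (vec n))
         (i2 : 'I_b -> int) (B : 'I_b -> set (vec n)),
    (forall j, i1 j <= s) -> (forall j, s + m%:Z + 1 <= i2 j) ->
    (forall j, measurable (A j)) -> (forall j, measurable (B j)) ->
    P ([set w | forall j, A j (x (i1 j) w)] `&`
       [set w | forall j, B j (x (i2 j) w)]) =
    (P [set w | forall j, A j (x (i1 j) w)] *
     P [set w | forall j, B j (x (i2 j) w)])%E.

Definition is_density n (sigma : {measure set (vec n) -> \bar R})
    (x0 : T -> vec n) (rho : vec n -> R) : Prop :=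
  measurable_fun setT rho /\ (forall y, 0 <= rho y) /\
  forall A, measurable A ->
    P (x0 @^-1` A) = (\int[sigma]_(y in A) (rho y)%:E)%E.

Definition is_joint_density n (sigma : {measure set (vec n) -> \bar R})
    (x0 x1 : T -> vec n) (f : vec n -> vec n -> R) : Prop :=
  measurable_fun setT (fun yz : vec n * vec n => f yz.1 yz.2) /\
  (forall y z, 0 <= f y z) /\
  forall A B, measurable A -> measurable B ->
    P (x0 @^-1` A `&` x1 @^-1` B) =
    (\int[sigma]_(y in A) \int[sigma]_(z in B) (f y z)%:E)%E.

End seq_assumptions.

Definition Uvar (L : nat) (th : L.-tuple R) (q : vec (2 * L))
    (xi : vec (2 * L)) (i : int) : R := 1 - vdot (uvec th q i) xi.

Definition weights (L : nat) (th : L.-tuple R) (q : vec (2 * L))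
    (beta : R) (n : nat) (xs : int -> vec (2 * L)) : seq R :=
  let e := fun i : nat => expR (- beta * Uvar th q (xs i%:Z) i%:Z) in
  [seq e i / \sum_(1 <= j < n.+1) e j | i <- iota 1 n].

Definition top_k (k : nat) (s : seq R) : 'rV[R]_k :=
  \row_(i < k) nth 0 (sort (fun a b : R => b <= a) s) i.

Definition poisson_pmfR (rate : R) (n : nat) : R :=
  rate ^+ n / n`!%:R * expR (- rate).

(** Atoms of a Poisson point process on R_+ with intensity measure Lam:
    0 < Y_0 < Y_1 < ... (the paper's Y_1 < Y_2 < ...), and the counting
    measure N(B) = #{i | Y_i in B} has independent Poisson counts on
    disjoint Borel sets of finite intensity. *)
Definition is_PPP_atoms {dT} {T : measurableType dT} (Q : probability T R)
    (Lam : set R -> \bar R) (Y : nat -> T -> R) : Prop :=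
  (forall i, measurable_fun setT (Y i)) /\
  (forall w, 0 < Y 0%N w) /\ (forall w i, Y i w < Y i.+1 w) /\
  forall (k : nat) (B : 'I_k -> set R) (cnt : 'I_k -> nat),
    (forall j, measurable (B j)) ->
    (forall j, B j `<=` `[0, +oo[%classic) ->
    (forall j, (Lam (B j) < +oo)%E) ->
    (forall j j', j != j' -> B j `&` B j' = set0) ->
    Q [set w | forall j, @counting _ R [set i | B j (Y i w)] = (cnt j)%:R%:E] =
    (\prod_(j < k) (poisson_pmfR (fine (Lam (B j))) (cnt j))%:E)%E.

Definition alphaL (L : nat) : R := 2 / ((2 * L)%N%:R - 1).

(** Cbar(q) = 2^{1/alpha} sigma_{d-2}/(d-1) * int rho d pi_q,
    with pi_q = (Phi_q)_# m_{H_q}, i.e. int rho d pi_q = int rho(Phi_q x) dm(x) *)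
Definition Cbar (L : nat) (q : vec (2 * L)) (m : probability (vec L) R)
    (rho : vec (2 * L) -> R) : R :=
  2 `^ (alphaL L)^-1 * sphere_area (2 * L - 2)%N / ((2 * L)%N%:R - 1) *
  fine (\int[m]_z (rho (Phi q z))%:E)%E.

(** rho is continuous and strictly positive on a neighbourhood (in the sphere)
    of the compact set S; since S is compact we may take a delta-neighbourhood *)
Definition cont_pos_near n (S : set (vec n)) (rho : vec n -> R) : Prop :=
  exists2 delta : R, 0 < delta &
    let U := nbhd_set S delta `&` @sphere n in
    forall y, U y -> 0 < rho y /\
      forall eps : R, 0 < eps -> exists2 eta : R, 0 < eta &
        forall z, U z -> vdist z y < eta -> `|rho z - rho y| < eps.

Definition bounded_on_nbhd n (S : set (vec n)) (f : vec n -> vec n -> R) : Prop :=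
  exists2 delta : R, 0 < delta & exists M : R,
    forall y z, (nbhd_set S delta `&` @sphere n) y ->
                (nbhd_set S delta `&` @sphere n) z -> f y z <= M.

Definition Wvec {dT} {T : measurableType dT} (k : nat) (Y : nat -> T -> R)
    (w : T) : 'rV[R]_k :=
  \row_(i < k) (expR (- Y i w) /
                  fine (\sum_(0 <= j <oo) (expR (- Y j w))%:E)%E).

End RoPE.

(* Main.v *)
(** The scaled values beta_n U_i form a triangular array of points on the half-line. Cut the
half-line into cells of width d. The probability that no point falls into a given finite
union of cells converges to exp (- intensity), a cell holding two points has probability of
the order of its squared intensity, and the points beyond K carry little exponential weight,
uniformly in n. These three properties, shared by the initial segments of the Poisson atoms,
determine the limit of every bounded continuous function of the top k normalised weights:
avoidance probabilities give the law of the set of occupied cells by inclusion-exclusion,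
and rounding the points down to the grid changes the sorted weights very little.
For the array, m-dependence and the bounds t^(2p) on pairs of hits, p = L - 1/2, give the
avoidance probability as exp (- sum of hitting probabilities) up to O(1/n); a hitting
probability is rho (u_i) times the measure of a cap, and rho (u_i) averages to the Haar
integral because the average along the orbit through any point of H_q is asymptotically
that along the orbit of 0. The only information on the surface measure is its rotation
invariance and total mass: invariance gives Stein's identity
E [g' (x) (1 - x^2)] = (2L - 1) E [x g (x)] for a coordinate x, which becomes a differential
equation for cap moments, and the total mass fixes the constant. *)
Require Import Defs.
From HB Require Import structures.
From mathcomp Require Import all_boot all_order all_algebra.
From mathcomp Require Import all_classical all_reals all_analysis.
From mathcomp Require Import measurable_realfun ring lra.
Import Order.TTheory GRing.Theory Num.Theory.
Import numFieldNormedType.Exports.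
Local Open Scope classical_set_scope.
Local Open Scope ring_scope.

Set Implicit Arguments.
Unset Strict Implicit.
Unset Printing Implicit Defensive.

(** * Sorted weights and their discretisation *)

(** The normaliser involves all points, so the top weights are not a function of finitely many
    counts. Convergence is therefore obtained by comparing two arrays with the same limiting mean
    function F, the scaled points and the first n Poisson atoms; dominated convergence then passes
    from n atoms to all of them. The squared intensities of the cells below K sum to at most F(K)
    times the largest increment of F, so double occupancy disappears as d tends to 0, while a point
    in an initial block of cells keeps the normaliser away from 0. On the sphere, the measure of a
    cap is not known beforehand to be continuous in the radius, so it cannot be differentiated
    directly. Stein's identity wants a test function with Lipschitz derivative; (x_+^2 - v)_+^2 is
    one, and two differentiations in v bring it down to an indicator. Half-integer powers are
    avoided by solving for squares and then putting v = cos^2 phi. The constant comes from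
    integrating over phi from 0 to pi/2: one side is E [x_+^2] = mass / (4L), the other a Wallis
    integral. *)

Section OrderStatistics.
Context {R : realType}.
Implicit Types (s l : seq R) (t : R).

(** Past the end of the list the value is 0, as in [top_k]; this is why the comparison results
    assume nonnegative entries or positive levels. *)
Definition os s i : R := nth 0 (sort (fun a b : R => b <= a) s) i.

Let ger : rel R := fun a b : R => b <= a.

Let ger_trans : transitive ger.
Proof. by move=> y x z; rewrite /ger => yx zy; apply: le_trans zy yx. Qed.

Let ger_total : total ger.
Proof. by move=> x y; rewrite /ger; exact: le_total. Qed.

Lemma count_ge_nth l i : sorted ger l -> (i < size l)%N ->
  (i < count (fun a => (nth 0 l i <= a)%R) l)%N.
Proof.
move=> sl il; rewrite -[X in count _ X](cat_take_drop i.+1) count_cat.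
apply: (@leq_trans (count (fun a => nth 0 l i <= a) (take i.+1 l))); last exact: leq_addr.
have -> : count (fun a => nth 0 l i <= a) (take i.+1 l) = size (take i.+1 l).
  apply/eqP; rewrite -all_count; apply/(all_nthP 0) => j.
  rewrite size_take; case: ifP => [h ji|h jl].
    rewrite nth_take//.
    apply: (sorted_leq_nth ger_trans (fun x => lexx x)) => //.
    by rewrite inE; exact: leq_trans ji il.
  have e : size l = i.+1 by apply/eqP; rewrite eqn_leq il andbT leqNgt h.
  rewrite nth_take -?e//.
  apply: (sorted_leq_nth ger_trans (fun x => lexx x)) => //.
  by rewrite -ltnS -e.
by rewrite size_takel.
Qed.

Lemma le_nth_count l i t : sorted ger l -> (i < count (fun a => (t <= a)%R) l)%N ->
  t <= nth 0 l i.
Proof.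
move=> sl; apply: contraTT; rewrite -ltNge -leqNgt => nt.
rewrite -[X in count _ X](cat_take_drop i) count_cat.
have -> : count (fun a => t <= a) (drop i l) = 0%N.
  apply/eqP; rewrite -leqn0 leqNgt -has_count; apply/hasPn => a /(nthP 0)[j].
  rewrite size_drop nth_drop => jl <-; rewrite -ltNge.
  have ijl : (i + j < size l)%N by rewrite -ltn_subRL.
  apply: le_lt_trans nt.
  apply: (sorted_leq_nth ger_trans (fun x => lexx x)) => //.
  - by rewrite inE; apply: leq_ltn_trans ijl; exact: leq_addr.
  - exact: leq_addr.
by rewrite addn0; apply: leq_trans (count_size _ _) _; rewrite size_take_min geq_minl.
Qed.

Lemma os_ge0 s i : all (fun a => 0 <= a)%R s -> 0 <= os s i.
Proof.
move=> s0; rewrite /os; case: (ltnP i (size s)) => h; last first.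
  by rewrite nth_default ?size_sort.
apply: (allP s0); rewrite -(mem_sort ger).
by apply: mem_nth; rewrite size_sort.
Qed.

Lemma os_le1 s i : all (fun a => a <= 1)%R s -> os s i <= 1.
Proof.
move=> s0; rewrite /os; case: (ltnP i (size s)) => h; last first.
  by rewrite nth_default ?size_sort.
apply: (allP s0); rewrite -(mem_sort ger).
by apply: mem_nth; rewrite size_sort.
Qed.

Lemma os_perm s l i : perm_eq s l -> os s i = os l i.
Proof.
move=> sl; rewrite /os; congr nth; apply/perm_sortP => //.
by move=> x y /andP[a b]; apply/le_anti; rewrite a b.
Qed.

(** Order statistics are read off from counts, so that comparing sorted lists becomes a matter of
    counting. Positivity of t excludes the default value 0 past the end. *)
Lemma os_geP s i t : 0 < t -> (t <= os s i) = (i < count (fun a => t <= a)%R s)%N.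
Proof.
move=> t0; apply/idP/idP => [h|].
  have isz : (i < size s)%N.
    rewrite ltnNge; apply/negP => h'; move: h.
    by rewrite /os nth_default ?size_sort// leNgt t0.
  have := @count_ge_nth (sort ger s) i (sort_sorted ger_total s).
  rewrite size_sort => /(_ isz) /leq_trans; apply.
  rewrite count_sort; apply: sub_count => a /=; apply: le_trans; exact: h.
rewrite -(count_sort ger) => /le_nth_count; apply; exact: sort_sorted.
Qed.

(** Counts above shifted levels replace a matching between the two lists. Only levels above eps
    matter, because the order statistics of [l] are nonnegative. *)
Lemma os_le s l i (eps : R) : 0 <= eps ->
  all (fun a => 0 <= a)%R l ->
  (forall t, eps < t -> (count (fun a => (t <= a)%R) s <= count (fun a => (t - eps <= a)%R) l)%N) ->
  os s i <= os l i + eps.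
Proof.
move=> e0 l0 H; have [le|lt] := leP (os s i) eps.
  by rewrite (le_trans le)// lerDr os_ge0.
have t0 : 0 < os s i by exact: le_lt_trans lt.
rewrite -lerBlDr os_geP ?subr_gt0//.
by apply: leq_trans (H _ lt); rewrite -os_geP.
Qed.

Lemma os_sorted s i : sorted (fun a b : R => b <= a) s -> os s i = nth 0 s i.
Proof. by move=> ss; rewrite /os sorted_sort. Qed.

End OrderStatistics.

Section Discretization.
Context {R : realType}.
Implicit Types (ys : seq R) (c : seq nat) (d : R).

Definition wts ys : seq R :=
  [seq expR (- y) / \sum_(z <- ys) expR (- z) | y <- ys].

Definition cell d (y : R) : nat := Num.truncn (y / d).

(** A cell is represented by its right endpoint, so rounding only lowers an exponential weight, by a
    factor of at most exp d. *)
Definition grid d c : seq R := [seq d * j.+1%:R | j <- c].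

Definition cells d r ys : seq nat := [seq cell d y | y <- ys & (cell d y < r)%N].

Lemma cell_bounds d (y : R) : 0 < d -> 0 <= y ->
  d * (cell d y)%:R <= y < d * (cell d y).+1%:R.
Proof.
move=> d0 y0; have yd0 : 0 <= y / d by rewrite divr_ge0// ltW.
have := truncn_itv yd0; rewrite -/(cell d y) => /andP[h1 h2].
by rewrite mulrC -ler_pdivlMr// h1/= mulrC -ltr_pdivrMr.
Qed.

Lemma cell_eqP d (y : R) j : 0 < d -> 0 <= y ->
  (cell d y == j) = (d * j%:R <= y < d * j.+1%:R).
Proof.
move=> d0 y0; have yd0 : 0 <= y / d by rewrite divr_ge0// ltW.
have /andP[h1 h2] := cell_bounds d0 y0.
apply/eqP/idP => [<-|/andP[a b]]; first by rewrite h1 h2.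
apply/eqP; rewrite eqn_leq; apply/andP; split; rewrite -ltnS -(ltr_nat R) -(ltr_pM2l d0).
- exact: le_lt_trans b.
- exact: le_lt_trans h2.
Qed.

Lemma cell_ltP d (y : R) r : 0 < d -> 0 <= y -> (cell d y < r)%N = (y < d * r%:R).
Proof.
move=> d0 y0; have /andP[h1 h2] := cell_bounds d0 y0.
apply/idP/idP => [lt|lt].
  by apply: lt_le_trans h2 _; rewrite ler_pM2l// ler_nat.
by rewrite -(ltr_nat R) -(ltr_pM2l d0); exact: le_lt_trans lt.
Qed.

Lemma wts_ge0 ys : all (fun a => 0 <= a) (wts ys).
Proof.
apply/allP => _ /mapP[y _ ->]; rewrite divr_ge0 ?expR_ge0//.
by apply: sumr_ge0 => z _; exact: expR_ge0.
Qed.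

Lemma ler_sum_mem (I : eqType) (s : seq I) (F : I -> R) i : (forall j, 0 <= F j) ->
  i \in s -> F i <= \sum_(j <- s) F j.
Proof.
move=> F0 si; rewrite (big_rem i)//= lerDl.
by apply: sumr_ge0 => j _; exact: F0.
Qed.

Lemma wts_le1 ys : all (fun a => a <= 1) (wts ys).
Proof.
apply/allP => _ /mapP[y ysy ->].
have h : expR (- y) <= \sum_(z <- ys) expR (- z).
  by apply: (@ler_sum_mem _ ys (fun z => expR (- z))) => // z; exact: expR_ge0.
by rewrite ler_pdivrMr ?mul1r// (lt_le_trans _ h)// expR_gt0.
Qed.

Lemma sub_count_in (T : eqType) (a b : pred T) (s : seq T) :
  {in s, forall x, a x -> b x} -> (count a s <= count b s)%N.
Proof.
elim: s => //= x s IH H; apply: leq_add.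
  by have := H x (mem_head _ _); case: (a x) => // ->.
by apply: IH => y ys; apply: H; rewrite inE ys orbT.
Qed.

Lemma wts_perm ys ys' : perm_eq ys ys' -> perm_eq (wts ys) (wts ys').
Proof.
by move=> yy; rewrite /wts (perm_big _ yy)/=; exact: perm_map.
Qed.

(** Rounding changes each kept exponential by a factor between 1 and exp d, and discarding the
    points beyond the r-th cell removes tau from the normaliser. Hence the weight of a kept point
    moves by at most eps, the weight of a discarded point is at most eps, and [os_le] applies in
    both directions. *)
Lemma os_wts_disc d r ys i : 0 < d -> all (fun y => 0 <= y) ys ->
  let c := cells d r ys in
  let S := \sum_(z <- grid d c) expR (- z) in
  let tau := \sum_(y <- ys | (r <= cell d y)%N) expR (- y) in
  0 < S ->
  `|os (wts ys) i - os (wts (grid d c)) i| <= expR d - 1 + tau / S.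
Proof.
move=> d0 ys0 c S tau Spos.
set eps := expR d - 1 + tau / S.
have ed1 : 1 <= expR d by rewrite -expR0 ler_expR ltW.
have tau0 : 0 <= tau by apply: sumr_ge0 => y _; exact: expR_ge0.
have tS0 : 0 <= tau / S by rewrite divr_ge0// ltW.
have eps0 : 0 <= eps by rewrite /eps addr_ge0// subr_ge0.
set S1 := \sum_(y <- ys | (cell d y < r)%N) expR (- y).
set ST := \sum_(y <- ys) expR (- y).
have STE : ST = S1 + tau.
  rewrite /ST (bigID (fun y => (cell d y < r)%N))/=; congr (_ + _).
  by apply: eq_bigl => y; rewrite -leqNgt.
have SE : S = \sum_(y <- ys | (cell d y < r)%N) expR (- (d * (cell d y).+1%:R)).
  by rewrite /S /grid /c /cells big_map big_map big_filter.
have aa y : y \in ys -> expR (- (d * (cell d y).+1%:R)) <= expR (- y) <=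
    expR d * expR (- (d * (cell d y).+1%:R)).
  move=> yys; have y0 : 0 <= y by exact: (allP ys0).
  have /andP[h1 h2] := cell_bounds d0 y0.
  rewrite -expRD !ler_expR lerN2 ltW//=.
  by move: h1; rewrite -natr1 mulrDr mulr1; lra.
have SS1 : S <= S1.
  rewrite SE /S1 big_seq_cond [leRHS]big_seq_cond; apply: ler_sum => y /andP[/aa/andP[]//].
have S1S : S1 <= expR d * S.
  rewrite SE mulr_sumr /S1 big_seq_cond [leRHS]big_seq_cond; apply: ler_sum => y /andP[/aa/andP[]//].
have STpos : 0 < ST by rewrite STE; apply: lt_le_trans (Spos) _; lra.
(* The normalisers satisfy S <= ST <= S (1 + eps); this comparison dictates the value of eps. *)
have STle : ST <= S * (1 + eps).
  rewrite STE /eps.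
  have -> : S * (1 + (expR d - 1 + tau / S)) = expR d * S + tau.
    by field; rewrite gt_eqF.
  lra.
have D1 y : y \in ys -> (cell d y < r)%N ->
    expR (- y) / ST <= expR (- (d * (cell d y).+1%:R)) / S + eps.
  move=> yys cy; have /andP[h1 h2] := aa _ yys.
  have aS : expR (- (d * (cell d y).+1%:R)) <= S.
    rewrite SE -big_filter.
    apply: (@ler_sum_mem _ _ (fun y => expR (- (d * (cell d y).+1%:R)))) => [j|].
      exact: expR_ge0.
    by rewrite mem_filter cy.
  rewrite ler_pdivrMr//; set q := _ / S.
  have qS : expR (- (d * (cell d y).+1%:R)) = q * S by rewrite /q divfK ?gt_eqF.
  have q1 : q <= 1 by rewrite /q ler_pdivrMr// mul1r.
  have q0 : 0 <= q by rewrite /q divr_ge0 ?expR_ge0// ltW.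
  rewrite qS in h2.
  apply: (@le_trans _ _ ((q + eps) * S)).
    apply: le_trans h2 _; rewrite mulrA ler_pM2r//.
    apply: (@le_trans _ _ (q + (expR d - 1))).
      rewrite -subr_ge0.
      have -> : q + (expR d - 1) - expR d * q = (expR d - 1) * (1 - q) by ring.
      by rewrite mulr_ge0// subr_ge0.
    by rewrite /eps; lra.
  apply: ler_wpM2l; first exact: addr_ge0.
  by rewrite STE; lra.
have Dt y : y \in ys -> ~~ (cell d y < r)%N -> expR (- y) / ST <= eps.
  move=> yys; rewrite -leqNgt => cy; apply: (@le_trans _ _ (tau / S)); last by rewrite /eps; lra.
  have h : expR (- y) <= tau.
    rewrite /tau -big_filter; apply: (@ler_sum_mem _ _ (fun y => expR (- y))) => [j|].
      exact: expR_ge0.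
    by rewrite mem_filter cy.
  apply: ler_pM; rewrite ?expR_ge0 ?invr_ge0 ?(ltW STpos)//.
  by rewrite lef_pV2// ?posrE// STE; lra.
have D2 y : y \in ys -> (cell d y < r)%N ->
    expR (- (d * (cell d y).+1%:R)) / S <= expR (- y) / ST + eps.
  move=> yys cy; have /andP[h1 h2] := aa _ yys.
  set q := _ / S.
  have qS : expR (- (d * (cell d y).+1%:R)) = q * S by rewrite /q divfK ?gt_eqF.
  have aS : expR (- (d * (cell d y).+1%:R)) <= S.
    rewrite SE -big_filter.
    apply: (@ler_sum_mem _ _ (fun y => expR (- (d * (cell d y).+1%:R)))) => [j|].
      exact: expR_ge0.
    by rewrite mem_filter cy.
  have q1 : q <= 1 by rewrite /q ler_pdivrMr// mul1r.
  (* Outside the trivial case, q <= 1 gives (q - eps) (1 + eps) <= q, which absorbs the larger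
     normaliser. *)
  have [le|lt] := leP q eps.
    by apply: le_trans le _; rewrite lerDr divr_ge0 ?expR_ge0// ltW.
  rewrite -lerBlDr ler_pdivlMr//.
  apply: le_trans h1; rewrite qS.
  apply: (@le_trans _ _ ((q - eps) * (S * (1 + eps)))).
    by rewrite ler_wpM2l// subr_ge0 ltW.
  rewrite -subr_ge0.
  have -> : q * S - (q - eps) * (S * (1 + eps)) = S * eps * (eps + (1 - q)) by ring.
  by rewrite mulr_ge0// ?mulr_ge0 ?(ltW Spos)// addr_ge0// subr_ge0.
have H1 : os (wts ys) i <= os (wts (grid d c)) i + eps.
  apply: os_le => //; first exact: wts_ge0.
  move=> t te; rewrite /wts /grid /c /cells !count_map count_filter.
  apply: sub_count_in => y yys /= ty.
  have cy : (cell d y < r)%N.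
    by apply/negPn/negP => /(Dt _ yys); rewrite leNgt (lt_le_trans te ty).
  rewrite cy andbT lerBlDr; apply: le_trans ty _; exact: D1.
have H2 : os (wts (grid d c)) i <= os (wts ys) i + eps.
  apply: os_le => //; first exact: wts_ge0.
  move=> t te; rewrite /wts /grid /c /cells !count_map count_filter.
  apply: sub_count_in => y yys /= /andP[ty cy].
  by rewrite lerBlDr; apply: le_trans ty _; exact: D2.
by rewrite ler_distl lerBlDr H2 H1.
Qed.

(** Without double occupancy the list of cells carries no more information than the set of occupied
    cells, so the discretised weights become a function of that finite set. *)
Lemma cells_perm d r ys (b : {set 'I_r}) :
  uniq (cells d r ys) ->
  (forall j : 'I_r, (j \in b) = has (fun y => cell d y == j) ys) ->
  perm_eq (cells d r ys) [seq val j | j <- enum b].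
Proof.
move=> u H; apply: uniq_perm => //.
  by rewrite map_inj_uniq ?enum_uniq//; exact: val_inj.
move=> j; apply/mapP/mapP => [[y]|[j']].
  rewrite mem_filter => /andP[cy yys] ->; exists (Ordinal cy) => //.
  by rewrite mem_enum H; apply/hasP; exists y.
rewrite mem_enum H => /hasP[y yys /eqP e] ->; exists y => //.
by rewrite mem_filter yys e ltn_ord.
Qed.

Lemma os_wts_grid_perm d (c c' : seq nat) i : perm_eq c c' ->
  os (wts (grid d c)) i = os (wts (grid d c')) i.
Proof. by move=> cc'; apply: os_perm; apply: wts_perm; exact: perm_map. Qed.

End Discretization.

(** * Bounded measurable functions and real-valued probabilities *)

Section BoundedMeasurable.
Context {d} {T : measurableType d} {R : realType}.
Variables (mu : {measure set T -> \bar R}) (D : set T).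
Hypotheses (mD : measurable D) (muD : (mu D < +oo)%E).
Implicit Types (f g : T -> R).

(** Bounded measurable functions on a set of finite measure: a class closed under the operations
    used below and contained in the integrable functions, so integrability reduces to closure
    properties. *)
Definition bmf f := measurable_fun D f /\ exists M, forall x, D x -> `|f x| <= M.

Lemma bmf_int f : bmf f -> mu.-integrable D (EFin \o f).
Proof.
move=> [mf [M fM]]; apply: measurable_bounded_integrable => //.
exists M; split; first exact: num_real.
by move=> x Mx y Dy; apply: le_trans (fM _ Dy) _; exact: ltW.
Qed.

Lemma bmf_cst r : bmf (fun=> r).
Proof. by split; [exact: measurable_cst | exists `|r|]. Qed.

Lemma bmfD f g : bmf f -> bmf g -> bmf (fun x => f x + g x).
Proof.
move=> [mf [M fM]] [mg [N gN]]; split; first exact: measurable_funD.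
by exists (M + N) => x Dx; apply: le_trans (ler_normD _ _) _; rewrite lerD ?fM ?gN.
Qed.

Lemma bmfN f : bmf f -> bmf (fun x => - f x).
Proof.
move=> [mf [M fM]]; split; first exact: measurable_funN.
by exists M => x Dx; rewrite normrN fM.
Qed.

Lemma bmfB f g : bmf f -> bmf g -> bmf (fun x => f x - g x).
Proof. by move=> bf bg; apply: bmfD => //; exact: bmfN. Qed.

Lemma bmfM f g : bmf f -> bmf g -> bmf (fun x => f x * g x).
Proof.
move=> [mf [M fM]] [mg [N gN]]; split; first exact: measurable_funM.
by exists (M * N) => x Dx; rewrite normrM ler_pM ?fM ?gN.
Qed.

Lemma bmfX f n : bmf f -> bmf (fun x => f x ^+ n).
Proof.
move=> [mf [M fM]]; split; first exact: measurable_funX.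
by exists (M ^+ n) => x Dx; rewrite normrX lerXn2r ?nnegrE ?fM// (le_trans _ (fM x Dx)).
Qed.

Lemma bmf_norm f : bmf f -> bmf (fun x => `|f x|).
Proof.
move=> [mf [M fM]]; split; first exact: measurableT_comp.
by exists M => x Dx; rewrite normr_id fM.
Qed.

Lemma bmf_sum (I : Type) (s : seq I) (Q : pred I) (F : I -> T -> R) :
  (forall i, bmf (F i)) -> bmf (fun x => \sum_(i <- s | Q i) F i x).
Proof.
move=> bF; elim: s => [|i s IH].
  by under [X in bmf X]funext do rewrite big_nil; exact: bmf_cst.
under [X in bmf X]funext do rewrite big_cons.
by case: (Q i) => //; exact: bmfD.
Qed.

Lemma bmf_indic (A : set T) : measurable A -> bmf (\1_A : T -> R).
Proof.
move=> mA; split; first exact: measurable_indic.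
by exists 1 => x _; rewrite indicE; case: (_ \in _); rewrite ?normr1 ?normr0.
Qed.

Lemma bmf_max f g : bmf f -> bmf g -> bmf (fun x => Num.max (f x) (g x)).
Proof.
move=> [mf [M fM]] [mg [N gN]]; split; first exact: measurable_maxr.
exists (Num.max M N) => x Dx; rewrite le_max.
by have [_|_] := leP (f x) (g x); rewrite ?gN ?fM ?orbT.
Qed.

Definition Ex f : R := \int[mu]_(x in D) f x.

Lemma ExE f : bmf f -> (Ex f)%:E = (\int[mu]_(x in D) (f x)%:E)%E.
Proof. by move=> bf; rewrite /Ex /Rintegral fineK//; apply: integrable_fin_num => //; exact: bmf_int. Qed.

Lemma ExD f g : bmf f -> bmf g -> Ex (fun x => f x + g x) = Ex f + Ex g.
Proof. by move=> bf bg; apply: RintegralD => //; exact: bmf_int. Qed.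

Lemma ExB f g : bmf f -> bmf g -> Ex (fun x => f x - g x) = Ex f - Ex g.
Proof. by move=> bf bg; apply: RintegralB => //; exact: bmf_int. Qed.

Lemma ExZ r f : bmf f -> Ex (fun x => r * f x) = r * Ex f.
Proof. by move=> bf; apply: RintegralZl => //; exact: bmf_int. Qed.

Lemma Ex_cst r : Ex (fun=> r) = r * fine (mu D).
Proof. exact: Rintegral_cst. Qed.

Lemma Ex_le f g : bmf f -> bmf g -> (forall x, D x -> f x <= g x) -> Ex f <= Ex g.
Proof. by move=> bf bg fg; apply: le_Rintegral => //; exact: bmf_int. Qed.

Lemma Ex_eq f g : (forall x, D x -> f x = g x) -> Ex f = Ex g.
Proof. by move=> fg; apply: eq_Rintegral => x /set_mem; exact: fg. Qed.

Lemma Ex_ge0 f : (forall x, D x -> 0 <= f x) -> 0 <= Ex f.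
Proof. exact: Rintegral_ge0. Qed.

Lemma Ex_sum (I : Type) (s : seq I) (Q : pred I) (F : I -> T -> R) :
  (forall i, bmf (F i)) -> Ex (fun x => \sum_(i <- s | Q i) F i x) = \sum_(i <- s | Q i) Ex (F i).
Proof.
move=> bF; elim: s => [|i s IH].
  rewrite big_nil; under Ex_eq do rewrite big_nil.
  by rewrite Ex_cst mul0r.
rewrite big_cons; under Ex_eq do rewrite big_cons.
by case: (Q i) => //; rewrite ExD ?IH//; exact: bmf_sum.
Qed.

Lemma Ex_norm f : bmf f -> `|Ex f| <= Ex (fun x => `|f x|).
Proof. by move=> bf; apply: le_normr_Rintegral => //; exact: bmf_int. Qed.

Lemma Ex_dist f g h : bmf f -> bmf g -> bmf h ->
  (forall x, D x -> `|f x - g x| <= h x) -> `|Ex f - Ex g| <= Ex h.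
Proof.
move=> bf bg bh fgh; rewrite -ExB//; apply: le_trans (Ex_norm (bmfB bf bg)) _.
by apply: Ex_le => //; apply: bmf_norm; exact: bmfB.
Qed.

Lemma Ex_indic (A : set T) : measurable A -> Ex (\1_A) = fine (mu (A `&` D)).
Proof. by move=> mA; rewrite /Ex /Rintegral integral_indic. Qed.

End BoundedMeasurable.

Section RealProbability.
Context {d} {T : measurableType d} {R : realType} (P : probability T R).
Implicit Types A B : set T.

Definition pr A : R := fine (P A).

Lemma PfinT : (P setT < +oo)%E. Proof. by rewrite probability_setT ltry. Qed.

Lemma prE A : measurable A -> (pr A)%:E = P A.
Proof. by move=> mA; rewrite /pr fineK// fin_num_measure. Qed.

Lemma pr_ge0 A : 0 <= pr A. Proof. by rewrite /pr fine_ge0. Qed.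

Lemma pr_Ex A : measurable A -> pr A = Ex P setT (\1_A : T -> R).
Proof. by move=> mA; rewrite Ex_indic// setIT. Qed.

Lemma prT : pr setT = 1. Proof. by rewrite /pr probability_setT. Qed.

Lemma pr_le A B : measurable A -> measurable B -> A `<=` B -> pr A <= pr B.
Proof. by move=> mA mB AB; rewrite -lee_fin !prE//; apply: le_measure => //; rewrite inE. Qed.

Lemma pr_le1 A : measurable A -> pr A <= 1.
Proof. by move=> mA; rewrite -prT; apply: pr_le. Qed.

Lemma prC A : measurable A -> pr (~` A) = 1 - pr A.
Proof. by move=> mA; apply: EFin_inj; rewrite EFinB !prE//; [exact: probability_setC | exact: measurableC]. Qed.

Lemma prU A B : measurable A -> measurable B -> pr (A `|` B) <= pr A + pr B.
Proof.
move=> mA mB; rewrite -lee_fin EFinD !prE//; last exact: measurableU.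
exact: measureU2.
Qed.

Lemma pr_disjU A B : measurable A -> measurable B -> A `&` B = set0 ->
  pr (A `|` B) = pr A + pr B.
Proof.
move=> mA mB AB; apply: EFin_inj; rewrite EFinD !prE//; last exact: measurableU.
exact: measureU.
Qed.

Lemma prD A B : measurable A -> measurable B -> pr A = pr (A `&` B) + pr (A `\` B).
Proof.
move=> mA mB; rewrite -pr_disjU; [|exact: measurableI|exact: measurableD|].
  by rewrite setUC setDE -setIUr setvU setIT.
by rewrite setDE setIACA setICr setI0.
Qed.

Lemma pr_bigU (I : eqType) (s : seq I) (A : I -> set T) : (forall i, measurable (A i)) ->
  pr [set w | exists2 i, i \in s & A i w] <= \sum_(i <- s) pr (A i).
Proof.
move=> mA; elim: s => [|i s IH].
  by rewrite big_nil (_ : [set w | _] = set0) ?/pr ?measure0//; apply/seteqP; split => // w [].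
have mU : measurable [set w | exists2 j, j \in s & A j w].
  exact: (@fin_bigcup_measurable _ _ _ [set` s]).
rewrite big_cons (_ : [set w | _] = A i `|` [set w | exists2 j, j \in s & A j w]).
  by apply: le_trans (prU _ _) _ => //; rewrite lerD2l.
apply/seteqP; split => w.
  by move=> [j]; rewrite inE => /orP[/eqP->|js] Aj; [left | right; exists j].
by move=> [Ai|[j js Aj]]; [exists i; rewrite ?mem_head | exists j; rewrite ?inE ?js ?orbT].
Qed.

Lemma pr_markov (f : T -> R) (c : R) : bmf setT f -> (forall w, 0 <= f w) -> 0 < c ->
  pr [set w | c <= f w] <= Ex P setT f / c.
Proof.
move=> bf f0 c0.
have mA : measurable [set w | c <= f w].
  rewrite -[X in measurable X]setTI; apply: measurable_fun_ler => //.
  by case: bf.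
rewrite ler_pdivlMr// mulrC pr_Ex// -ExZ//; last exact: bmf_indic.
  apply: Ex_le => //; first exact: PfinT.
  - by apply: bmfM; [exact: bmf_cst | exact: bmf_indic].
  - move=> w _; rewrite indicE; case: (boolP (w \in _)) => [/set_mem|_]; rewrite ?mulr1 ?mulr0//.
exact: PfinT.
Qed.

End RealProbability.

(** * Uniform continuity on compact sets, and measurability of functions of vectors *)

Section Compactness.
Context {R : realType}.

(** The Heine-Cantor argument, in an asymmetric form: the base point a ranges over the compact set,
    whereas z may leave it and stay in U only. It is applied to a density near the orbit closure,
    whose caps are not contained in that closure. *)
Lemma compact_unif (V : normedModType R) (A U : set V) (f : V -> R) :
  compact A -> A `<=` U ->
  (forall a, A a -> forall e : R, 0 < e -> exists2 h : R, 0 < h &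
     forall z, U z -> `|z - a| < h -> `|f z - f a| < e) ->
  forall e : R, 0 < e -> exists2 h : R, 0 < h &
     forall a z, A a -> U z -> `|z - a| < h -> `|f z - f a| < e.
Proof.
move=> cA AU fc e e0.
have := (compact_near_coveringP A).1 cA _ (0 : R)^'+
  (fun h a => A a -> forall z, U z -> `|z - a| < h -> `|f z - f a| < e) _.
case.
- move=> a Aa.
  have e20 : 0 < e / 2 by lra.
  have [h h0 H] := fc a Aa _ e20.
  exists ([set x | `|x - a| < h / 2], [set r | r < h / 2]) => /=.
    split => /=.
      apply/nbhs_ballP; exists (h / 2) => /=; first by lra.
      by move=> x; rewrite -ball_normE /= distrC.
    by near=> t; near: t; apply: nbhs_right_lt; lra.
  move=> [x r] /= [xa rh] Ax z Uz zx.
  have za : `|z - a| < h.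
    by apply: le_lt_trans (ler_distD x _ _) _; lra.
  have xa' : `|x - a| < h by lra.
  have := H _ Uz za; have := H _ (AU _ Ax) xa'.
  rewrite distrC => h1 h2; apply: le_lt_trans (ler_distD (f a) _ _) _; lra.
- move=> h /= h0 H; exists (h / 2); first by lra.
  move=> a z Aa; apply: (H (h / 2)) => //=; last by lra.
  by rewrite sub0r normrN gtr0_norm; lra.
Unshelve. all: by end_near.
Qed.

End Compactness.

Section RowVectors.
Context {R : realType}.

Lemma rV_norm_lt k (u v : 'rV[R]_k) (e : R) : 0 < e ->
  (forall i, `|u 0 i - v 0 i| < e) -> `|u - v| < e.
Proof.
move=> e0 H; have : ball u e v.
  by split => // i j; rewrite (ord1 i) /ball/=; exact: H.
by rewrite mx_norm_ball.
Qed.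

Lemma rV_norm_ge k (u : 'rV[R]_k) i : `|u 0 i| <= `|u|.
Proof.
rewrite leNgt; apply/negP => h.
have : ball (0 : 'rV[R]_k) `|u 0 i| u by rewrite mx_norm_ball /= /ball_/= sub0r normrN.
by move=> [_ /(_ 0 i)]; rewrite /ball/= mxE sub0r normrN ltxx.
Qed.

Lemma unit_box_compact k : compact [set v : 'rV[R]_k | forall i, 0 <= v 0 i <= 1].
Proof.
have := @rV_compact R k (fun=> `[0, 1]%classic) (fun=> @segment_compact _ _ _).
set A := (X in compact X); set B := (X in _ -> compact X).
suff -> : A = B by [].
by apply/seteqP; split => v h i; have := h i; rewrite /= in_itv.
Qed.

Lemma continuous_unif_box k (f : 'rV[R]_k -> R) : continuous f ->
  forall e : R, 0 < e -> exists2 h : R, 0 < h &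
  forall u v : 'rV[R]_k, (forall i, 0 <= u 0 i <= 1) -> (forall i, `|v 0 i - u 0 i| < h) ->
    `|f v - f u| < e.
Proof.
move=> cf e e0.
have [||h h0 H] := @compact_unif R 'rV[R]_k _ setT f (@unit_box_compact k) _ _ e e0.
- by [].
- move=> a _ e1 e10; have := cf a => /cvgrPdist_lt /(_ _ e10) /nbhs_ballP[h /= h0 H].
  exists h => // z _ za; rewrite distrC; apply: H.
  by rewrite -ball_normE /= distrC.
exists h => // u v u01 uv; apply: H => //.
exact: rV_norm_lt.
Qed.

Context {d} {T : measurableType d}.

Lemma measurable_setT_le (f g : T -> R) : measurable_fun setT f -> measurable_fun setT g ->
  measurable [set w | f w <= g w].
Proof. by move=> mf mg; rewrite -[X in measurable X]setTI; apply: measurable_fun_ler. Qed.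

Lemma measurable_setT_lt (f g : T -> R) : measurable_fun setT f -> measurable_fun setT g ->
  measurable [set w | f w < g w].
Proof. by move=> mf mg; rewrite -[X in measurable X]setTI; apply: measurable_fun_ltr. Qed.

Lemma measurable_setT_itv (f : T -> R) (a b : R) : measurable_fun setT f ->
  measurable [set w | a <= f w < b].
Proof.
move=> mf; rewrite (_ : [set w | _] = [set w | a <= f w] `&` [set w | f w < b]).
  by apply: measurableI; [apply: measurable_setT_le | apply: measurable_setT_lt].
by apply/seteqP; split => w /= => [/andP[]|[-> ->]].
Qed.

Lemma measurable_fun_sumr (I : Type) (s : seq I) (Q : pred I) (F : I -> T -> R) :
  (forall i, measurable_fun setT (F i)) ->
  measurable_fun setT (fun x => \sum_(i <- s | Q i) F i x).
Proof.
move=> mF; elim: s => [|i s IH].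
  by under [X in measurable_fun _ X]funext do rewrite big_nil; exact: measurable_cst.
under [X in measurable_fun _ X]funext do rewrite big_cons.
by case: (Q i) => //; exact: measurable_funD.
Qed.

Lemma measurable_fun_prodr (I : Type) (s : seq I) (Q : pred I) (F : I -> T -> R) :
  (forall i, measurable_fun setT (F i)) ->
  measurable_fun setT (fun x => \prod_(i <- s | Q i) F i x).
Proof.
move=> mF; elim: s => [|i s IH].
  by under [X in measurable_fun _ X]funext do rewrite big_nil; exact: measurable_cst.
under [X in measurable_fun _ X]funext do rewrite big_cons.
by case: (Q i) => //; exact: measurable_funM.
Qed.

(** For r > 0 the level set at r says that at least i+1 of the functions are >= r, a condition on a
    finite sum of indicators; for r <= 0 it is everything. *)
Lemma measurable_fun_os n (g : nat -> T -> R) i :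
  (forall j, measurable_fun setT (g j)) ->
  (forall w, all (fun a => 0 <= a) [seq g j w | j <- iota 0 n]) ->
  measurable_fun setT (fun w => os [seq g j w | j <- iota 0 n] i).
Proof.
move=> mg g0; apply: (measurability (@RGenCInfty.G R)) => [|/= _ [_] [r] -> <-].
  exact: RGenCInfty.measurableE.
rewrite setTI.
have [r0|r0] := leP r 0.
  rewrite (_ : _ @^-1` _ = setT)//; apply/seteqP; split => w //= _.
  by rewrite in_itv/= andbT (le_trans r0)// os_ge0.
rewrite (_ : _ @^-1` _ = [set w | i.+1%:R <=
    \sum_(j <- iota 0 n) (\1_[set w | r <= g j w] w : R)]); last first.
  have E w : (count (fun a => (r <= a)%R) [seq g j w | j <- iota 0 n])%:R =
      \sum_(j <- iota 0 n) (\1_[set w | r <= g j w] w : R).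
    rewrite -sum1_count big_map natr_sum big_mkcond/=.
    apply: eq_bigr => j _; rewrite indicE.
    by case: ifPn => h; [rewrite mem_set | rewrite memNset//=; exact/negP].
  by apply/seteqP; split => w; rewrite /= in_itv/= andbT os_geP// -(ler_nat R) E.
apply: measurable_setT_le; first exact: measurable_cst.
apply: measurable_fun_sumr => j; apply: measurable_indic.
by apply: measurable_setT_le.
Qed.

(* f is continuous, so its values are limits of the values at points rounded
   down to a grid, and these are finite combinations of indicators. *)
Lemma measurable_fun_rV k (f : 'rV[R]_k -> R) (g : 'I_k -> T -> R) : continuous f ->
  (forall i, measurable_fun setT (g i)) -> (forall i w, 0 <= g i w <= 1) ->
  measurable_fun setT (fun w => f (\row_i g i w)).
Proof.
move=> cf mg g01.
pose row m (c : 'I_k -> nat) : 'rV[R]_k := \row_i ((c i)%:R / m.+1%:R).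
pose h m w := f (row m (fun i => Num.truncn (m.+1%:R * g i w))).
have m0 m : 0 < m.+1%:R :> R by rewrite ltr0n.
have mg0 m i w : 0 <= m.+1%:R * g i w by rewrite mulr_ge0//; case/andP: (g01 i w).
apply: (@measurable_fun_cvg _ _ _ setT h) => [m|w _].
  rewrite (_ : h m = fun w => \sum_(c : {ffun 'I_k -> 'I_m.+2}) f (row m (fun i => val (c i))) *
      \prod_(i < k) \1_[set w | (c i)%:R <= m.+1%:R * g i w < (c i).+1%:R] w).
    apply: measurable_fun_sumr => c; apply: measurable_funM; first exact: measurable_cst.
    apply: measurable_fun_prodr => i; apply: measurable_indic.
    by apply: measurable_setT_itv; apply: measurable_funM => //; exact: measurable_cst.
  apply/funext => w.
  (* A coordinate equal to 1 has index m.+1, so the grid needs m.+2 indices. *)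
  have tb i : (Num.truncn (m.+1%:R * g i w) < m.+2)%N.
    rewrite -(ltr_nat R); apply: le_lt_trans (_ : m.+1%:R < _); last by rewrite ltr_nat.
    apply: le_trans (_ : m.+1%:R * g i w <= _); first by rewrite truncn_le.
    by rewrite -[leRHS]mulr1 ler_pM2l//; case/andP: (g01 i w).
  rewrite (bigD1 [ffun i => Ordinal (tb i)])//= [X in _ + X]big1 ?addr0.
    rewrite [X in _ * X]big1 ?mulr1.
      by congr (f _); apply/rowP => i; rewrite !mxE ffunE.
    move=> i _; rewrite ffunE/= indicE mem_set//=.
    exact: truncn_itv.
  move=> c cN; apply/eqP; rewrite mulf_eq0; apply/orP; right.
  have [i ci] : exists i, Num.truncn (m.+1%:R * g i w) != c i.
    apply/existsP; rewrite -negb_forall; apply: contra cN => /forallP cE.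
    by apply/eqP/ffunP => i; rewrite ffunE; apply/val_inj => /=; rewrite (eqP (cE i)).
  apply/eqP; rewrite (bigD1 i)//= indicE memNset ?mul0r//=.
  by move=> h1; move: ci; rewrite (truncn_def h1) eqxx.
apply/cvgrPdist_lt => e e0.
have [d0 d00 H] := continuous_unif_box cf e0.
near=> m; rewrite distrC; apply: H => i; first by rewrite mxE.
rewrite !mxE distrC.
have /andP[h1 h2] := truncn_itv (mg0 m i w).
have -> : g i w - (Num.truncn (m.+1%:R * g i w))%:R / m.+1%:R =
   (m.+1%:R * g i w - (Num.truncn (m.+1%:R * g i w))%:R) / m.+1%:R.
  by rewrite mulrBl mulrAC mulfV ?mul1r// gt_eqF.
rewrite ger0_norm; last by rewrite divr_ge0 ?ler0n// subr_ge0.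
apply: lt_trans (_ : m.+1%:R^-1 < _); last first.
  near: m; apply: (near_infty_natSinv_lt (PosNum d00)).
rewrite ltr_pdivrMr// mulVf ?gt_eqF//.
by move: h2; rewrite -natr1; lra.
Unshelve. all: by end_near.
Qed.

End RowVectors.

(** * Comparison of point arrays *)

Section PointArrays.
Context {R : realType}.

(** The cell condition as an interval, which makes the events below measurable without truncation;
    for y >= 0 it agrees with [cell d y = j], and a negative y lies in no cell. *)
Definition incell (d : R) (j : nat) (y : R) := d * j%:R <= y < d * j.+1%:R.

Definition pairs n : seq (nat * nat) :=
  [seq p <- [seq (a, b) | a <- iota 0 n, b <- iota 0 n] | (p.1 < p.2)%N].

Lemma mem_pairs n a b : ((a, b) \in pairs n) = (a < b < n)%N.
Proof.
rewrite mem_filter /=; case: ltnP => //= ab.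
apply/allpairsP/idP => [[[a' b'] /= [_ + [_ ->]]]|bn]; first by rewrite mem_iota.
by exists (a, b); rewrite /= !mem_iota /= add0n bn (ltn_trans ab).
Qed.

Definition points n (y : nat -> R) : seq R := [seq y i | i <- iota 0 n].

Definition tailsum n K (y : nat -> R) := \sum_(z <- points n y | K%:R <= z) expR (- z).

Section Events.
Context {dT} {T : measurableType dT} (P : probability T R).
Variable y : nat -> T -> R.

Definition avoids n d r (B : {set 'I_r}) : set T :=
  [set w | forall i, i \in iota 0 n -> forall j, j \in B -> ~~ incell d j (y i w)].

Definition doubles n d j : set T :=
  [set w | exists2 p, p \in pairs n & incell d j (y p.1 w) && incell d j (y p.2 w)].

Definition occ n d r w : {set 'I_r} := [set j : 'I_r | has (incell d j) (points n (y ^~ w))].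

Hypothesis my : forall i, measurable_fun setT (y i).

Lemma measurable_incell d j i : measurable [set w | incell d j (y i w)].
Proof. exact: measurable_setT_itv. Qed.

Lemma measurable_avoids n d r (B : {set 'I_r}) : measurable (avoids n d B).
Proof.
apply: (@fin_bigcap_measurable _ _ _ [set` iota 0 n]) => // i _.
apply: (@fin_bigcap_measurable _ _ _ [set` B]) => // j _.
rewrite (_ : (fun a => _) = ~` [set w | incell d j (y i w)]).
  exact/measurableC/measurable_incell.
by apply/seteqP; split => w /= /negP.
Qed.

Lemma measurable_doubles n d j : measurable (doubles n d j).
Proof.
apply: (@fin_bigcup_measurable _ _ _ [set` pairs n]) => // p _.
rewrite (_ : (fun a => _) = [set w | incell d j (y p.1 w)] `&` [set w | incell d j (y p.2 w)]).
  by apply: measurableI; exact: measurable_incell.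
by apply/seteqP; split => w /= => [/andP[]|[-> ->]].
Qed.

Lemma measurable_tailsum n K : measurable_fun setT (fun w => tailsum n K (y ^~ w)).
Proof.
rewrite (_ : (fun w => _) = fun w => \sum_(i <- iota 0 n)
    \1_[set w | K%:R <= y i w] w * expR (- y i w)).
  apply: measurable_fun_sumr => i; apply: measurable_funM.
    by apply: measurable_indic; apply: measurable_setT_le.
  by apply: measurableT_comp => //; apply: measurable_funN.
apply/funext => w; rewrite /tailsum /points big_map big_mkcond; apply: eq_bigr => i _.
rewrite indicE; case: ifPn => h; first by rewrite mem_set ?mul1r.
by rewrite memNset ?mul0r//=; exact/negP.
Qed.

Lemma avoids_occ n d r (B : {set 'I_r}) :
  avoids n d B = [set w | occ n d r w \subset ~: B].
Proof.
apply/seteqP; split => w /= H.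
  apply/fintype.subsetP => j; rewrite !inE => /hasP[z /mapP[i il ->] ijd].
  by apply/negP => jB; have := H i il j jB; rewrite ijd.
move=> i il j jB; apply/negP => ijd.
have /(fintype.subsetP H) : j \in occ n d r w.
  by rewrite inE; apply/hasP; exists (y i w) => //; apply/mapP; exists i.
by rewrite inE jB.
Qed.

Lemma measurable_occ n d r (B : {set 'I_r}) : measurable [set w | occ n d r w = B].
Proof.
rewrite (_ : [set w | _] = \bigcap_(j in [set: 'I_r])
   (if j \in B then ~` (avoids n d [set j]) else avoids n d [set j])).
  apply: fin_bigcap_measurable => // j _; case: ifP => _.
    exact/measurableC/measurable_avoids.
  exact/measurable_avoids.
have E w (j : 'I_r) : avoids n d [set j] w <-> j \notin occ n d r w.
  rewrite avoids_occ /=; split => [/fintype.subsetP H|jN].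
    by apply/negP => jo; have := H _ jo; rewrite !inE eqxx.
  apply/fintype.subsetP => j' jo; rewrite !inE.
  by apply: contra jN => /eqP <-.
apply/seteqP; split => w /=.
  by move=> <- j _; case: ifPn => jo; [move=> /E; rewrite jo | apply/E].
move=> H; apply/setP => j; have := H j I.
case: ifPn => jB; last by move=> /E /negbTE.
by move=> h; apply/negPn/negP => h'; apply: h; apply/E.
Qed.

(** Avoiding the complement of C means that the occupied set is contained in C; summing over the
    possible values of that set expresses avoidance probabilities by its law, a triangular system to
    be inverted later. *)
Lemma pr_occ_sub n d r (C : {set 'I_r}) :
  pr P [set w | occ n d r w \subset C] =
  \sum_(B : {set 'I_r} | B \subset C) pr P [set w | occ n d r w = B].
Proof.
have mC : measurable [set w | occ n d r w \subset C].
  by rewrite -(finset.setCK C) -avoids_occ; exact: measurable_avoids.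
rewrite pr_Ex//.
rewrite [RHS](eq_bigr (fun B => Ex P setT (\1_[set w | occ n d r w = B] : T -> R))); last first.
  by move=> B _; apply: pr_Ex; exact: measurable_occ.
rewrite -Ex_sum//; [|exact: PfinT|by move=> B; apply: bmf_indic => //; exact: measurable_occ].
apply: Ex_eq => w _; rewrite indicE.
have z B : B != occ n d r w -> \1_[set w | occ n d r w = B] w = 0 :> R.
  by move=> h; rewrite indicE memNset//= => e; rewrite e eqxx in h.
have [h|h] := boolP (occ n d r w \subset C).
  rewrite mem_set// (bigD1 (occ n d r w))//= indicE mem_set//= big1 ?addr0//.
  by move=> B /andP[_]; exact: z.
rewrite memNset/=; last exact/negP.
rewrite big1// => B BC; apply: z; apply: contraNneq h => <-//.
Qed.

Lemma Ex_occ n d r (g : {set 'I_r} -> R) :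
  bmf setT (fun w => g (occ n d r w)) /\
  Ex P setT (fun w => g (occ n d r w)) = \sum_(B : {set 'I_r}) g B * pr P [set w | occ n d r w = B].
Proof.
have E : (fun w => g (occ n d r w)) = fun w => \sum_(B : {set 'I_r}) g B * \1_[set w | occ n d r w = B] w.
  apply/funext => w; rewrite (bigD1 (occ n d r w))//= indicE mem_set//= mulr1 big1 ?addr0//.
  by move=> B BN; rewrite indicE memNset ?mulr0//= => e; rewrite e eqxx in BN.
have bi B : bmf setT (\1_[set w | occ n d r w = B] : T -> R).
  by apply: bmf_indic; exact: measurable_occ.
have bZ B : bmf setT (fun w => g B * \1_[set w | occ n d r w = B] w).
  by apply: bmfM => //; exact: bmf_cst.
rewrite E; split; first exact: bmf_sum.
rewrite Ex_sum//; last exact: PfinT.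
apply: eq_bigr => B _; rewrite ExZ// ?pr_Ex//; first exact: measurable_occ.
exact: PfinT.
Qed.

End Events.

(** F t is the limiting mean number of points below t. Nonnegativity is asked for large n only,
    since [beta n] may be negative at first. The double-occupancy clause is an asymptotic upper
    bound, which suffices because its sum over cells is small for a fine mesh. In the last clause K0
    is chosen before n, which is the uniformity of the tails. *)
Definition good_array {dT} {T : measurableType dT} (P : probability T R)
    (y : nat -> nat -> T -> R) (F : R -> R) : Prop :=
  [/\ (forall n i, measurable_fun setT (y n i)),
   (exists n0, forall n i w, (n0 <= n)%N -> 0 <= y n i w),
   (forall (d : R) r (B : {set 'I_r}), 0 < d ->
      (fun n => pr P (avoids (y n) n d B)) @ \oo -->
      expR (- \sum_(j in B) (F (d * j.+1%:R) - F (d * j%:R)))),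
   (forall (d : R) j (e : R), 0 < d -> 0 < e -> \forall n \near \oo,
      pr P (doubles (y n) n d j) <= (F (d * j.+1%:R) - F (d * j%:R)) ^+ 2 + e) &
   (forall e : R, 0 < e -> exists K0 : nat, forall K, (K0 <= K)%N -> \forall n \near \oo,
      pr P [set w | e <= tailsum n K (y n ^~ w)] <= e)].

Definition wrow k (s : seq R) : 'rV[R]_k := top_k k (wts s).

Lemma wrow01 k s i : 0 <= wrow k s 0 i <= 1.
Proof.
by rewrite mxE; apply/andP; split; [apply: os_ge0; exact: wts_ge0 | apply: os_le1; exact: wts_le1].
Qed.

Lemma measurable_wrow {dT} {T : measurableType dT} k (f : 'rV[R]_k -> R) n (y : nat -> T -> R) :
  continuous f -> (forall i, measurable_fun setT (y i)) ->
  measurable_fun setT (fun w => f (wrow k (points n (y ^~ w)))).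
Proof.
move=> cf my; apply: measurable_fun_rV => //.
  move=> i; rewrite /wts /points.
  pose S w := \sum_(l <- iota 0 n) expR (- y l w).
  (* The quotient is written as a single exponential, so that measurability reduces to that of [ln];
     the two agree because S is positive as soon as the list has an entry. *)
  pose g j w := expR (- y j w - ln (S w)).
  have mE j : measurable_fun setT (fun w => expR (- y j w)).
    by apply: measurableT_comp => //; exact: measurable_funN.
  rewrite (_ : (fun w => _) = fun w => os [seq g j w | j <- iota 0 n] i).
    apply: measurable_fun_os => [j|w]; last by apply/allP => _ /mapP[j _ ->]; exact: expR_ge0.
    apply: measurableT_comp => //; apply: measurable_funB; first exact: measurable_funN.
    by apply: (measurableT_comp (@measurable_ln R)); exact: measurable_fun_sumr.
  apply/funext => w; congr os; rewrite -map_comp; apply/eq_in_map => j jn /=.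
  have S0 : 0 < S w.
    apply: lt_le_trans (expR_gt0 (- y j w)) _.
    apply: (@ler_sum_mem _ _ _ (fun l => expR (- y l w))) => // l; exact: expR_ge0.
  by rewrite /g expRB lnK ?posrE// big_map.
by move=> i w; have := wrow01 (points n (y ^~ w)) i; rewrite mxE.
Qed.

End PointArrays.

(** * Two arrays with the same mean function have the same limiting weights *)

Section Comparison.
Context {R : realType}.

Lemma incell_cell (d y : R) j : 0 < d -> 0 <= y -> incell d j y = (cell d y == j).
Proof. by move=> d0 y0; rewrite cell_eqP. Qed.

(** The deterministic half of the comparison. A point in one of the first r0 cells forces S >= exp
    (- d r0), so a tail of size e perturbs the weights by at most e / exp (- d r0). *)
Lemma os_wts_occ n (y : nat -> R) (d e : R) r r0 K (b : {set 'I_r}) i :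
  0 < d -> (forall i, 0 <= y i) -> d * r%:R = K%:R -> (r0 <= r)%N ->
  (exists2 l, l \in iota 0 n & exists2 j : nat, (j < r0)%N & incell d j (y l)) ->
  (forall j, (j < r)%N -> forall p, p \in pairs n -> ~~ (incell d j (y p.1) && incell d j (y p.2))) ->
  tailsum n K y <= e ->
  (forall j : 'I_r, (j \in b) = has (incell d j) (points n y)) ->
  `|os (wts (points n y)) i - os (wts (grid d [seq val j | j <- enum b])) i|
     <= expR d - 1 + e / expR (- (d * r0%:R)).
Proof.
move=> d0 y0 drK r0r [l ln [j jr0 lj]] nodbl te bE.
have ys0 : all (fun z => 0 <= z) (points n y) by apply/allP => _ /mapP[m _ ->].
have u : uniq (cells d r (points n y)).
  rewrite /cells /points filter_map -map_comp map_inj_in_uniq ?filter_uniq ?iota_uniq//.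
  have key a c : (a < c)%N -> c \in iota 0 n -> (cell d (y a) < r)%N ->
      cell d (y a) != cell d (y c).
    rewrite mem_iota /= add0n => ac cn ca; apply/negP => /eqP ce.
    have pac : (a, c) \in pairs n by rewrite mem_pairs ac cn.
    have := nodbl _ ca _ pac.
    by rewrite /= !incell_cell// -ce eqxx.
  move=> a c; rewrite !mem_filter /= => /andP[ca an] /andP[cc cn] ce.
  case: (ltngtP a c) => // h.
    by have := key _ _ h cn ca; rewrite ce eqxx.
  by have := key _ _ h an cc; rewrite ce eqxx.
have pe : perm_eq (cells d r (points n y)) [seq val j | j <- enum b].
  apply: cells_perm => // j'; rewrite bE; apply/hasP/hasP => -[z zy h]; exists z => //.
    by rewrite -incell_cell// (allP ys0).
  by rewrite incell_cell// (allP ys0).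
rewrite -(os_wts_grid_perm _ _ pe).
have cl : cell d (y l) = j by apply/eqP; rewrite -incell_cell.
set S := \sum_(z <- grid d (cells d r (points n y))) expR (- z).
have Sge : expR (- (d * r0%:R)) <= S.
  apply: (@le_trans _ _ (expR (- (d * j.+1%:R)))).
    by rewrite ler_expR lerN2 ler_pM2l// ler_nat.
  apply: (@ler_sum_mem _ _ _ (fun z => expR (- z))) => [z|]; first exact: expR_ge0.
  apply/mapP; exists j => //; apply/mapP; exists (y l) => //.
  rewrite mem_filter cl (leq_trans jr0)//=.
  by apply/mapP; exists l.
have S0 : 0 < S by apply: lt_le_trans Sge; exact: expR_gt0.
apply: le_trans (os_wts_disc i d0 ys0 S0) _.
rewrite lerD2l.
set tau := \sum_(_ <- _ | _) _.
have -> : tau = tailsum n K y.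
  rewrite /tau /tailsum big_seq_cond [RHS]big_seq_cond; apply: eq_bigl => z.
  case zy: (z \in points n y) => //=.
  by rewrite leqNgt cell_ltP ?(allP ys0)// drK -leNgt.
have t0 : 0 <= tailsum n K y by apply: sumr_ge0 => z _; exact: expR_ge0.
apply: ler_pM => //; first by rewrite invr_ge0 ltW.
by rewrite lef_pV2 ?posrE ?expR_gt0.
Qed.

Lemma cvgr_sum (I : Type) (s : seq I) (S : pred I) (u : I -> nat -> R) (l : I -> R) :
  (forall i, S i -> u i n @[n --> \oo] --> l i) ->
  (fun n => \sum_(i <- s | S i) u i n) @ \oo --> \sum_(i <- s | S i) l i.
Proof.
move=> H; elim: s => [|i s IH].
  rewrite big_nil (_ : (fun n => _) = fun=> 0); first exact: cvg_cst.
  by apply/funext => n; rewrite big_nil.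
rewrite big_cons; under eq_fun do rewrite big_cons.
by case: ifP => // Si; apply: cvgD => //; exact: H.
Qed.

Lemma cvgr_sum0 (I : Type) (s : seq I) (S : pred I) (u : I -> nat -> R) :
  (forall i, S i -> u i n @[n --> \oo] --> (0 : R)) ->
  (fun n => \sum_(i <- s | S i) u i n) @ \oo --> (0 : R).
Proof. by move=> /cvgr_sum => /(_ s); rewrite big1. Qed.

Definition gridf k (f : 'rV[R]_k -> R) d r (B : {set 'I_r}) : R :=
  f (wrow k (grid d [seq val j | j <- enum B])).

Section OneArray.
Context {dT} {T : measurableType dT} (P : probability T R).
Variables (y : nat -> nat -> T -> R) (F : R -> R).
Hypothesis gy : good_array P y F.
Variables (k : nat) (f : 'rV[R]_k -> R) (M : R).
Hypotheses (cf : continuous f) (fM : forall v, `|f v| <= M).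

(** Off a bad event of probability at most 4 eta, the weights are within kappa of those of the
    occupied grid points and f moves by less than eta; on it the two values differ by at most 2M. *)
Lemma approx_by_cells (eta kappa d e : R) r r0 K :
  0 < eta -> 0 < d -> d * r%:R = K%:R -> (r0 <= r)%N ->
  (forall u v : 'rV[R]_k, (forall i, 0 <= u 0 i <= 1) ->
     (forall i, `|v 0 i - u 0 i| < kappa) -> `|f v - f u| < eta) ->
  expR d - 1 + e / expR (- (d * r0%:R)) < kappa ->
  expR (- \sum_(j < r0) (F (d * j.+1%:R) - F (d * j%:R))) < eta ->
  \sum_(j < r) (F (d * j.+1%:R) - F (d * j%:R)) ^+ 2 <= eta ->
  (\forall n \near \oo, pr P [set w | e <= tailsum n K (y n ^~ w)] <= eta) ->
  \forall n \near \oo,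
    `|Ex P setT (fun w => f (wrow k (points n (y n ^~ w)))) -
      \sum_(B : {set 'I_r}) gridf f d B * pr P [set w | occ (y n) n d r w = B]|
    <= eta + 8 * M * eta.
Proof.
move=> eta0 d0 drK r0r Hk hk hav hdbl htail.
have [my [n0 y0] av dbl _] := gy.
have M0 : 0 <= M by apply: le_trans (fM 0).
have := av d r0 [set: 'I_r0]%SET d0.
under [X in expR (- X)]eq_bigl do rewrite inE.
move=> /cvgr_lt /(_ _ hav) near_av.
have near_dbl : \forall n \near \oo, \sum_(j < r) pr P (doubles (y n) n d j) <= eta + eta.
  (* The excess allowed in each of the r cells, so that the total excess stays below eta; the
     successor avoids a division by 0. *)
  have e1 : 0 < eta / r.+1%:R by rewrite divr_gt0.
  have H : \forall n \near \oo, forall j : 'I_r,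
      pr P (doubles (y n) n d j) <= (F (d * j.+1%:R) - F (d * j%:R)) ^+ 2 + eta / r.+1%:R.
    by apply: filter_forall => j; exact: dbl.
  near=> n; have Hn : forall j : 'I_r, pr P (doubles (y n) n d j) <=
      (F (d * j.+1%:R) - F (d * j%:R)) ^+ 2 + eta / r.+1%:R by near: n.
  apply: le_trans (ler_sum _ (fun j _ => Hn j)) _.
  rewrite big_split/= lerD// sumr_const card_ord -[leLHS]mulr_natr mulrAC ler_pdivrMr//.
  by rewrite ler_pM2l// ler_nat.
near=> n.
have n0n : (n0 <= n)%N by near: n; exact: nbhs_infty_ge.
have yn0 i w : 0 <= y n i w by exact: y0.
have [bo Eo] := @Ex_occ R _ T P (y n) (my n) n d r (@gridf k f d r).
rewrite -Eo.
(* The initial block is empty (eta), some cell holds two points (2 eta), or the tail is heavy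
   (eta). *)
set bad : set T := avoids (y n) n d [set: 'I_r0]%SET `|`
  ([set w | exists2 j : 'I_r, j \in enum 'I_r & doubles (y n) n d j w] `|` [set w | e <= tailsum n K (y n ^~ w)]).
have mdbl : measurable [set w | exists2 j : 'I_r, j \in enum 'I_r & doubles (y n) n d j w].
  by apply: (@fin_bigcup_measurable _ _ _ [set` enum 'I_r]) => // j _; exact: measurable_doubles.
have mtail : measurable [set w | e <= tailsum n K (y n ^~ w)].
  by apply: measurable_setT_le => //; exact: measurable_tailsum.
have mav : measurable (avoids (y n) n d [set: 'I_r0]%SET) by exact: measurable_avoids.
have mbad : measurable bad by apply: measurableU => //; apply: measurableU.
have prbad : pr P bad <= 4 * eta.
  apply: le_trans (prU _ _ _) _ => //; first exact: measurableU.
  have h1 : pr P (avoids (y n) n d [set: 'I_r0]%SET) < eta by near: n.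
  have h2 := prU P mdbl mtail.
  have h3 : pr P [set w | e <= tailsum n K (y n ^~ w)] <= eta by near: n.
  have h4 : \sum_(j < r) pr P (doubles (y n) n d j) <= eta + eta by near: n.
  have h5 := @pr_bigU _ _ _ P _ (enum 'I_r) (fun j : 'I_r => doubles (y n) n d j)
     (fun j => measurable_doubles (my n) n d j).
  rewrite big_enum/= in h5.
  by apply: le_trans (lerD (ltW h1) h2) _; lra.
have b1 : bmf setT (fun w => f (wrow k (points n (y n ^~ w)))).
  by split; [exact: measurable_wrow | exists M].
have bb : bmf setT (fun w => eta + 2 * M * \1_bad w).
  apply: bmfD => //; first exact: bmf_cst.
  by apply: bmfM => //; [exact: bmf_cst | exact: bmf_indic].
apply: le_trans (Ex_dist measurableT (PfinT P) b1 bo bb _) _ => //.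
  move=> w _; rewrite indicE; case: (boolP (w \in bad)) => [_|/negP wb].
    rewrite mulr1; apply: le_trans (ler_normB _ _) _.
    have := fM (wrow k (points n (y n ^~ w))); have := fM (wrow k (grid d [seq val j | j <- enum (occ (y n) n d r w)])).
    by rewrite -/(gridf f d _); lra.
  rewrite mulr0 addr0; apply/ltW/Hk => i; first exact: wrow01.
  have nb : ~ bad w by move=> h; apply: wb; exact: mem_set.
  rewrite !mxE distrC; apply: le_lt_trans hk.
  rewrite distrC; apply: (os_wts_occ (K := K)) => //.
  - apply: contrapT => H; apply: nb; left => l ln j _; apply/negP => ij.
    by apply: H; exists l => //; exists j.
  - move=> j jr p pospart; apply/negP => h; apply: nb; right; left.
    by exists (Ordinal jr); [rewrite mem_enum | exists p].
  - by rewrite leNgt; apply/negP => h; apply: nb; right; right; exact: ltW.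
  - by move=> j; rewrite inE.
rewrite ExD//; [|exact: PfinT|exact: bmf_cst|]; last first.
  by apply: bmfM => //; [exact: bmf_cst | exact: bmf_indic].
rewrite Ex_cst// ExZ//; [|exact: PfinT|exact: bmf_indic].
have -> : fine (P setT) = 1 by exact: prT.
rewrite -pr_Ex// mulr1 lerD2l.
have -> : 8 * M * eta = 2 * M * (4 * eta) by ring.
by rewrite ler_wpM2l// mulr_ge0.
Unshelve. all: by end_near.
Qed.

End OneArray.

Section TwoArrays.
Context {dT} {T : measurableType dT} (P : probability T R).
Context {dT'} {T' : measurableType dT'} (Q : probability T' R).
Variables (y : nat -> nat -> T -> R) (y' : nat -> nat -> T' -> R) (F : R -> R).
Hypotheses (gy : good_array P y F) (gy' : good_array Q y' F).

(* The probabilities of [occ = B] are recovered from those of [occ \subset B]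
   by induction on the size of B. *)
Lemma occ_cvg0 d r (B : {set 'I_r}) : 0 < d ->
  (fun n => pr P [set w | occ (y n) n d r w = B] - pr Q [set w | occ (y' n) n d r w = B]) @ \oo --> (0 : R).
Proof.
move=> d0; have [my _ av _ _] := gy; have [my' _ av' _ _] := gy'.
have [m] := ubnP #|B|; elim: m B => // m IH B /ltnSE Bm.
have sub0 : (fun n => pr P [set w | occ (y n) n d r w \subset B] -
     pr Q [set w | occ (y' n) n d r w \subset B]) @ \oo --> (0 : R).
  rewrite (_ : (fun n => _) = fun n => pr P (avoids (y n) n d (~: B)%SET) -
     pr Q (avoids (y' n) n d (~: B)%SET)); last first.
    by apply/funext => n; rewrite !avoids_occ finset.setCK.
  rewrite -[X in _ --> X](subrr (expR (- \sum_(j in (~: B)%SET) (F (d * j.+1%:R) - F (d * j%:R))))).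
  by apply: cvgB; [exact: av | exact: av'].
have sum0 : (fun n => \sum_(C : {set 'I_r} | (C \subset B) && (C != B))
    (pr P [set w | occ (y n) n d r w = C] - pr Q [set w | occ (y' n) n d r w = C])) @ \oo --> (0 : R).
  apply: cvgr_sum0 => C /andP[CB CnB]; apply: IH.
  by apply: leq_trans Bm; apply: proper_card; rewrite finset.properEneq CnB.
rewrite (_ : (fun n => _) =
  (fun n => (pr P [set w | occ (y n) n d r w \subset B] -
     pr Q [set w | occ (y' n) n d r w \subset B]) -
  \sum_(C : {set 'I_r} | (C \subset B) && (C != B))
    (pr P [set w | occ (y n) n d r w = C] - pr Q [set w | occ (y' n) n d r w = C]))).
  by rewrite -[X in _ --> X](subrr 0); exact: cvgB.
apply/funext => n /=.
rewrite !pr_occ_sub// sumrB (bigD1 B)//= [X in _ = _ - X - _](bigD1 B)//=.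
ring.
Qed.

Hypotheses (F0 : F 0 = 0) (Fnd : forall a b, 0 <= a -> a <= b -> F a <= F b).
Hypothesis Fcont : forall (K : nat) (e : R), 0 < e -> exists2 h, 0 < h &
  forall a b, 0 <= a -> a <= b -> b <= K%:R -> b - a <= h -> F b - F a <= e.
Hypothesis Finf : forall e, 0 < e -> exists K : nat, expR (- F K%:R) < e.
Variables (k : nat) (f : 'rV[R]_k -> R) (M : R).
Hypotheses (cf : continuous f) (fM : forall v, `|f v| <= M).

Lemma telescope_cells d r : \sum_(j < r) (F (d * j.+1%:R) - F (d * j%:R)) = F (d * r%:R).
Proof.
rewrite -(big_mkord xpredT (fun j => F (d * j.+1%:R) - F (d * j%:R))) telescope_sumr//.
by rewrite mulr0 F0 subr0.
Qed.

(** Each expectation is close to a finite sum of grid values of f weighted by the law of the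
    occupied set, and the two laws merge as n grows with the mesh fixed. The parameters are chosen
    in the order eta, kappa, K1, e, K, d. *)
Lemma good_arrays_compare :
  (fun n => Ex P setT (fun w => f (wrow k (points n (y n ^~ w)))) -
            Ex Q setT (fun w => f (wrow k (points n (y' n ^~ w))))) @ \oo --> (0 : R).
Proof.
have M0 : 0 <= M by apply: le_trans (fM 0).
have C0 : 0 < 3 + 16 * M by lra.
apply/cvgrPdist_lt => e0 e00.
(* Two approximations by cells cost eta + 8 M eta each, and the difference of the finite sums costs
   eta. *)
pose eta := e0 / (3 + 16 * M).
have eta0 : 0 < eta by rewrite divr_gt0.
have [kappa kappa0 Hk] := continuous_unif_box cf eta0.
have [K1 hK1] := Finf eta0.
(* The second entry makes the tail error e / exp (- K1) at most kappa / 4, where exp (- K1) is the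
   lower bound of the normaliser. *)
pose e := Num.min eta (kappa / 4 * expR (- K1%:R)).
have e_gt0 : 0 < e by rewrite lt_min eta0 mulr_gt0 ?expR_gt0// divr_gt0.
have [_ _ _ _ /(_ _ e_gt0)[K2 HK2]] := gy.
have [_ _ _ _ /(_ _ e_gt0)[K3 HK3]] := gy'.
pose K := maxn K1 (maxn K2 K3).
have FK0 : 0 <= F K%:R by rewrite -F0; apply: Fnd.
(* With increments at most eta / (F K + 1), the sum of their squares is at most that number times F
   K, hence at most eta. *)
have [h h0 Hh] : exists2 h, 0 < h & forall a b, 0 <= a -> a <= b -> b <= K%:R -> b - a <= h ->
    F b - F a <= eta / (F K%:R + 1).
  by apply: Fcont; rewrite divr_gt0//; lra.
have [g g0 Hg] : exists2 g, 0 < g & forall d, 0 < d -> d < g -> expR d - 1 < kappa / 4.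
  have := @continuous_expR R 0 => /cvgrPdist_lt/(_ (kappa / 4)).
  case; first by lra.
  move=> g /= g0 Hg; exists g => // d d0 dg.
  have := Hg d; rewrite /= sub0r normrN gtr0_norm// => /(_ dg).
  by rewrite expR0 distrC ger0_norm// subr_ge0 -expR0 ler_expR ltW.
have hg0 : 0 < Num.min h g by rewrite lt_min h0.
(* The mesh is the reciprocal of an integer, so that K1 and K are endpoints of cells. *)
have [N _ /(_ _ (leqnn N))/= HN] := near_infty_natSinv_lt (PosNum hg0).
rewrite lt_min in HN; case/andP: HN => dh dg.
set d := N.+1%:R^-1 in dh dg.
have d0 : 0 < d by rewrite invr_gt0.
pose r := (N.+1 * K)%N; pose r0 := (N.+1 * K1)%N.
have r0r : (r0 <= r)%N by rewrite leq_pmul2l// leq_maxl.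
have drK m : d * (N.+1 * m)%:R = m%:R by rewrite natrM mulrA mulVf ?mul1r.
have hk : expR d - 1 + e / expR (- (d * r0%:R)) < kappa.
  rewrite drK; have h1 := Hg d d0 dg.
  have h2 : e / expR (- K1%:R) <= kappa / 4.
    by rewrite ler_pdivrMr ?expR_gt0// ge_min lexx orbT.
  lra.
have hav : expR (- \sum_(j < r0) (F (d * j.+1%:R) - F (d * j%:R))) < eta.
  by rewrite telescope_cells drK.
have hdbl : \sum_(j < r) (F (d * j.+1%:R) - F (d * j%:R)) ^+ 2 <= eta.
  have step (j : 'I_r) : (F (d * j.+1%:R) - F (d * j%:R)) ^+ 2 <=
      eta / (F K%:R + 1) * (F (d * j.+1%:R) - F (d * j%:R)).
    have dj : d * j%:R <= d * j.+1%:R by rewrite ler_pM2l// ler_nat.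
    have dj0 : 0 <= d * j%:R by rewrite mulr_ge0// ltW.
    rewrite expr2; apply: ler_wpM2r; first by rewrite subr_ge0; exact: Fnd.
    apply: Hh => //; first by rewrite -(drK K) ler_pM2l// ler_nat.
    by rewrite -mulrBr -natr1 [_ + 1]addrC addrK mulr1 ltW.
  apply: le_trans (ler_sum _ (fun j _ => step j)) _.
  rewrite -mulr_sumr telescope_cells drK mulrAC ler_pdivrMr; last by lra.
  by rewrite ler_pM2l//; lra.
have tail1 : \forall n \near \oo, pr P [set w | e <= tailsum n K (y n ^~ w)] <= eta.
  have : (K2 <= K)%N by rewrite /K !leq_max leqnn !orbT.
  move=> /HK2; apply: filterS => n /le_trans; apply.
  by rewrite ge_min lexx.
have tail2 : \forall n \near \oo, pr Q [set w | e <= tailsum n K (y' n ^~ w)] <= eta.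
  have : (K3 <= K)%N by rewrite /K !leq_max leqnn !orbT.
  move=> /HK3; apply: filterS => n /le_trans; apply.
  by rewrite ge_min lexx.
have A1 := approx_by_cells gy cf fM eta0 d0 (drK K) r0r Hk hk hav hdbl tail1.
have A2 := approx_by_cells gy' cf fM eta0 d0 (drK K) r0r Hk hk hav hdbl tail2.
have A3 : (fun n => \sum_(B : {set 'I_r}) gridf f d B *
    (pr P [set w | occ (y n) n d r w = B] - pr Q [set w | occ (y' n) n d r w = B])) @ \oo --> (0 : R).
  apply: cvgr_sum0 => B _; rewrite -[X in _ --> X](mulr0 (gridf f d B)).
  by apply: cvgM; [exact: cvg_cst | exact: occ_cvg0].
move/cvgrPdist_lt: A3 => /(_ _ eta0) A3.
move: A1 A2 A3; apply: filterS3 => n a1 a2 a3.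
rewrite sub0r normrN.
rewrite sub0r normrN in a3.
have eE : e0 = 3 * eta + 16 * M * eta by rewrite -mulrDl mulrC /eta divfK// gt_eqF.
move: a1 a2 a3.
set E1 := Ex P _ _; set E2 := Ex Q _ _; set S1 := \sum_(_ | _) _; set S2 := \sum_(_ | _) _.
set S3 := \sum_(_ | _) _.
have -> : S3 = S1 - S2 by rewrite /S3 /S1 /S2 -sumrB; apply: eq_bigr => B _; rewrite mulrBr.
rewrite !ler_norml !ltr_norml eE => /andP[? ?] /andP[? ?] /andP[? ?].
apply/andP; split; lra.
Qed.

End TwoArrays.
End Comparison.

(** * Tail weight from polynomially growing mean counts *)

Section TailFromCounts.
Context {R : realType} {dT} {T : measurableType dT} (P : probability T R).

Lemma geometric_range (a : R) (K M : nat) : 0 <= a -> a < 1 ->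
  \sum_(K <= l < M) a ^+ l <= a ^+ K / (1 - a).
Proof.
move=> a0 a1; have d0 : 0 < 1 - a by rewrite subr_gt0.
rewrite ler_pdivlMr// mulr_suml.
have [KM|MK] := leqP K M; last first.
  by rewrite big_geq ?exprn_ge0// ltnW.
under eq_bigr => l _ do rewrite mulrBr mulr1 -exprSr.
under eq_bigr => l _ do rewrite -opprB.
by rewrite sumrN telescope_sumr// opprB gerBl exprn_ge0.
Qed.

Lemma ler_exprn (a b : R) n : 0 <= a -> a <= b -> a ^+ n <= b ^+ n.
Proof. by move=> a0 ab; apply: lerXn2r => //; rewrite nnegrE// (le_trans a0). Qed.

(** Half of the exponential decay of the weights is spent on the growth of the counts: l + 1 <= 2 (L
    + 1) (1 + x) with x = l / (2 (L + 1)), and (1 + x)^L <= exp (x L) <= exp (l / 2). *)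
Lemma polyn_le_exp L (l : nat) : l.+1%:R ^+ L <= (2 * L.+1%:R) ^+ L * expR (l%:R / 2) :> R.
Proof.
pose x : R := l%:R / (2 * L.+1%:R).
have L0 : 0 < L.+1%:R :> R by rewrite ltr0n.
have x0 : 0 <= x by rewrite divr_ge0// mulr_ge0// ltW.
apply: (@le_trans _ _ ((2 * L.+1%:R * (1 + x)) ^+ L)).
  apply: ler_exprn => //.
  have -> : 2 * L.+1%:R * (1 + x) = 2 * L.+1%:R + l%:R.
    by rewrite /x; field; rewrite gt_eqF.
  rewrite -natr1 addrC lerD2r -natrM ler1n//.
rewrite exprMn ler_wpM2l ?exprn_ge0 ?mulr_ge0 ?(ltW L0)//.
apply: (@le_trans _ _ (expR x ^+ L)).
  by apply: ler_exprn; [rewrite addr_ge0 | exact: expR_ge1Dx].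
rewrite -expRM_natl ler_expR /x.
rewrite -subr_ge0.
have -> : l%:R / 2 - L%:R * (l%:R / (2 * L.+1%:R)) = l%:R / (2 * L.+1%:R) :> R.
  have -> : L%:R = L.+1%:R - 1 :> R by rewrite -natr1 addrK.
  by field; rewrite gt_eqF.
exact: x0.
Qed.

Lemma tailsum_bound n K (y : nat -> T -> R) : (forall i, measurable_fun setT (y i)) ->
  bmf setT (fun w => tailsum n K (y ^~ w)).
Proof.
move=> my; split; first exact: measurable_tailsum.
exists n%:R => w _; rewrite ger0_norm; last by apply: sumr_ge0 => z _; exact: expR_ge0.
rewrite /tailsum /points big_map.
apply: le_trans (_ : \sum_(i <- iota 0 n) 1 <= _).
  rewrite big_mkcond; apply: ler_sum => i _; case: ifP => // Ky.
  by rewrite -expR0 ler_expR oppr_le0 (le_trans _ Ky).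
by rewrite big_const_seq count_predT size_iota iter_addr_0.
Qed.

(** A point y in [l, l + 1) has weight at most exp (- l) times the indicator of y < l + 1. Summing
    the mean counts over l >= K leaves a geometric tail of ratio exp (- 1/2) in the expectation, and
    Markov's inequality concludes. Layers beyond M are bounded crudely by n exp (- M). *)
Lemma tail_of_counts (y : nat -> nat -> T -> R) (C : R) (L : nat) :
  (forall n i, measurable_fun setT (y n i)) -> 0 <= C ->
  (\forall n \near \oo, forall l : nat,
     \sum_(i <- iota 0 n) pr P [set w | y n i w < l.+1%:R] <= C * l.+1%:R ^+ L) ->
  forall e : R, 0 < e -> exists K0 : nat, forall K, (K0 <= K)%N -> \forall n \near \oo,
      pr P [set w | e <= tailsum n K (y n ^~ w)] <= e.
Proof.
move=> my C0 cnt e e0.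
pose a : R := expR (- (1 / 2)).
have a0 : 0 <= a by exact: expR_ge0.
have a1 : a < 1 by rewrite -[ltRHS]expR0 ltr_expR; lra.
pose c : R := C * (2 * L.+1%:R) ^+ L.
have c0 : 0 <= c by rewrite mulr_ge0// exprn_ge0// mulr_ge0.
have key : \forall n \near \oo, forall K M : nat, (K <= M)%N ->
    Ex P setT (fun w => tailsum n K (y n ^~ w)) <= c * (a ^+ K / (1 - a)) + n%:R * expR (- M%:R).
  apply: filterS cnt => n cnt K M KM.
  have mi l i : measurable [set w | y n i w < l.+1%:R] by exact: measurable_setT_lt.
  have bi l i : bmf setT (\1_[set w | y n i w < l.+1%:R] : T -> R) by exact: bmf_indic.
  pose g l i w : R := expR (- l%:R) * \1_[set w | y n i w < l.+1%:R] w.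
  have bg l i : bmf setT (g l i) by apply: bmfM => //; exact: bmf_cst.
  have g0 l i w : 0 <= g l i w by rewrite mulr_ge0// expR_ge0.
  have bf i : bmf setT (fun w => \sum_(K <= l < M) g l i w).
    exact: bmf_sum.
  have b2 : bmf setT (fun w => \sum_(i <- iota 0 n)
     (\sum_(K <= l < M) g l i w + expR (- M%:R))).
    by apply: bmf_sum => i; apply: bmfD => //; exact: bmf_cst.
  apply: le_trans (Ex_le measurableT (PfinT P) (tailsum_bound n K (my n)) b2 _) _ => [w _|].
    rewrite /tailsum /points big_map big_mkcond; apply: ler_sum => i _.
    have s0 : 0 <= \sum_(K <= l < M) g l i w.
      exact: sumr_ge0.
    case: ifPn => [Ky|_]; last by rewrite addr_ge0// expR_ge0.
    have [My|yM] := leP M%:R (y n i w).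
      by apply: le_trans (_ : expR (- M%:R) <= _); [rewrite ler_expR lerN2 | rewrite lerDr].
    have y0 : 0 <= y n i w by apply: le_trans Ky.
    have /andP[l1 l2] := truncn_itv y0; set l := Num.truncn _ in l1 l2.
    have lM : (l < M)%N by rewrite -(ltr_nat R) (le_lt_trans l1).
    have Kl : (K <= l)%N by rewrite -ltnS -(ltr_nat R) (le_lt_trans Ky).
    apply: le_trans (_ : \sum_(K <= l < M) g l i w <= _); last first.
      by rewrite lerDl expR_ge0.
    rewrite (bigD1_seq l)//= ?mem_index_iota ?Kl// ?iota_uniq//.
    rewrite /g indicE mem_set// mulr1.
    apply: le_trans (_ : expR (- l%:R) <= _); first by rewrite ler_expR lerN2.
    by rewrite lerDl; apply: sumr_ge0 => j _; exact: g0.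
  rewrite Ex_sum//; [|exact: PfinT|by move=> i; apply: bmfD => //; exact: bmf_cst].
  under eq_bigr => i _.
    rewrite ExD//; [|exact: PfinT|exact: bmf_cst].
    rewrite Ex_cst// -/(pr P setT) prT mulr1.
    rewrite Ex_sum//; last exact: PfinT.
    under eq_bigr => l _ do rewrite ExZ ?PfinT// -pr_Ex//.
    over.
  rewrite big_split/= [X in _ + X]big_const_seq count_predT size_iota iter_addr_0 mulr_natl lerD2r.
  rewrite exchange_big/=.
  apply: le_trans (_ : \sum_(K <= l < M) c * a ^+ l <= _); last first.
    by rewrite -mulr_sumr ler_wpM2l// geometric_range.
  apply: ler_sum => l _; rewrite -mulr_sumr.
  apply: le_trans (ler_wpM2l (expR_ge0 _) (cnt l)) _.
  rewrite mulrCA /c -mulrA ler_wpM2l//.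
  apply: le_trans (ler_wpM2l (expR_ge0 _) (polyn_le_exp L l)) _.
  rewrite mulrCA ler_wpM2l ?exprn_ge0 ?mulr_ge0//.
  rewrite -expRD /a -expRM_natl ler_expR.
  lra.
have [K0 HK0] : exists K0 : nat, forall K, (K0 <= K)%N -> c * (a ^+ K / (1 - a)) <= e * e / 2.
  have : (fun K => c * (a ^+ K / (1 - a))) @ \oo --> c * (0 / (1 - a)).
    apply: cvgM; first exact: cvg_cst.
    apply: cvgM; last exact: cvg_cst.
    by apply: cvg_expr; rewrite ger0_norm.
  rewrite mul0r mulr0 => /cvgr_lt/(_ (e * e / 2)) [|K0 _ H].
    by rewrite divr_gt0// mulr_gt0.
  by exists K0 => K K0K; apply/ltW/H.
exists K0 => K K0K; apply: filterS key => n key.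
apply: le_trans (pr_markov P (tailsum_bound n K (my n)) _ e0) _.
  by move=> w; apply: sumr_ge0 => z _; exact: expR_ge0.
rewrite ler_pdivrMr//.
(* M may depend on n. Each of the two terms is at most e^2 / 2, so Markov's inequality at level e
   gives e. *)
have [M [KM hM]] : exists M : nat, (K <= M)%N /\ n%:R * expR (- M%:R) <= e * e / 2.
  have : (fun M : nat => n%:R * a ^+ M) @ \oo --> (n%:R * 0 : R).
    by apply: cvgM; [exact: cvg_cst | apply: cvg_expr; rewrite ger0_norm].
  rewrite mulr0 => /cvgr_lt/(_ (e * e / 2)) [|M0 _ H]; first by rewrite divr_gt0// mulr_gt0.
  exists (maxn K M0); split; first exact: leq_maxl.
  apply: le_trans (ltW (H (maxn K M0) (leq_maxr _ _))).
  rewrite /= ler_wpM2l// /a -expRM_natl ler_expR.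
  have : 0 <= (maxn K M0)%:R :> R by []. lra.
apply: le_trans (key K M KM) _.
have := HK0 K K0K; lra.
Qed.

End TailFromCounts.

(** * Poisson atoms *)

Section PoissonAtoms.
Context {R : realType} {dT} {T : measurableType dT} (Q : probability T R).
Variables (Lam : {measure set R -> \bar R}) (Y : nat -> T -> R) (F : R -> R).
Hypothesis hY : is_PPP_atoms Q Lam Y.
Hypothesis hLam : forall y : R, 0 <= y -> Lam `[0, y]%classic = (F y)%:E.
Hypotheses (F0 : F 0 = 0) (Fnd : forall a b : R, 0 <= a -> a <= b -> F a <= F b).
Hypothesis Fcont : forall (K : nat) (e : R), 0 < e -> exists2 h : R, 0 < h &
  forall a b : R, 0 <= a -> a <= b -> b <= K%:R -> b - a <= h -> F b - F a <= e.

Lemma Lam_oc (a b : R) : 0 <= a -> a <= b -> Lam `]a, b]%classic = (F b - F a)%:E.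
Proof.
move=> a0 ab; have b0 := le_trans a0 ab.
have : Lam `[0, b]%classic = (Lam `[0%R, a]%classic + Lam `]a, b]%classic)%E.
  rewrite -measureU//.
    by rewrite -itv_bndbnd_setU// bnd_simp.
  apply/seteqP; split => x //=; rewrite !in_itv/= => -[/andP[_ xa] /andP[ax _]].
  by move: (le_lt_trans xa ax); rewrite ltxx.
rewrite !hLam//; have := measure_ge0 Lam `]a, b]%classic.
case: (Lam `]a, b]%classic) => //= r _ [->]; congr EFin; ring.
Qed.

(** Continuity of F excludes atoms, so half-open cells get the increments of F whichever endpoint
    they contain. *)
Lemma Lam_set1 (t : R) : 0 <= t -> Lam [set t] = 0%E.
Proof.
move=> t0; apply/eqP; rewrite eq_le measure_ge0 andbT.
apply/lee_addgt0Pr => e e0; rewrite add0e.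
have [t00|tpos] := leP t 0.
  have <- : 0 = t by apply/le_anti; rewrite t0 t00.
  by rewrite -set_itv1 hLam// F0 lee_fin ltW.
have [h h0 H] := Fcont (Num.truncn t).+1 e0.
pose s := Num.max 0 (t - h).
have s0 : 0 <= s by rewrite le_max lexx.
have st : s < t by rewrite gt_max tpos ltrBlDr ltrDl.
apply: (@le_trans _ _ (Lam `]s, t]%classic)).
  by apply: le_measure; rewrite ?inE// => x ->; rewrite /= in_itv/= st lexx.
rewrite Lam_oc// ?(ltW st)// lee_fin; apply: H => //; rewrite ?(ltW st)//.
  by have /andP[_ /ltW] := truncn_itv t0.
by rewrite lerBlDr -lerBlDl le_max lexx orbT.
Qed.

Lemma Lam_co (a b : R) : 0 <= a -> a < b -> Lam `[a, b[%classic = (F b - F a)%:E.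
Proof.
move=> a0 ab; have b0 : 0 <= b by apply: le_trans a0 (ltW ab).
have h1 : Lam `[a, b]%classic = (F b - F a)%:E.
  rewrite -(@setU1itv _ _ _ _ false) ?bnd_simp ?ltW// measureU//.
    by rewrite [X in (X + _)%E]Lam_set1// add0e; apply: Lam_oc => //; exact: ltW.
  by apply/seteqP; split => x //= [->]; rewrite in_itv/= ltxx.
rewrite -h1 -[in RHS](@setUitv1 _ _ _ _ true) ?bnd_simp ?ltW// measureU//.
  by rewrite [X in (_ + X)%E]Lam_set1// adde0.
by apply/seteqP; split => x //= -[/[swap] ->]; rewrite in_itv/= ltxx andbF.
Qed.

Lemma poisson_count (B : set R) (c : nat) : measurable B -> B `<=` `[0, +oo[%classic ->
  (Lam B < +oo)%E ->
  pr Q [set w | @counting _ R [set i | B (Y i w)] = c%:R%:E] = poisson_pmfR (fine (Lam B)) c.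
Proof.
move=> mB B0 LB; have [_ [_ [_ H]]] := hY.
have := H 1%N (fun=> B) (fun=> c) (fun=> mB) (fun=> B0) (fun=> LB) _.
rewrite big_ord1 (_ : [set w | forall _, _] = [set w | @counting _ R [set i | B (Y i w)] = c%:R%:E]).
  by move=> h; rewrite /pr h// => j j'; rewrite !ord1 eqxx.
by apply/seteqP; split => w /= h => [|_]; [exact: (h ord0) | exact: h].
Qed.

Let my i : measurable_fun setT (Y i). Proof. by case: hY. Qed.

(** A series of indicators makes the count measurable, and its partial sums bound it from below;
    both hold even when the count is infinite. *)
Lemma counting_series (S : set nat) : @counting _ R S = (\sum_(i <oo) (\1_S i)%:E)%E.
Proof.
have -> : S = \bigcup_(i in S) [set i] by rewrite bigcup_imset1 image_id.
rewrite measure_bigcup//; last by move=> i j _ _ [k [/= -> ->]].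
rewrite bigcup_imset1 image_id eseries_mkcond.
apply: eq_eseriesr => i _; rewrite indicE; case: ifP => // _.
by rewrite -[LHS]/(@counting _ R [set i]) /counting asboolT// fset_set1 finmap.cardfs1.
Qed.

Lemma measurable_count (B : set R) (c : nat) : measurable B ->
  measurable [set w | @counting _ R [set i | B (Y i w)] = c%:R%:E].
Proof.
move=> mB; pose g w : \bar R := (\sum_(i <oo) (\1_(Y i @^-1` B) w : R)%:E)%E.
have mg : measurable_fun setT g.
  apply: ge0_emeasurable_sum => [i w _ _|i _].
    by rewrite lee_fin indicE.
  apply/measurable_EFinP; apply: measurable_indic.
  by rewrite -[X in measurable X]setTI; exact: my.
rewrite (_ : [set w | _] = setT `&` g @^-1` [set c%:R%:E]).
  by apply: mg => //; exact: emeasurable_set1.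
by rewrite setTI; apply/seteqP; split => w /=; rewrite counting_series.
Qed.

Lemma partial_count_le (B : set R) n w :
  ((\sum_(i <- iota 0 n) (\1_(Y i @^-1` B) w : R))%:E <= @counting _ R [set i | B (Y i w)])%E.
Proof.
rewrite counting_series -sumEFin; apply: (@le_trans _ _ (\sum_(0 <= i < n) (\1_[set i | B (Y i w)] i)%:E)%E).
  by rewrite /index_iota subn0.
by apply: nneseries_lim_ge.
Qed.

Lemma pmf_cvg (l : R) : (fun M => \sum_(0 <= c < M) poisson_pmfR l c) @ \oo --> (1 : R).
Proof.
rewrite (_ : (fun M => _) = fun M => series (exp_coeff l) M * expR (- l)).
  have := @cvgM _ _ _ _ _ _ _ _ (is_cvg_series_exp_coeff l) (cvg_cst (expR (- l))).
  by rewrite -/(expR l) -expRD subrr expR0; exact.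
by apply/funext => M; rewrite /series/= mulr_suml; apply: eq_bigr.
Qed.

Lemma pmf_mean (l : R) M : 0 <= l ->
  \sum_(0 <= c < M.+1) c%:R * poisson_pmfR l c = l * \sum_(0 <= c < M) poisson_pmfR l c.
Proof.
move=> l0; rewrite big_nat_recl//= mul0r add0r mulr_sumr; apply: eq_bigr => c _.
rewrite /poisson_pmfR factS natrM exprS.
have c0 : c.+1%:R != 0 :> R by rewrite pnatr_eq0.
have f0 : c`!%:R != 0 :> R by rewrite pnatr_eq0 -lt0n fact_gt0.
by field; rewrite f0 addrC natr1 c0.
Qed.

(** The hypothesis speaks of the law of total counts, not of single atoms. The number of hits among
    the first n atoms is at most the total count when that is below M, and at most n otherwise; the
    truncated Poisson mean plus n times the tail probability tends to [fine (Lam B)]. *)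
Lemma mean_count_le (B : set R) n : measurable B -> B `<=` `[0, +oo[%classic ->
  (Lam B < +oo)%E ->
  \sum_(i <- iota 0 n) pr Q (Y i @^-1` B) <= fine (Lam B).
Proof.
move=> mB B0 LB; set l := fine _.
have l0 : 0 <= l by exact: fine_ge0.
pose A c := [set w | @counting _ R [set i | B (Y i w)] = c%:R%:E].
have mA c : measurable (A c) by exact: measurable_count.
have prA c : pr Q (A c) = poisson_pmfR l c by exact: poisson_count.
have mYB i : measurable (Y i @^-1` B) by rewrite -[X in measurable X]setTI; exact: my.
have bA c : bmf setT (\1_(A c) : T -> R) by exact: bmf_indic.
have bcA (k : R) c : bmf setT (fun w => k * \1_(A c) w) by apply: bmfM => //; exact: bmf_cst.
have bY i : bmf setT (\1_(Y i @^-1` B) : T -> R) by exact: bmf_indic.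
have main M : \sum_(i <- iota 0 n) pr Q (Y i @^-1` B) <=
    \sum_(0 <= c < M) c%:R * poisson_pmfR l c + n%:R * (1 - \sum_(0 <= c < M) poisson_pmfR l c).
  under eq_bigr do rewrite pr_Ex//.
  rewrite -Ex_sum//; last exact: PfinT.
  have b1 : bmf setT (fun w => \sum_(0 <= c < M) c%:R * \1_(A c) w : R) by exact: bmf_sum.
  have b2 : bmf setT (fun w => \sum_(0 <= c < M) \1_(A c) w : R) by exact: bmf_sum.
  have b3 : bmf setT (fun w => 1 - \sum_(0 <= c < M) \1_(A c) w : R).
    by apply: bmfB => //; exact: bmf_cst.
  have b4 : bmf setT (fun w => n%:R * (1 - \sum_(0 <= c < M) \1_(A c) w) : R).
    by apply: bmfM => //; exact: bmf_cst.
  apply: le_trans (Ex_le measurableT (PfinT Q) _ (bmfD b1 b4) _) _.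
  - exact: bmf_sum.
  - move=> w _; have N_n : \sum_(i <- iota 0 n) (\1_(Y i @^-1` B) w : R) <= n%:R.
      apply: le_trans (_ : \sum_(i <- iota 0 n) 1 <= _).
        by apply: ler_sum => i _; rewrite indicE; case: (_ \in _).
      by rewrite big_const_seq count_predT size_iota iter_addr_0.
    (* The second case covers counts from M on, an infinite count included. *)
    have [[c cM Ac]|nA] := pselect (exists2 c, (c < M)%N & A c w).
      have dj c' : c' != c -> \1_(A c') w = 0 :> R.
        move=> cc; rewrite indicE memNset//= => Ac'; move: Ac; rewrite /A/= Ac' => -[/eqP].
        by rewrite eqr_nat (negbTE cc).
      have c1 : \1_(A c) w = 1 :> R by rewrite indicE mem_set.
      have s1 : \sum_(0 <= c < M) c%:R * \1_(A c) w = c%:R :> R.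
        rewrite (bigD1_seq c)/= ?mem_index_iota ?iota_uniq// c1 big1 ?mulr1 ?addr0//.
        by move=> c' cc; rewrite dj ?mulr0.
      have s2 : \sum_(0 <= c < M) \1_(A c) w = 1 :> R.
        rewrite (bigD1_seq c)/= ?mem_index_iota ?iota_uniq// c1 big1 ?addr0//.
      rewrite s1 s2 subrr mulr0 addr0.
      by have := partial_count_le B n w; rewrite Ac lee_fin.
    have z c : (c < M)%N -> \1_(A c) w = 0 :> R.
      by move=> cM; rewrite indicE memNset// => Ac; apply: nA; exists c.
    have s1 : \sum_(0 <= c < M) c%:R * \1_(A c) w = 0 :> R.
      by rewrite big_nat big1// => c /andP[_ cM]; rewrite z ?mulr0.
    have s2 : \sum_(0 <= c < M) \1_(A c) w = 0 :> R.
      by rewrite big_nat big1// => c /andP[_ cM]; rewrite z.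
    by rewrite s1 s2 add0r subr0 mulr1.
  rewrite ExD ?PfinT// ExZ ?PfinT// ExB ?PfinT//; last exact: bmf_cst.
  rewrite Ex_cst// -/(pr Q setT) prT mulr1 !Ex_sum ?PfinT//.
  under [X in X + _]eq_bigr do rewrite ExZ ?PfinT// -pr_Ex// prA.
  by under [X in _ + _ * (1 - X)]eq_bigr do rewrite -pr_Ex// prA.
have lim : (fun M => l * \sum_(0 <= c < M) poisson_pmfR l c +
    n%:R * (1 - \sum_(0 <= c < M.+1) poisson_pmfR l c)) @ \oo --> (l * 1 + n%:R * (1 - 1) : R).
  apply: cvgD; apply: cvgM; try exact: cvg_cst; first exact: pmf_cvg.
  apply: cvgB; first exact: cvg_cst.
  by rewrite (cvg_shiftS (fun M => \sum_(0 <= c < M) poisson_pmfR l c)); exact: pmf_cvg.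
rewrite -[leRHS](_ : l * 1 + n%:R * (1 - 1) = l); last by ring.
rewrite -(cvg_lim _ lim)//; apply: limr_ge; first by apply/cvg_ex; eexists; exact: lim.
by near=> M; rewrite -pmf_mean//; exact: main.
Unshelve. all: by end_near.
Qed.

End PoissonAtoms.

(** * The initial segments of the Poisson atoms as an array *)

Section PoissonArray.
Context {R : realType} {dT} {T : measurableType dT} (Q : probability T R).
Variables (Lam : {measure set R -> \bar R}) (Y : nat -> T -> R) (F : R -> R).
Hypothesis hY : is_PPP_atoms Q Lam Y.
Hypothesis hLam : forall y : R, 0 <= y -> Lam `[0, y]%classic = (F y)%:E.
Hypotheses (F0 : F 0 = 0) (Fnd : forall a b : R, 0 <= a -> a <= b -> F a <= F b).
Hypothesis Fcont : forall (K : nat) (e : R), 0 < e -> exists2 h : R, 0 < h &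
  forall a b : R, 0 <= a -> a <= b -> b <= K%:R -> b - a <= h -> F b - F a <= e.
Variables (C : R) (L : nat).
Hypotheses (C0 : 0 <= C) (Fpoly : forall l : nat, F l.+1%:R <= C * l.+1%:R ^+ L).

Let my i : measurable_fun setT (Y i). Proof. by case: hY. Qed.

Let Ypos i w : 0 < Y i w.
Proof.
have [_ [h0 [h1 _]]] := hY; elim: i => [|i IH]; first exact: h0.
exact: lt_trans IH (h1 w i).
Qed.

Lemma Lam_cells (d : R) r (B : {set 'I_r}) : 0 < d ->
  Lam [set z | exists2 j, j \in B & incell d (nat_of_ord j) z] =
  (\sum_(j in B) (F (d * j.+1%:R) - F (d * j%:R)))%:E.
Proof.
move=> d0.
have -> : [set z | exists2 j, j \in B & incell d (nat_of_ord j) z] =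
    \big[setU/set0]_(j < r | j \in B) `[d * (j : nat)%:R, d * j.+1%:R[%classic.
  rewrite -(bigcup_pred (mem B)); apply/seteqP; split => z [j] /= jB jz; exists j => //.
rewrite measure_bigsetU_ord_cond//.
  rewrite -sumEFin; apply: eq_bigr => j _.
  have dj : d * j%:R < d * j.+1%:R by rewrite ltr_pM2l// ltr_nat.
  have dj0 : 0 <= d * j%:R by rewrite mulr_ge0// ltW.
  exact: (Lam_co hLam F0 Fcont dj0 dj).
move=> i j _ _ [z [/=]]; rewrite !in_itv/= => /andP[a b] /andP[a' b'].
apply/val_inj/eqP; rewrite eqn_leq; apply/andP; split; rewrite -ltnS -(ltr_nat R) -(ltr_pM2l d0).
  exact: le_lt_trans b'.
exact: le_lt_trans b.
Qed.

(** Two atoms in a cell exclude the counts 0 and 1, and exp (- l) >= 1 - l gives 1 - exp (- l) (1 +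
    l) <= 1 - (1 - l) (1 + l) = l^2. *)
Lemma doubles_le n (d : R) j : 0 < d ->
  pr Q (doubles Y n d j) <= (F (d * j.+1%:R) - F (d * j%:R)) ^+ 2.
Proof.
move=> d0; set l := F _ - F _.
pose B : set R := `[d * j%:R, d * j.+1%:R[%classic.
have dj0 : 0 <= d * j%:R by rewrite mulr_ge0// ltW.
have djj : d * j%:R < d * j.+1%:R by rewrite ltr_pM2l// ltr_nat.
have LB : Lam B = l%:E by exact: (Lam_co hLam F0 Fcont).
have l0 : 0 <= l by rewrite subr_ge0 Fnd// ltW.
have mB : measurable B by exact: measurable_itv.
have B0 : B `<=` `[0, +oo[%classic.
  by move=> z; rewrite /B/= !in_itv/= andbT => /andP[+ _]; exact: le_trans.
have LBf : (Lam B < +oo)%E by rewrite LB ltry.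
pose A c := [set w | @counting _ R [set i | B (Y i w)] = c%:R%:E].
have mA c : measurable (A c) by exact: (measurable_count hY).
have prA c : pr Q (A c) = poisson_pmfR l c by rewrite (poisson_count hY)// LB.
have sub : doubles Y n d j `<=` ~` (A 0%N `|` A 1%N).
  move=> w [[a b]/= pab /andP[ia ib]].
  move: pab; rewrite mem_pairs => /andP[ab bn].
  have h2 : (2 <= \sum_(i <- iota 0 n) (\1_(Y i @^-1` B) w : R)).
    have s1 c : (c < n)%N -> \sum_(i <- iota 0 n) (i == c)%:R = 1 :> R.
      move=> cn; rewrite (bigD1_seq c) ?iota_uniq ?mem_iota//= eqxx big1 ?addr0//.
      by move=> i /negbTE ->.
    apply: le_trans (_ : \sum_(i <- iota 0 n) ((i == a)%:R + (i == b)%:R) <= _).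
      by rewrite big_split/= !s1// (ltn_trans ab).
    apply: ler_sum => i _; rewrite indicE.
    have [->|ia'] := eqVneq i a.
      by rewrite (ltn_eqF ab) addr0 mem_set//= in_itv.
    have [->|ib'] := eqVneq i b; first by rewrite add0r mem_set//= in_itv.
    by rewrite addr0 ler0n.
  have := partial_count_le Y B n w.
  move=> + [] h; rewrite h lee_fin => /(le_trans h2); by rewrite ler_nat.
apply: le_trans (pr_le Q _ _ sub) _.
- exact: measurable_doubles.
- by apply: measurableC; exact: measurableU.
rewrite prC; last exact: measurableU.
rewrite pr_disjU//; last first.
  by apply/seteqP; split => w //; rewrite /A/= => -[->] [] /eqP; rewrite eqr_nat.
rewrite !prA /poisson_pmfR expr0 expr1 !fact0 invr1 !mulr1 mul1r.
have := expR_ge1Dx (- l); set E := expR _ => hE.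
rewrite -subr_ge0.
have -> : l ^+ 2 - (1 - (E + l * E)) = (E - (1 - l)) * (1 + l) by ring.
by rewrite mulr_ge0 ?subr_ge0// addr_ge0.
Qed.

(** The avoidance events of the first n atoms decrease to the void event of the whole process, whose
    probability is explicit; continuity from above gives the limit. Doubles and tails are controlled
    uniformly in n by total counts. *)
Lemma ppp_good_array : good_array Q (fun=> Y) F.
Proof.
split.
- by [].
- by exists 0%N => n i w _; exact: ltW.
- move=> d r B d0.
  set l := \sum_(j in B) _.
  pose U := [set z | exists2 j, j \in B & incell d (nat_of_ord j) z].
  have LU : Lam U = l%:E by exact: Lam_cells.
  have mU : measurable U.
    apply: (@fin_bigcup_measurable _ _ _ [set` B]) => // j _; exact: (@measurable_setT_itv R _ _ id).
  have U0 : U `<=` `[0, +oo[%classic.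
    by move=> z [j _ /andP[h _]]; rewrite /= in_itv/= andbT (le_trans _ h)// mulr_ge0// ltW.
  have := poisson_count hY 0 mU U0; rewrite LU ltry => /(_ isT).
  rewrite /poisson_pmfR expr0 fact0 divr1 mul1r /= => <-.
  (* Atom i is seen by [avoids] from n = i + 1 on. *)
  have cap : [set w | @counting _ R [set i | U (Y i w)] = 0%:R%:E] = \bigcap_n avoids Y n d B.
    apply/seteqP; split => w /=.
      move=> h n _ i il j jB; apply/negP => ij.
      have := partial_count_le Y U i.+1 w.
      rewrite h lee_fin leNgt => /negP; apply.
      apply: lt_le_trans (_ : \1_(Y i @^-1` U) w <= _).
        by rewrite indicE mem_set// /U/=; exists j.
      apply: (@ler_sum_mem _ _ _ (fun i => \1_(Y i @^-1` U) w : R)); first by move=> k; rewrite indicE.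
      by rewrite mem_iota /= add0n.
    move=> h; rewrite (_ : [set i | _] = set0); first exact: measure0.
    apply/seteqP; split => i //= [j jB ij].
    have := h i.+1 I i; rewrite mem_iota /= add0n ltnS leqnn => /(_ isT j jB).
    by rewrite ij.
  rewrite cap; apply: fine_cvg; rewrite prE; last first.
    by apply: bigcapT_measurable => n; exact: measurable_avoids.
  apply: nonincreasing_cvg_mu.
  + by rewrite (le_lt_trans (probability_le1 _ _))// ?ltry//; exact: measurable_avoids.
  + by move=> n; exact: measurable_avoids.
  + by apply: bigcapT_measurable => n; exact: measurable_avoids.
  + move=> n m nm; apply/subsetPset => w H i; rewrite mem_iota => /andP[_ ilt].
    by apply: H; rewrite mem_iota /= add0n in ilt *; exact: leq_trans nm.
- by move=> d j e d0 e0; apply: nearW => n; apply: le_trans (doubles_le _ _ d0) _; rewrite lerDl ltW.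
- apply: (tail_of_counts (C := C) (L := L)) => //.
  apply: nearW => n l; apply: le_trans (Fpoly l).
  have LB : Lam `[0, l.+1%:R[%classic = (F l.+1%:R)%:E.
    by rewrite (Lam_co hLam F0 Fcont)// F0 subr0.
  rewrite -[leRHS]/(fine (F l.+1%:R)%:E) -LB.
  apply: le_trans (mean_count_le hY n _ _ _) => //; last by rewrite LB ltry.
    apply: ler_sum => i _; apply: pr_le.
    + exact: measurable_setT_lt.
    + by rewrite -[X in measurable X]setTI; exact: my.
    + by move=> w /= h; rewrite in_itv/= ltW.
  by move=> z; rewrite /= !in_itv/= andbT => /andP[].
Qed.

End PoissonArray.

(** * Passage to infinitely many atoms *)

Section PoissonWeights.
Context {R : realType}.

(* If the total weight is infinite both sides vanish in the limit, since then
   [fine +oo = 0] and division by zero gives zero. *)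
Lemma div_partial_sum_cvg (a : nat -> R) (x : R) : (forall j, 0 < a j) ->
  (fun n => x / \sum_(0 <= j < n) a j) @ \oo --> x / fine (\sum_(0 <= j <oo) (a j)%:E)%E.
Proof.
move=> a0.
have c : (fun n => (\sum_(0 <= j < n) (a j)%:E)%E) @ \oo --> (\sum_(0 <= j <oo) (a j)%:E)%E.
  by apply: is_cvg_nneseries => n _ _; rewrite lee_fin ltW.
have ge n : ((\sum_(0 <= j < n) (a j)%:E)%E <= \sum_(0 <= j <oo) (a j)%:E)%E.
  by apply: nneseries_lim_ge => i _ _; rewrite lee_fin ltW.
have E n : (\sum_(0 <= j < n) (a j)%:E)%E = (\sum_(0 <= j < n) a j)%:E by rewrite sumEFin.
have S1 n : 0 < \sum_(0 <= j < n.+1) a j.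
  rewrite big_nat_recl//=; apply: ltr_wpDr => //; apply: sumr_ge0 => j _; exact: ltW.
have {}c : EFin \o (fun n => \sum_(0 <= j < n) a j) @ \oo --> (\sum_(0 <= j <oo) (a j)%:E)%E.
  apply: cvg_trans c; apply: near_eq_cvg; apply: nearW => n; by rewrite /= E.
case L : (\sum_(0 <= j <oo) (a j)%:E)%E c ge => [l| |] c ge.
- apply: cvgM; first exact: cvg_cst.
  apply: cvgV.
    have := ge 1%N; rewrite E lee_fin; apply: contraTneq => /= ->.
    by rewrite -ltNge.
  exact: (fine_cvg c).
- rewrite /= invr0; apply: cvgM; first exact: cvg_cst.
  apply/(gtr0_cvgV0 (f := fun n => \sum_(0 <= j < n) a j)).
    by exists 1%N => // -[//|n] _; exact: S1.
  exact/cvgeryP.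
- by have := ge 0%N; rewrite leeNy_eq big_geq.
Qed.

Context {dT} {T : measurableType dT} (Q : probability T R).
Variables (Y : nat -> T -> R) (k : nat) (f : 'rV[R]_k -> R) (M : R).
Hypotheses (my : forall i, measurable_fun setT (Y i)) (Yinc : forall w i, Y i w < Y i.+1 w).
Hypotheses (cf : continuous f) (fM : forall v, `|f v| <= M).

(** Since the atoms increase, the weights of the first n are already sorted, and for n > i the i-th
    coordinate is exp (- Y_i) over a partial sum. *)
Lemma wrow_Wvec_cvg w : (fun n => f (wrow k (points n (Y ^~ w)))) @ \oo --> f (Wvec k Y w).
Proof.
have coord i : (fun n => wrow k (points n (Y ^~ w)) 0 i) @ \oo --> Wvec k Y w 0 i.
  rewrite /Wvec mxE.
  have := @div_partial_sum_cvg (fun j => expR (- Y j w)) (expR (- Y i w)) (fun j => expR_gt0 _).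
  apply: cvg_trans; apply: near_eq_cvg; near=> n.
  have i_n : (i < n)%N by near: n; exact: nbhs_infty_gt.
  rewrite mxE -/(os _ _) os_sorted.
    rewrite (nth_map 0) ?size_map ?size_iota// (nth_map 0%N) ?size_iota// nth_iota// add0n.
    by rewrite big_map /index_iota subn0.
  rewrite /wts /points -map_comp.
  apply: (homo_sorted (e := ltn)); last exact: iota_ltn_sorted.
  move=> a b ab /=; rewrite ler_wpM2r//.
    by rewrite invr_ge0; apply: sumr_ge0 => z _; exact: expR_ge0.
  rewrite ler_expR lerN2.
  have : {homo (Y ^~ w) : a b / (a < b)%N >-> a < b} by apply: homo_ltn => //; exact: lt_trans.
  by move=> /(_ _ _ ab)/ltW.
apply/cvgrPdist_lt => e e0.
have := @cf (Wvec k Y w) => /cvgrPdist_lt /(_ _ e0) /nbhs_ballP[h /= h0 Hh].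
have H : \forall n \near \oo, forall i, `|Wvec k Y w 0 i - wrow k (points n (Y ^~ w)) 0 i| < h.
  by apply: filter_forall => i; have := coord i => /cvgrPdist_lt; exact.
apply: filterS H => n H; apply: Hh; rewrite -ball_normE /=.
exact: rV_norm_lt.
Unshelve. all: by end_near.
Qed.

Lemma Ex_Wvec_cvg :
  (fun n => (Ex Q setT (fun w => f (wrow k (points n (Y ^~ w)))))%:E) @ \oo -->
  (\int[Q]_w (f (Wvec k Y w))%:E)%E.
Proof.
have mf n : measurable_fun setT (fun w => f (wrow k (points n (Y ^~ w)))) by exact: measurable_wrow.
have mW : measurable_fun setT (fun w => f (Wvec k Y w)).
  apply: (measurable_fun_cvg mf) => w _; exact: wrow_Wvec_cvg.
have [] := @dominated_convergence _ _ _ Q setT measurableT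
   (fun n w => (f (wrow k (points n (Y ^~ w))))%:E) (fun w => (f (Wvec k Y w))%:E) (cst M%:E).
- by move=> n; exact/measurable_EFinP.
- exact/measurable_EFinP.
- by apply: aeW => w _; apply: cvg_EFin; [exact: nearW | exact: wrow_Wvec_cvg].
- exact: finite_measure_integrable_cst.
- by apply: aeW => w n _; rewrite lee_fin.
move=> _ _; apply: cvg_trans; apply: near_eq_cvg; apply: nearW => n /=.
by rewrite ExE//; [exact: PfinT | split => //; exists M].
Qed.

End PoissonWeights.

(** * Measure of spherical caps *)

Section Invariance.
Context {d} {X : measurableType d} {R : realType}.

(** Change of variables for a function controlled on D only: it is extended by 0, which is harmless
    because phi preserves D. *)
Lemma Ex_invariant (mu : {measure set X -> \bar R}) (phi : X -> X) (D : set X) (f : X -> R) :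
  measurable D -> (mu D < +oo)%E -> measurable_fun setT phi ->
  (forall A, measurable A -> mu (phi @^-1` A) = mu A) -> phi @^-1` D = D ->
  bmf D f -> Ex mu D (f \o phi) = Ex mu D f.
Proof.
move=> mD muD mphi inv phiD bf; have [mf [M fM]] := bf.
pose g := f \_ D.
have mg : measurable_fun setT g by apply/(measurable_restrictT _ mD).
have gE x : D x -> g x = f x by move=> Dx; rewrite /g patchE mem_set.
have bg : bmf D (g \o phi).
  split; first by apply: measurable_funTS; exact: measurableT_comp.
  exists M => x Dx /=; rewrite gE ?fM//; by rewrite -phiD in Dx.
transitivity (Ex mu D g); last by apply: Ex_eq => x /gE.
transitivity (Ex mu D (g \o phi)).
  by apply: Ex_eq => x Dx /=; rewrite gE//; rewrite -phiD in Dx.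
rewrite /Ex /Rintegral; congr fine.
have := @integral_pushforward _ _ _ _ R phi mphi mu D (EFin \o g) _ _ mD.
rewrite phiD => <- //.
- by apply: eq_measure_integral => A mA _; exact: inv.
- exact/measurable_EFinP.
- exact: bmf_int bg.
Qed.

End Invariance.

Section Sphere.
Context {R : realType}.
Variable n : nat.
Implicit Types (x u v : @vec R n) (w : 'I_n -> R).

Definition dotf w x : R := \sum_(i < n) w i * tnth x i.

(** The Householder reflection in the hyperplane orthogonal to w. *)
Definition house w : 'M[R]_n :=
  \matrix_(i, j) ((i == j)%:R - 2 / (\sum_(l < n) w l ^+ 2) * w i * w j).

Lemma house_orthogonal w : \sum_(l < n) w l ^+ 2 != 0 -> orthogonal_mx (house w).
Proof.
move=> s0; set s := \sum_(l < n) w l ^+ 2 in s0.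
apply/matrixP => i j; rewrite !mxE.
under eq_bigr do rewrite !mxE.
pose c := 2 / s.
transitivity (\sum_k ((k == i)%:R * (k == j)%:R - c * w j * ((k == i)%:R * w k)
   - c * w i * ((k == j)%:R * w k) + c ^+ 2 * w i * w j * w k ^+ 2)).
  apply: eq_bigr => k _; rewrite -/s -/c; ring.
rewrite big_split/= !sumrB -!mulr_sumr -/s.
have D (F : 'I_n -> R) l : \sum_k (k == l)%:R * F k = F l.
  rewrite (bigD1 l)//= eqxx mul1r big1 ?addr0// => k /negbTE ->; by rewrite mul0r.
rewrite (D (fun k => (k == j)%:R)) !D.
rewrite /c; field.
by [].
Qed.

Lemma mapply_house w x i :
  tnth (mapply (house w) x) i = tnth x i - 2 / (\sum_(l < n) w l ^+ 2) * w i * dotf w x.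
Proof.
rewrite tnth_mktuple; under eq_bigr do rewrite mxE mulrBl.
rewrite sumrB; congr (_ - _).
  rewrite (bigD1 i)//= eqxx mul1r big1 ?addr0// => j ji.
  by rewrite eq_sym (negbTE ji) mul0r.
by rewrite /dotf mulr_sumr; apply: eq_bigr => j _; rewrite !mulrA.
Qed.

Lemma vdot_mapply (O : 'M[R]_n) x y : orthogonal_mx O -> vdot (mapply O x) (mapply O y) = vdot x y.
Proof.
move=> OO; rewrite /vdot.
under eq_bigr do rewrite !tnth_mktuple mulr_suml.
under eq_bigr => i _ do (under eq_bigr do rewrite mulr_sumr).
rewrite exchange_big/=; apply: eq_bigr => j _; rewrite exchange_big/=.
transitivity (\sum_(k < n) (j == k)%:R * (tnth x j * tnth y k)).
  apply: eq_bigr => k _; move/matrixP: (OO) => /(_ j k).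
  rewrite !mxE => <-; rewrite mulr_suml; apply: eq_bigr => i _; rewrite mxE; ring.
rewrite (bigD1 j)//= eqxx mul1r big1 ?addr0// => k kj.
by rewrite eq_sym (negbTE kj) mul0r.
Qed.

Lemma measurable_tnthR (i : 'I_n) : measurable_fun setT (fun x => tnth x i).
Proof. exact: measurable_tnth. Qed.

Lemma measurable_dotf w : measurable_fun setT (dotf w).
Proof.
apply: measurable_fun_sumr => i; apply: measurable_funM; first exact: measurable_cst.
exact: measurable_tnthR.
Qed.

Lemma measurable_vdot u : measurable_fun setT (vdot u).
Proof. exact: (measurable_dotf (tnth u)). Qed.

Lemma measurable_mapply (O : 'M[R]_n) : measurable_fun setT (mapply O).
Proof.
apply/measurable_fun_tnthP => i.
rewrite (_ : _ \o _ = dotf (O i)); first exact: measurable_dotf.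
by apply/funext => x /=; rewrite tnth_mktuple.
Qed.

Lemma measurable_sphere : measurable (@sphere R n).
Proof.
have m : measurable_fun setT (fun x => vdot x x).
  by apply: measurable_fun_sumr => i; apply: measurable_funM; exact: measurable_tnthR.
rewrite (_ : @sphere R n = setT `&` (fun x => vdot x x) @^-1` [set 1]); first exact: m.
by rewrite setTI.
Qed.

Lemma sphere_sum x : sphere x -> \sum_(i < n) tnth x i ^+ 2 = 1.
Proof. by move=> <-; apply: eq_bigr => i _; rewrite expr2. Qed.

Lemma sphere_tnth x i : sphere x -> tnth x i ^+ 2 <= 1.
Proof.
move=> /sphere_sum <-; rewrite (bigD1 i)//= lerDl; apply: sumr_ge0 => j _; exact: sqr_ge0.
Qed.

Lemma sphere_tnth_norm x i : sphere x -> `|tnth x i| <= 1.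
Proof. by move=> /(sphere_tnth i); rewrite -[X in X <= _]real_normK ?num_real// expr_le1. Qed.

Variable sigma : {measure set (@vec R n) -> \bar R}.
Hypothesis hs : is_surface_measure sigma.

Lemma sigma_fin : (sigma (@sphere R n) < +oo)%E.
Proof. by have [_ [-> _]] := hs; rewrite ltry. Qed.

Notation E := (Ex sigma (@sphere R n)).

Lemma bmf_tnth i : bmf (@sphere R n) (fun x => tnth x i).
Proof.
split; first by apply: measurable_funTS; exact: measurable_tnthR.
by exists 1 => x; exact: sphere_tnth_norm.
Qed.

Lemma E_mapply (O : 'M[R]_n) f : orthogonal_mx O -> bmf (@sphere R n) f ->
  E (fun x => f (mapply O x)) = E f.
Proof.
move=> OO bf; apply: (Ex_invariant (phi := mapply O)) => //.
- exact: measurable_sphere.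
- exact: sigma_fin.
- exact: measurable_mapply.
- by move=> A mA; have [_ [_ H]] := hs; exact: H.
- by apply/seteqP; split => x; rewrite /sphere/= vdot_mapply.
Qed.

(* The reflection exchanging the j-th basis vector and the unit vector u. *)
Lemma reflection_exists (j : 'I_n) u : sphere u -> exists2 O : 'M[R]_n, orthogonal_mx O &
  (forall x, tnth (mapply O x) j = vdot u x) /\
  (forall i x, i != j -> (1 - tnth u j) * tnth (mapply O x) i =
     (1 - tnth u j) * tnth x i + tnth u i * (tnth x j - vdot u x)).
Proof.
(* If the j-th coordinate is 1, then u is the basis vector itself and the identity serves; otherwise
   the reflection is the one along u minus the basis vector. The factor 1 - u_j lets one formula
   cover both cases. *)
move=> su; have [u1|u1] := eqVneq (tnth u j) 1.
  have u0 i : i != j -> tnth u i = 0.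
    move=> ij; have := sphere_sum su; rewrite (bigD1 j)//= (bigD1 i)//= u1 expr1n.
    move=> /eqP; rewrite -subr_eq0 addrAC subrr add0r => /eqP H.
    have : tnth u i ^+ 2 <= 0.
      by rewrite -H lerDl; apply: sumr_ge0 => k _; exact: sqr_ge0.
    by rewrite le_eqVlt ltNge sqr_ge0 orbF sqrf_eq0 => /eqP.
  exists 1%:M; first by rewrite /orthogonal_mx trmx1 mulmx1.
  have m1 x i : tnth (mapply 1%:M x) i = tnth x i.
    rewrite tnth_mktuple (bigD1 i)//= mxE eqxx mul1r big1 ?addr0// => k ki.
    by rewrite mxE eq_sym (negbTE ki) mul0r.
  split => [x|i x ij].
    rewrite m1 /vdot (bigD1 j)//= u1 mul1r big1 ?addr0// => k kj.
    by rewrite u0// mul0r.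
  by rewrite m1 (u0 _ ij) mul0r addr0.
pose w i := tnth u i - (i == j)%:R.
have sw : \sum_(l < n) w l ^+ 2 = 2 * (1 - tnth u j).
  rewrite /w (bigD1 j)//= eqxx.
  under eq_bigr => i /negbTE -> do rewrite subr0.
  have := sphere_sum su; rewrite (bigD1 j)//=; set S := \sum_(_ | _) _ => /eqP.
  rewrite addrC eq_sym -subr_eq => /eqP <-; rewrite mulr1n; ring.
have u10 : 1 - tnth u j != 0 by rewrite subr_eq0 eq_sym.
exists (house w); first by apply: house_orthogonal; rewrite sw mulf_neq0 ?pnatr_eq0.
have dw x : dotf w x = vdot u x - tnth x j.
  rewrite /dotf /w /vdot; under eq_bigr do rewrite mulrBl.
  rewrite sumrB; congr (_ - _).
  rewrite (bigD1 j)//= eqxx mul1r big1 ?addr0// => k /negbTE ->; by rewrite mul0r.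
split => [x|i x ij]; rewrite mapply_house sw dw /w ?eqxx ?(negbTE ij) /=.
  field; by rewrite u10.
field; by rewrite u10.
Qed.

End Sphere.

(** * Stein's identity from reflection invariance *)

Section SteinIdentity.
Context {R : realType}.
Variable n : nat.
Implicit Types (x u v : @vec R n).
Variable sigma : {measure set (@vec R n) -> \bar R}.
Hypothesis hs : is_surface_measure sigma.
Variable i0 : 'I_n.

Local Notation S := (@sphere R n).
Local Notation E := (Ex sigma S).
Local Notation x0 x := (tnth x i0).

Let mS : measurable S. Proof. exact: measurable_sphere. Qed.
Let sS : (sigma S < +oo)%E. Proof. exact: sigma_fin. Qed.

Definition mass : R := fine (sigma S).

Lemma mass_ge0 : 0 <= mass. Proof. exact: fine_ge0. Qed.

Lemma bmf_comp (g : R -> R) (y : @vec R n -> R) (G : R) : measurable_fun setT g ->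
  measurable_fun setT y ->
  (forall x, S x -> `|y x| <= 1) -> (forall a, `|a| <= 1 -> `|g a| <= G) ->
  bmf S (fun x => g (y x)).
Proof.
move=> mg my y1 gG; split; first by apply: measurable_funTS; exact: measurableT_comp.
by exists G => x Sx; apply: gG; exact: y1.
Qed.

Lemma E_flip (f : R -> R -> R) j : j != i0 ->
  bmf S (fun x => f (x0 x) (tnth x j)) ->
  E (fun x => f (x0 x) (- tnth x j)) = E (fun x => f (x0 x) (tnth x j)).
Proof.
move=> j0 bf.
pose u : @vec R n := [tuple - (i == j)%:R | i < n].
have su : sphere u.
  rewrite /sphere/= /vdot (bigD1 j)//= !tnth_mktuple eqxx mulrNN mulr1 big1 ?addr0// => k kj.
  by rewrite tnth_mktuple (negbTE kj) oppr0 mul0r.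
have [U UU [Oj Oi]] := reflection_exists j su.
rewrite -(E_mapply hs UU bf); apply: Ex_eq => x Sx.
have -> : tnth (mapply U x) j = - tnth x j.
  rewrite Oj /vdot (bigD1 j)//= tnth_mktuple eqxx mulN1r big1 ?addr0// => k kj.
  by rewrite tnth_mktuple (negbTE kj) oppr0 mul0r.
congr (f _ _); have ij : i0 != j by rewrite eq_sym.
have := Oi i0 x ij; rewrite !tnth_mktuple eqxx (negbTE ij) oppr0 mul0r addr0.
by move/mulfI => -> //; rewrite opprK (_ : 1 + 1 = 2)// pnatr_eq0.
Qed.

Lemma E_odd (g : R -> R) G j : j != i0 -> measurable_fun setT g ->
  (forall a, `|a| <= 1 -> `|g a| <= G) -> E (fun x => g (x0 x) * tnth x j) = 0.
Proof.
move=> j0 mg gG.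
have bg : bmf S (fun x => g (x0 x) * tnth x j).
  apply: bmfM; last exact: bmf_tnth.
  apply: bmf_comp mg _ _ gG; first exact: measurable_tnthR.
  by move=> x; exact: sphere_tnth_norm.
have := @E_flip (fun a b => g a * b) j j0 bg.
rewrite (_ : Ex _ _ _ = - E (fun x => g (x0 x) * tnth x j)); last first.
  rewrite -[RHS]mulN1r -ExZ//; apply: Ex_eq => x _; ring.
lra.
Qed.

Lemma vdot_plane (c s : R) j x : j != i0 ->
  vdot [tuple c * (i == i0)%:R + s * (i == j)%:R | i < n] x = c * x0 x + s * tnth x j.
Proof.
move=> j0; rewrite /vdot (bigD1 i0)//= (bigD1 j)//= !tnth_mktuple !eqxx big1 ?addr0.
  by rewrite (negbTE j0) eq_sym (negbTE j0) /=; ring.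
by move=> k /andP[k0 kj]; rewrite tnth_mktuple (negbTE k0) (negbTE kj) !mulr0 addr0 mul0r.
Qed.

(** The reflection taken along the vector c e_i0 + s e_j fixes all other coordinates and acts in
    this plane by (a, b) -> (c a + s b, s a - c b). The condition c != 1 permits dividing by the
    factor in [reflection_exists]. *)
Lemma E_plane (f : R -> R -> R) (c s : R) j : j != i0 -> c ^+ 2 + s ^+ 2 = 1 -> c != 1 ->
  bmf S (fun x => f (x0 x) (tnth x j)) ->
  E (fun x => f (c * x0 x + s * tnth x j) (s * x0 x - c * tnth x j)) =
  E (fun x => f (x0 x) (tnth x j)).
Proof.
move=> j0 cs c1 bf.
pose u : @vec R n := [tuple c * (i == i0)%:R + s * (i == j)%:R | i < n].
have u0 : tnth u i0 = c by rewrite tnth_mktuple eqxx [i0 == j]eq_sym (negbTE j0) /=; ring.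
have uj : tnth u j = s by rewrite tnth_mktuple eqxx (negbTE j0) /=; ring.
have su : sphere u by rewrite /sphere/= vdot_plane// u0 uj -cs; ring.
have [U UU [U0 Ui]] := reflection_exists i0 su.
rewrite -(E_mapply hs UU bf); apply: Ex_eq => x Sx.
rewrite U0 vdot_plane//; congr (f _ _).
have := Ui j x j0; rewrite u0 uj vdot_plane// => H.
have c10 : 1 - c != 0 by rewrite subr_eq0 eq_sym.
apply: (mulfI c10); rewrite H.
apply/eqP; rewrite -subr_eq0; apply/eqP.
have -> : (1 - c) * (s * x0 x - c * tnth x j) - ((1 - c) * tnth x j + s * (x0 x - (c * x0 x + s * tnth x j)))
   = (c ^+ 2 + s ^+ 2 - 1) * tnth x j by ring.
by rewrite cs subrr mul0r.
Qed.

Variables (g dg : R -> R) (G C : R).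
Hypotheses (mg : measurable_fun setT g) (mdg : measurable_fun setT dg).
Hypotheses (gG : forall a, `|a| <= 1 -> `|g a| <= G) (dgG : forall a, `|a| <= 1 -> `|dg a| <= G).
(** A quadratic Taylor bound stands for differentiability with Lipschitz derivative; it admits
    squares of truncated functions. *)
Hypothesis gC : forall a b, `|a| <= 1 -> `|b| <= 1 ->
  `|g b - g a - dg a * (b - a)| <= C * (b - a) ^+ 2.

Let G0 : 0 <= G. Proof. by apply: le_trans (gG (a := 0) _); rewrite ?normr0. Qed.
Let C0 : 0 <= C.
Proof.
have h0 : `|0 : R| <= 1 by rewrite normr0.
have h1 : `|1 : R| <= 1 by rewrite normr1.
by have := gC h0 h1; rewrite subr0 expr1n [C * 1]mulr1; exact: le_trans (normr_ge0 _).
Qed.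

Lemma bmf_g0 : bmf S (fun x => g (x0 x)).
Proof.
apply: bmf_comp mg _ _ gG; first exact: measurable_tnthR.
by move=> x; exact: sphere_tnth_norm.
Qed.

Lemma bmf_dg0 : bmf S (fun x => dg (x0 x)).
Proof.
apply: bmf_comp mdg _ _ dgG; first exact: measurable_tnthR.
by move=> x; exact: sphere_tnth_norm.
Qed.

(** Infinitesimal invariance: E [g (x0) x_j] vanishes by symmetry, and so does its image E
    [g (y) (s x0 - c x_j)] with y = c x0 + s x_j. The first-order term of this relation in s is the
    claim. *)
Lemma stein_plane j : j != i0 ->
  E (fun x => dg (x0 x) * tnth x j ^+ 2) = E (fun x => g (x0 x) * x0 x).
Proof.
move=> j0.
set A := E (fun x => dg _ * _); set B := E _.
have bx i : bmf S (fun x => tnth x i) by exact: bmf_tnth.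
have m0 := mass_ge0.
pose K := (2 * G + 8 * C) * mass.
have K0 : 0 <= K by rewrite mulr_ge0// addr_ge0// mulr_ge0.
(* The expansion is done at finite s with an explicit error, and s is then taken small. *)
suff H s : 0 < s -> s <= 1 -> `|A - B| <= s * (`|A| + K).
  apply/eqP; rewrite -subr_eq0 -normr_le0.
  apply/ler_addgt0Pl => e e0; rewrite addr0.
  have d0 : 0 < `|A| + K + 1 by have := normr_ge0 A; lra.
  pose s := Num.min 1 (e / (`|A| + K + 1)).
  have s0 : 0 < s by rewrite lt_min ltr01 divr_gt0.
  have s1 : s <= 1 by rewrite ge_min lexx.
  apply: le_trans (H s s0 s1) _.
  apply: (@le_trans _ _ (s * (`|A| + K + 1))); first by rewrite ler_pM2l// lerDl.
  by rewrite -ler_pdivlMr// ge_min lexx orbT.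
move=> s0 s1; pose c := Num.sqrt (1 - s ^+ 2).
have s21 : s ^+ 2 <= 1 by rewrite expr_le1// ltW.
have cE : c ^+ 2 = 1 - s ^+ 2 by rewrite sqr_sqrtr// subr_ge0.
have c0 : 0 <= c by exact: sqrtr_ge0.
have c1 : c < 1 by rewrite -(@ltr_pXn2r _ 2)// ?nnegrE// expr1n cE gtrBl exprn_gt0.
have cs : 1 - c <= s.
  have : (1 - c) * (1 + c) = s ^+ 2 by rewrite -[RHS](subKr 1) -cE; ring.
  have : s ^+ 2 <= s by rewrite expr2 -[leRHS]mul1r ler_pM2r.
  have : 0 <= (1 - c) * c by rewrite mulr_ge0// subr_ge0 ltW.
  lra.
pose y x := c * x0 x + s * tnth x j.
have y1 x : S x -> `|y x| <= 1.
  move=> Sx; rewrite -(@expr_le1 _ 2)// real_normK ?num_real//.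
  have h : x0 x ^+ 2 + tnth x j ^+ 2 <= 1.
    rewrite -(sphere_sum Sx) (bigD1 i0)//= (bigD1 j)//= addrA lerDl.
    by apply: sumr_ge0 => k _; exact: sqr_ge0.
  apply: le_trans h; rewrite /y -subr_ge0.
  have -> : x0 x ^+ 2 + tnth x j ^+ 2 - (c * x0 x + s * tnth x j) ^+ 2 =
    (s * x0 x - c * tnth x j) ^+ 2 + (1 - s ^+ 2 - c ^+ 2) * (x0 x ^+ 2 + tnth x j ^+ 2) by ring.
  by rewrite cE subrr mul0r addr0 sqr_ge0.
have my : measurable_fun setT y.
  by apply: measurable_funD; apply: measurable_funM; (exact: measurable_cst || exact: measurable_tnthR).
have bgy : bmf S (fun x => g (y x)) by exact: bmf_comp mg my y1 gG.
have bg0 := bmf_g0; have bdg0 := bmf_dg0.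
have dyx x : S x -> (y x - x0 x) ^+ 2 <= 4 * s ^+ 2.
  move=> Sx; have h0 := sphere_tnth_norm i0 Sx; have hj := sphere_tnth_norm j Sx.
  have : `|y x - x0 x| <= 2 * s.
    have -> : y x - x0 x = - ((1 - c) * x0 x) + s * tnth x j by rewrite /y; ring.
    apply: le_trans (ler_normD _ _) _; rewrite normrN !normrM (gtr0_norm s0) (ger0_norm (x := 1 - c)); last by lra.
    have h1 : (1 - c) * `|x0 x| <= s * 1 by apply: ler_pM => //; lra.
    have h2 : s * `|tnth x j| <= s * 1 by rewrite ler_pM2l.
    lra.
  rewrite -real_normK ?num_real// => h.
  have -> : 4 * s ^+ 2 = (2 * s) ^+ 2 by ring.
  by apply: lerXn2r; rewrite ?nnegrE// mulr_ge0// ltW.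
(* The exact relation, from the vanishing of E [g (x0) x_j]. *)
have step1 : c * E (fun x => g (y x) * tnth x j) = s * E (fun x => g (y x) * x0 x).
  have e0 := @E_plane (fun a b => g a * b) c s j j0 _ _ (bmfM bg0 (bx j)).
  have := e0 _ _; rewrite (E_odd j0 mg gG) => /(_ _ _)H.
  have {}H : E (fun x => g (y x) * (s * x0 x - c * tnth x j)) = 0.
    by apply: H; [rewrite cE subrK | rewrite lt_eqF].
  have : E (fun x => s * (g (y x) * x0 x) - c * (g (y x) * tnth x j)) = 0.
    rewrite -H; apply: Ex_eq => x _; ring.
  rewrite ExB// ?ExZ//; try exact: bmfM; try by apply: bmfM; [exact: bmf_cst | exact: bmfM].
  by move/eqP; rewrite subr_eq0 => /eqP ->.
(* Taylor's bound at x0: the terms g (x0) x_j and (c - 1) dg (x0) x0 x_j are odd in x_j and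
   integrate to 0, so only s dg (x0) x_j^2 remains. *)
have step2 : `|E (fun x => g (y x) * tnth x j) - s * A| <= 4 * C * s ^+ 2 * mass.
  have b1 : bmf S (fun x => dg (x0 x) * x0 x) by exact: bmfM.
  have mb1 : measurable_fun setT (fun a => dg a * a) by apply: measurable_funM.
  have b1G a : `|a| <= 1 -> `|dg a * a| <= G.
    by move=> a1; rewrite normrM -[leRHS]mulr1 ler_pM// dgG.
  have -> : s * A = E (fun x => g (x0 x) * tnth x j + (c - 1) * ((dg (x0 x) * x0 x) * tnth x j)
      + s * (dg (x0 x) * tnth x j ^+ 2)).
    rewrite !ExD ?ExZ//; try exact: bmfM; try by apply: bmfM => //; exact: bmfX;
      try by apply: bmfM; [exact: bmf_cst|apply: bmfM => //; exact: bmfX].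
    - rewrite (E_odd j0 mg gG) (E_odd (g := fun a => dg a * a) j0 mb1 b1G).
      by rewrite mulr0 !add0r.
    - by apply: bmfM; [exact: bmf_cst|apply: bmfM].
    - apply: bmfD; first exact: bmfM.
      by apply: bmfM; [exact: bmf_cst|apply: bmfM].
    - by apply: bmfM; [exact: bmf_cst|apply: bmfM => //; exact: bmfX].
  have bR : bmf S (fun x => g (x0 x) * tnth x j + (c - 1) * ((dg (x0 x) * x0 x) * tnth x j)
      + s * (dg (x0 x) * tnth x j ^+ 2)).
    apply: bmfD; last by apply: bmfM; [exact: bmf_cst|apply: bmfM => //; exact: bmfX].
    apply: bmfD; first exact: bmfM.
    by apply: bmfM; [exact: bmf_cst|apply: bmfM].
  rewrite -[leRHS](Ex_cst sigma mS).
  apply: Ex_dist => //; [exact: bmfM | exact: bmf_cst |].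
  move=> x Sx; have h0 := sphere_tnth_norm i0 Sx; have hj := sphere_tnth_norm j Sx.
  have -> : g (y x) * tnth x j - (g (x0 x) * tnth x j + (c - 1) * (dg (x0 x) * x0 x * tnth x j) +
      s * (dg (x0 x) * tnth x j ^+ 2)) = (g (y x) - g (x0 x) - dg (x0 x) * (y x - x0 x)) * tnth x j.
    by set gy := g (y x); rewrite /y; ring.
  rewrite normrM -[leRHS]mulr1; apply: ler_pM => //.
  apply: le_trans (gC h0 (y1 _ Sx)) _.
  by rewrite [4 * C]mulrC -mulrA ler_wpM2l// dyx.
have step3 : `|E (fun x => g (y x) * x0 x) - B| <= (2 * G * s + 4 * C * s ^+ 2) * mass.
  rewrite -[leRHS](Ex_cst sigma mS).
  apply: Ex_dist => //; [exact: bmfM | exact: bmfM | exact: bmf_cst |].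
  move=> x Sx; have h0 := sphere_tnth_norm i0 Sx.
  rewrite -mulrBl normrM -[leRHS]mulr1; apply: ler_pM => //.
  have -> : g (y x) - g (x0 x) = dg (x0 x) * (y x - x0 x) + (g (y x) - g (x0 x) - dg (x0 x) * (y x - x0 x)).
    by ring.
  apply: le_trans (ler_normD _ _) _; apply: lerD; last first.
    apply: le_trans (gC h0 (y1 _ Sx)) _.
    by rewrite [4 * C]mulrC -mulrA ler_wpM2l// dyx.
  rewrite normrM [2 * G]mulrC -mulrA; apply: ler_pM => //; first exact: dgG.
  rewrite -(@ler_pXn2r _ 2)// ?nnegrE//; last by rewrite mulr_ge0// ltW.
  by rewrite real_normK ?num_real// exprMn (_ : 2 ^+ 2 = 4 :> R) ?dyx//; ring.
set P1 := E _ in step1 step2; set P2 := E _ in step1 step3.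
have cAB : `|c * A - B| <= s * K.
  have : `|s * (c * A - B)| <= s * (s * K).
    have -> : s * (c * A - B) = (s * P2 - s * B) - c * (P1 - s * A) by rewrite -step1; ring.
    apply: le_trans (ler_normB _ _) _; rewrite -mulrBr !normrM (gtr0_norm s0) (ger0_norm c0).
    have h1 : s * `|P2 - B| <= s * ((2 * G * s + 4 * C * s ^+ 2) * mass) by rewrite ler_pM2l.
    have h2 : c * `|P1 - s * A| <= 1 * (4 * C * s ^+ 2 * mass) by apply: ler_pM => //; exact: ltW.
    have h3 : 0 <= C * s ^+ 2 * mass * (1 - s).
      by rewrite mulr_ge0 ?subr_ge0// mulr_ge0// mulr_ge0// sqr_ge0.
    rewrite -subr_ge0.
    have -> : s * (s * K) - (s * `|P2 - B| + c * `|P1 - s * A|) =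
      (s * ((2 * G * s + 4 * C * s ^+ 2) * mass) - s * `|P2 - B|) +
      (1 * (4 * C * s ^+ 2 * mass) - c * `|P1 - s * A|) + 4 * (C * s ^+ 2 * mass * (1 - s)).
      by rewrite /K; ring.
    apply: addr_ge0; last by rewrite mulr_ge0.
    by apply: addr_ge0; rewrite subr_ge0.
  by rewrite normrM (gtr0_norm s0) ler_pM2l.
have -> : A - B = (1 - c) * A + (c * A - B) by ring.
apply: le_trans (ler_normD _ _) _; rewrite mulrDr; apply: lerD => //.
by rewrite normrM ger0_norm ?subr_ge0 ?(ltW c1)// ler_wpM2r.
Qed.

(** On the sphere 1 - x0^2 is the sum of the squares of the n - 1 other coordinates, and each of
    them contributes the same amount by [stein_plane]. *)
Lemma stein : E (fun x => dg (x0 x) * (1 - x0 x ^+ 2)) = n.-1%:R * E (fun x => g (x0 x) * x0 x).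
Proof.
transitivity (\sum_(j < n | j != i0) E (fun x => dg (x0 x) * tnth x j ^+ 2)).
  rewrite -Ex_sum//; last first.
    by move=> j; apply: bmfM; [exact: bmf_dg0 | apply: bmfX; exact: bmf_tnth].
  apply: Ex_eq => x Sx; rewrite -mulr_sumr; congr (_ * _).
  by rewrite -(sphere_sum Sx) (bigD1 i0)//= addrAC subrr add0r.
rewrite (eq_bigr (fun=> E (fun x => g (x0 x) * x0 x))); last by move=> j /stein_plane.
rewrite sumr_const mulr_natl; congr (_ *+ _).
have := cardC1 i0; rewrite card_ord => <-; apply: eq_card => j; by rewrite !inE.
Qed.

End SteinIdentity.

(** * Truncated powers, and derivatives from secant bounds *)

Section RealFacts.
Context {R : realType}.
Implicit Types (a v s : R).

Definition pospart a : R := Num.max a 0.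
Definition sqexcess v a : R := Num.max (pospart a ^+ 2 - v) 0.

Lemma pospart_ge0 a : 0 <= pospart a. Proof. by rewrite le_max lexx orbT. Qed.
Lemma sqexcess_ge0 v a : 0 <= sqexcess v a. Proof. by rewrite le_max lexx orbT. Qed.

Lemma pospart_le1 a : `|a| <= 1 -> pospart a <= 1.
Proof. by move=> a1; rewrite ge_max ler01 andbT (le_trans (ler_norm _)). Qed.

Lemma pospart_dist a b : (pospart b - pospart a) ^+ 2 <= (b - a) ^+ 2.
Proof.
rewrite /pospart; have [a0|a0] := leP a 0; have [b0|b0] := leP b 0; rewrite ?subr0 ?sub0r ?sqrrN//.
- by rewrite expr0n/= sqr_ge0.
- by apply: lerXn2r; rewrite ?nnegrE; lra.
- by rewrite -[leRHS]sqrrN; apply: lerXn2r; rewrite ?nnegrE; lra.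
Qed.

Lemma sqexcess_le1 v a : 0 <= v -> `|a| <= 1 -> sqexcess v a <= 1.
Proof.
move=> v0 a1; rewrite ge_max ler01 andbT.
have : pospart a ^+ 2 <= 1 by rewrite expr_le1 ?pospart_ge0 ?pospart_le1.
lra.
Qed.

(** The kink of [sqexcess] disappears on squaring, since value and derivative of the square both
    vanish where a_+^2 = v. The constant 12 is crude and covers all four sign cases. *)
Lemma sqexcess_taylor v a b : 0 <= v -> v <= 1 -> `|a| <= 1 -> `|b| <= 1 ->
  `|sqexcess v b ^+ 2 - sqexcess v a ^+ 2 - 4 * pospart a * sqexcess v a * (b - a)| <= 12 * (b - a) ^+ 2.
Proof.
move=> v0 v1 a1 b1.
have pa := pospart_ge0 a; have pb := pospart_ge0 b; have pa1 := pospart_le1 a1; have pb1 := pospart_le1 b1.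
have d := pospart_dist a b; have d0 := sqr_ge0 (b - a).
have sq (p q : R) : 0 <= p -> p <= q -> q <= 1 -> (q ^+ 2 - p ^+ 2) ^+ 2 <= 4 * (q - p) ^+ 2.
  move=> p0 pq q1.
  have -> : (q ^+ 2 - p ^+ 2) ^+ 2 = (q + p) ^+ 2 * (q - p) ^+ 2 by ring.
  apply: ler_wpM2r; first exact: sqr_ge0.
  by rewrite (_ : 4 = 2 ^+ 2); [apply: lerXn2r; rewrite ?nnegrE; lra | ring].
rewrite /sqexcess; have [av|av] := leP (pospart a ^+ 2 - v) 0; have [bv|bv] := leP (pospart b ^+ 2 - v) 0.
- by rewrite expr0n/= mulr0 mul0r !subr0 normr0 mulr_ge0.
- rewrite expr0n/= mulr0 mul0r !subr0 ger0_norm ?sqr_ge0//.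
  have pab : pospart a <= pospart b.
    by rewrite -(@ler_pXn2r _ 2)// ?nnegrE//; lra.
  have := sq _ _ pa pab pb1 => h.
  have : (pospart b ^+ 2 - v) ^+ 2 <= (pospart b ^+ 2 - pospart a ^+ 2) ^+ 2.
    by apply: lerXn2r; rewrite ?nnegrE; lra.
  lra.
- have pab : pospart b <= pospart a.
    by rewrite -(@ler_pXn2r _ 2)// ?nnegrE//; lra.
  have apos : pospart a = a.
    rewrite /pospart; case: leP => // a0.
    by move: av; rewrite /pospart max_r// expr0n/=; lra.
  have bpb : b <= pospart b by rewrite /pospart le_max lexx.
  have bale : b <= a by rewrite -apos; exact: le_trans pab.
  have h := sq _ _ pb pab pa1.
  have d' : (pospart a - pospart b) ^+ 2 <= (b - a) ^+ 2 by rewrite -sqrrN opprB.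
  have h1 : (pospart a ^+ 2 - v) ^+ 2 <= (pospart a ^+ 2 - pospart b ^+ 2) ^+ 2.
    by apply: lerXn2r; rewrite ?nnegrE; lra.
  have h2 : pospart a * (pospart a ^+ 2 - v) * (a - b) <= 2 * (b - a) ^+ 2.
    have q : pospart a ^+ 2 - v <= 2 * (a - b).
      have : pospart a ^+ 2 - pospart b ^+ 2 <= 2 * (a - b).
        have -> : pospart a ^+ 2 - pospart b ^+ 2 = (pospart a + pospart b) * (pospart a - pospart b) by ring.
        apply: (@le_trans _ _ (2 * (pospart a - pospart b))); first by apply: ler_wpM2r; lra.
        by move: bpb; rewrite {1}apos; lra.
      lra.
    apply: (@le_trans _ _ (1 * (2 * (a - b)) * (a - b))); last by rewrite le_eqVlt; apply/orP; left; apply/eqP; ring.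
    apply: ler_wpM2r; first lra.
    by apply: ler_pM; lra.
  have h3 : 0 <= pospart a * (pospart a ^+ 2 - v) * (a - b).
    by rewrite mulr_ge0 ?subr_ge0// mulr_ge0// ltW.
  rewrite expr0n/= sub0r.
  have -> : - (pospart a ^+ 2 - v) ^+ 2 - 4 * pospart a * (pospart a ^+ 2 - v) * (b - a) =
    4 * (pospart a * (pospart a ^+ 2 - v) * (a - b)) - (pospart a ^+ 2 - v) ^+ 2 by ring.
  have h4 := sqr_ge0 (pospart a ^+ 2 - v).
  by rewrite ler_norml; apply/andP; split; lra.
- have pos x : 0 < pospart x ^+ 2 - v -> pospart x = x.
    have [x0|x0] := leP x 0; last by rewrite /pospart max_l// ltW.
    by rewrite /pospart max_r// expr0n/=; lra.
  rewrite (pos _ av) (pos _ bv).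
  rewrite (pos _ av) in pa pa1; rewrite (pos _ bv) in pb pb1.
  have -> : (b ^+ 2 - v) ^+ 2 - (a ^+ 2 - v) ^+ 2 - 4 * a * (a ^+ 2 - v) * (b - a) =
     (b ^+ 2 + 2 * (a * b) + 3 * a ^+ 2 - 2 * v) * (b - a) ^+ 2 by ring.
  rewrite normrM [X in _ * X]ger0_norm//; apply: ler_wpM2r => //.
  have ha : 0 <= a ^+ 2 <= 1 by rewrite sqr_ge0 expr_le1.
  have hb : 0 <= b ^+ 2 <= 1 by rewrite sqr_ge0 expr_le1.
  have hab : 0 <= a * b <= 1 by rewrite mulr_ge0//= mulr_ile1.
  by move/andP: ha => [? ?]; move/andP: hb => [? ?]; move/andP: hab => [? ?];
     rewrite ler_norml; apply/andP; split; lra.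
Qed.

(** The square is convex in v with derivative - 2 [sqexcess], so a secant lies between the two
    tangents. Such two-sided bounds survive integration, which replaces differentiation under the
    integral sign. *)
Lemma sqexcess_sqr_diff v v' a : v <= v' ->
  (v' - v) * (2 * sqexcess v' a) <= sqexcess v a ^+ 2 - sqexcess v' a ^+ 2 <= (v' - v) * (2 * sqexcess v a).
Proof.
move=> vv; rewrite /sqexcess; set q := pospart a ^+ 2.
have [h|h] := leP (q - v) 0; have [h'|h'] := leP (q - v') 0; try lra.
- rewrite mulr0 mulr0 expr0n/= subr0 sqr_ge0/= expr2 mulrA; apply: ler_wpM2r; lra.
- have e : (q - v) ^+ 2 - (q - v') ^+ 2 = (v' - v) * ((q - v) + (q - v')) by ring.
  by rewrite e !ler_wpM2l//; lra.
Qed.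

Lemma sqexcess_diff v v' a : v <= v' ->
  (v' - v) * (v' < pospart a ^+ 2)%R%:R <= sqexcess v a - sqexcess v' a <= (v' - v) * (v < pospart a ^+ 2)%R%:R.
Proof.
move=> vv; rewrite /sqexcess -![_ < pospart a ^+ 2]subr_gt0; set q := pospart a ^+ 2.
by case: (ltP 0 (q - v)) => h; case: (ltP 0 (q - v')) => h' /=; lra.
Qed.

Lemma pospart_diff s s' a : 0 <= s -> s <= s' ->
  (s' - s) * (s' ^+ 2 < pospart a ^+ 2)%R%:R <= Num.max (pospart a - s) 0 - Num.max (pospart a - s') 0
    <= (s' - s) * (s ^+ 2 < pospart a ^+ 2)%R%:R.
Proof.
move=> s0 ss; have p0 := pospart_ge0 a; have s'0 : 0 <= s' by exact: le_trans ss.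
rewrite !ltr_pXn2r ?nnegrE// -![_ < pospart a]subr_gt0.
by case: (ltP 0 (pospart a - s)) => h; case: (ltP 0 (pospart a - s')) => h' /=; lra.
Qed.

(** The difference quotient at x lies between - D x and - D at the other endpoint, on either side of
    x; continuity of D at x closes the gap. *)
Lemma sandwich_derive (G D : R -> R) (a b x : R) : a < x -> x < b ->
  (forall v v', a < v -> v <= v' -> v' < b ->
     (v' - v) * D v' <= G v - G v' <= (v' - v) * D v) ->
  (D y @[y --> x] --> D x) -> is_derive x (1 : R) G (- D x).
Proof.
move=> ax xb H Dc.
have L : (fun h => h^-1 *: ((G \o shift x) (h *: (1 : R)) - G x)) @ (0 : R)^' --> - D x.
  apply/cvgrPdist_lt => e e0.
  move/cvgrPdist_lt: Dc => /(_ _ e0) /nbhs_ballP [r /= r0 Hr].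
  pose rr := Num.min r (Num.min (x - a) (b - x)).
  have rr0 : 0 < rr by rewrite !lt_min r0 !subr_gt0 ax.
  near=> h.
  have hr : `|h| < rr by near: h; apply: dnbhs0_lt.
  have h0 : h != 0 by near: h; exact: nbhs_dnbhs_neq.
  have [hr1 [ha hb]] : `|h| < r /\ `|h| < x - a /\ `|h| < b - x.
    by move: hr; rewrite !lt_min => /andP[? /andP[]].
  have hh := ler_norm h; have hh' := ler_norm (- h); rewrite normrN in hh'.
  have Dh : `|D x - D (h + x)| < e.
    by apply: Hr; rewrite /ball/= opprD addrCA subrr addr0 normrN.
  have hle : h <= `|h| by exact: ler_norm.
  rewrite /= [h%:A]mulr1; set q := _ *: _.
  have qE : h * q = G (h + x) - G x by rewrite /q /GRing.scale/= mulrA mulfV ?mul1r.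
  case: (ltgtP h 0) h0 => // hs _.
  - have := H (h + x) x; rewrite -qE => /(_ _ _ _)/andP[]; try lra.
    rewrite opprD addrCA subrr addr0 => k1 k2.
    have j1 : q <= - D x by rewrite -(ler_nM2l hs); lra.
    have j2 : - D (h + x) <= q by rewrite -(ler_nM2l hs); lra.
    by move: Dh; rewrite !ltr_norml => /andP[? ?]; apply/andP; split; lra.
  - have := H x (h + x); rewrite addrK => /(_ _ _ _)/andP[]; try lra.
    move=> k1 k2.
    have j1 : q <= - D (h + x) by rewrite -(ler_pM2l hs); lra.
    have j2 : - D x <= q by rewrite -(ler_pM2l hs); lra.
    by move: Dh; rewrite !ltr_norml => /andP[? ?]; apply/andP; split; lra.
apply: DeriveDef; first by apply/cvg_ex; eexists; exact: L.
exact: cvg_lim L.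
Unshelve. all: by end_near.
Qed.

Lemma is_derive_fX (f : R -> R) n (x df : R) : is_derive x (1 : R) f df ->
  is_derive x (1 : R) (fun y => f y ^+ n) (n%:R * f x ^+ n.-1 * df).
Proof. by move=> d; have := @is_deriveX R R f n x 1 df d; rewrite exprfctE. Qed.

Lemma is_derive_fM (f g : R -> R) (x df dg : R) : is_derive x (1 : R) f df ->
  is_derive x (1 : R) g dg ->
  is_derive x (1 : R) (fun y => f y * g y) (f x * dg + g x * df).
Proof. by move=> d e; exact: (@is_deriveM R R f g x 1 df dg d e). Qed.

Lemma is_derive_onem (x : R) : is_derive x (1 : R) (fun y : R => 1 - y) (- 1).
Proof.
by have := (@is_deriveB R R R (cst (1 : R)) id x 1 0 1 (is_derive_cst _ _ _) (is_derive_id _ _)); rewrite sub0r.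
Qed.

Lemma zero_derive_cst (W : R -> R) (a b : R) :
  (forall x : R, a < x -> x < b -> is_derive x (1 : R) W 0) ->
  forall x y : R, a < x -> x < b -> a < y -> y < b -> W x = W y.
Proof.
move=> dW; suff H (x y : R) : a < x -> x < y -> y < b -> W x = W y.
  move=> x y ax xb ay yb; case: (ltgtP x y) => [xy|yx|->//]; first exact: H.
  by rewrite (H y x).
move=> ax xy yb.
have [||c _] := @MVT R W (fun=> 0) x y xy _ _.
- move=> z; rewrite in_itv/= => /andP[xz zy]; apply: dW; first exact: lt_trans xz.
  exact: lt_trans yb.
- apply: derivable_within_continuous => z; rewrite in_itv/= => /andP[xz zy].
  by apply: ex_derive; apply: dW; [exact: lt_le_trans xz | exact: le_lt_trans yb].
- by rewrite mul0r => /eqP; rewrite subr_eq0 => /eqP ->.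
Qed.

Lemma lipschitz_cvg (f : R -> R) (K x : R) : (forall y, `|f y - f x| <= K * `|y - x|) ->
  f y @[y --> x] --> f x.
Proof.
move=> H; apply/cvgrPdist_lt => e e0.
pose k := `|K| + 1; have k0 : 0 < k by rewrite ltr_wpDl.
apply/nbhs_ballP; exists (e / k) => /=; first by rewrite divr_gt0.
move=> y; rewrite /ball/= => yx; rewrite distrC; apply: le_lt_trans (H y) _.
rewrite ltr_pdivlMr// in yx; apply: le_lt_trans yx; rewrite mulrC distrC.
by apply: ler_wpM2l => //; rewrite /k; have := ler_norm K; lra.
Qed.

End RealFacts.

(** * Truncated moments of a coordinate *)

Section CapFunctions.
Context {R : realType}.
Variable n : nat.
Hypothesis n2 : (2 <= n)%N.
Implicit Types (x u : @vec R n).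
Variable sigma : {measure set (@vec R n) -> \bar R}.
Hypothesis hs : is_surface_measure sigma.
Variable i0 : 'I_n.

Local Notation S := (@sphere R n).
Local Notation E := (Ex sigma S).
Local Notation x0 x := (tnth x i0).

Let mS : measurable S. Proof. exact: measurable_sphere. Qed.
Let sS : (sigma S < +oo)%E. Proof. exact: sigma_fin. Qed.

(* With x the coordinate along i0, these are the moments E [x_+ (x_+^2 - v)_+^k] for k = 2, 1, 0,
   each a multiple of the derivative of the previous one. Stein's identity makes excess2 solve a
   first-order equation; excess0 is comparable to the measure of a cap near its pole. *)
Definition excess2 (v : R) := E (fun x => pospart (x0 x) * sqexcess v (x0 x) ^+ 2).
Definition excess1 (v : R) := E (fun x => pospart (x0 x) * sqexcess v (x0 x)).
Definition excess0 (v : R) := E (fun x => pospart (x0 x) * (v < pospart (x0 x) ^+ 2)%R%:R).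
Definition linexcess (s : R) := E (fun x => pospart (x0 x) * Num.max (pospart (x0 x) - s) 0).

Lemma measurable_pp : measurable_fun setT (@pospart R).
Proof. by apply: measurable_maxr => //; exact: measurable_cst. Qed.

Lemma measurable_zz v : measurable_fun setT (@sqexcess R v).
Proof.
apply: measurable_maxr; last exact: measurable_cst.
apply: measurable_funB; last exact: measurable_cst.
by apply: measurable_funX; exact: measurable_pp.
Qed.

Let b0 : bmf S (fun x => x0 x). Proof. exact: bmf_tnth. Qed.
Let bp : bmf S (fun x => pospart (x0 x)). Proof. by apply: bmf_max b0 _; exact: bmf_cst. Qed.
Let bz v : bmf S (fun x => sqexcess v (x0 x)).
Proof.
by apply: bmf_max; [apply: bmfB; [exact: bmfX | exact: bmf_cst] | exact: bmf_cst].
Qed.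
Let bi v : bmf S (fun x => (v < pospart (x0 x) ^+ 2)%R%:R : R).
Proof.
rewrite (_ : (fun x => _) = (\1_[set x | v < pospart (x0 x) ^+ 2] : vec n -> R)).
  apply: bmf_indic => //; apply: measurable_setT_lt; first exact: measurable_cst.
  apply: measurable_funX; apply: (measurableT_comp measurable_pp); exact: measurable_tnthR.
apply/funext => x; rewrite indicE; case: (boolP (_ < _)) => h.
  by rewrite mem_set.
by rewrite memNset//=; exact/negP.
Qed.

Lemma p_le1 x : S x -> pospart (x0 x) <= 1.
Proof. by move=> Sx; apply: pospart_le1; exact: sphere_tnth_norm. Qed.

(** Stein's identity for g = [sqexcess v] squared, whose derivative is 4 [pospart] times
    [sqexcess v]. Writing 1 - x^2 = (1 - v) - (x^2 - v) where the excess is positive gives 4 (1 - v)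
    excess1 - 4 excess2 = (n - 1) excess2. *)
Lemma excess2_stein v : 0 <= v -> v <= 1 -> 4 * (1 - v) * excess1 v = (n + 3)%:R * excess2 v.
Proof.
move=> v0 v1.
have := @stein R n sigma hs i0 (fun a => sqexcess v a ^+ 2) (fun a => 4 * pospart a * sqexcess v a) 4 12.
have mz2 : measurable_fun setT (fun a => sqexcess v a ^+ 2).
  by apply: measurable_funX; exact: measurable_zz.
have mpz : measurable_fun setT (fun a : R => 4 * pospart a * sqexcess v a).
  apply: measurable_funM; last exact: measurable_zz.
  by apply: measurable_funM; [exact: measurable_cst | exact: measurable_pp].
move=> /(_ mz2 mpz _ _ _) H.
have {}H : E (fun x => 4 * pospart (x0 x) * sqexcess v (x0 x) * (1 - x0 x ^+ 2)) =
    n.-1%:R * E (fun x => sqexcess v (x0 x) ^+ 2 * x0 x).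
  apply: H.
  - move=> a a1; rewrite ger0_norm ?sqr_ge0//.
    have h : sqexcess v a ^+ 2 <= 1 by rewrite expr_le1 ?sqexcess_ge0 ?sqexcess_le1.
    by apply: le_trans h _; lra.
  - move=> a a1; rewrite ger0_norm; last by rewrite mulr_ge0 ?sqexcess_ge0// mulr_ge0 ?pospart_ge0.
    rewrite -mulrA -[leRHS]mulr1 ler_pM2l//.
    exact: (mulr_ile1 (pospart_ge0 a) (sqexcess_ge0 v a) (pospart_le1 a1) (sqexcess_le1 v0 a1)).
  - by move=> a b a1 b1; exact: sqexcess_taylor.
have zx x : sqexcess v (x0 x) ^+ 2 * x0 x = pospart (x0 x) * sqexcess v (x0 x) ^+ 2.
  have [h|h] := leP (x0 x) 0; last by rewrite /pospart max_l ?ltW// mulrC.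
  have -> : sqexcess v (x0 x) = 0.
    rewrite /sqexcess (_ : pospart (x0 x) = 0); last by rewrite /pospart max_r.
    by rewrite max_r// expr0n/=; lra.
  by rewrite expr0n/= mul0r mulr0.
have zx2 x : 4 * pospart (x0 x) * sqexcess v (x0 x) * (1 - x0 x ^+ 2) =
   4 * (1 - v) * (pospart (x0 x) * sqexcess v (x0 x)) - 4 * (pospart (x0 x) * sqexcess v (x0 x) ^+ 2).
  have [h|h] := leP (x0 x) 0.
    by rewrite (_ : pospart (x0 x) = 0); [ring | rewrite /pospart max_r].
  have pE : pospart (x0 x) = x0 x by rewrite /pospart max_l// ltW.
  rewrite /sqexcess pE; have [k|k] := leP (x0 x ^+ 2 - v) 0; ring.
have bpz : bmf S (fun x => pospart (x0 x) * sqexcess v (x0 x)) by exact: bmfM.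
have bpz2 : bmf S (fun x => pospart (x0 x) * sqexcess v (x0 x) ^+ 2) by apply: bmfM => //; exact: bmfX.
move: H; under Ex_eq do rewrite zx2; under [in RHS]Ex_eq do rewrite zx.
rewrite ExB ?ExZ//; try by apply: bmfM => //; exact: bmf_cst.
rewrite -/(excess1 v) -/(excess2 v) => H.
rewrite natrD; have -> : n%:R = n.-1%:R + 1 :> R by rewrite natr1 prednK// (leq_trans _ n2).
lra.
Qed.

Lemma excess2_sandwich v v' : v <= v' ->
  (v' - v) * (2 * excess1 v') <= excess2 v - excess2 v' <= (v' - v) * (2 * excess1 v).
Proof.
move=> vv.
have bpz w : bmf S (fun x => pospart (x0 x) * sqexcess w (x0 x)) by exact: bmfM.
have bpz2 w : bmf S (fun x => pospart (x0 x) * sqexcess w (x0 x) ^+ 2) by apply: bmfM => //; exact: bmfX.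
have bk (k : R) w : bmf S (fun x => k * (pospart (x0 x) * sqexcess w (x0 x))) by apply: bmfM => //; exact: bmf_cst.
rewrite !mulrA -ExB// -!ExZ//; apply/andP; split; apply: Ex_le => //; try exact: bmfB.
- move=> x _; have /andP[h _] := sqexcess_sqr_diff (x0 x) vv.
  rewrite -mulrBr mulrCA; apply: ler_wpM2l; first exact: pospart_ge0.
  by apply: le_trans h; rewrite mulrA.
- move=> x _; have /andP[_ h] := sqexcess_sqr_diff (x0 x) vv.
  rewrite -mulrBr [leRHS]mulrCA; apply: ler_wpM2l; first exact: pospart_ge0.
  by apply: le_trans h _; rewrite mulrA.
Qed.

Lemma excess1_sandwich v v' : v <= v' ->
  (v' - v) * excess0 v' <= excess1 v - excess1 v' <= (v' - v) * excess0 v.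
Proof.
move=> vv.
have bpz w : bmf S (fun x => pospart (x0 x) * sqexcess w (x0 x)) by exact: bmfM.
have bpi w : bmf S (fun x => pospart (x0 x) * (w < pospart (x0 x) ^+ 2)%R%:R) by exact: bmfM.
have bk (k : R) w : bmf S (fun x => k * (pospart (x0 x) * (w < pospart (x0 x) ^+ 2)%R%:R)).
  by apply: bmfM => //; exact: bmf_cst.
rewrite -ExB// -!ExZ//; apply/andP; split; apply: Ex_le => //; try exact: bmfB.
- move=> x _; have /andP[h _] := sqexcess_diff (x0 x) vv.
  by rewrite -mulrBr mulrCA; apply: ler_wpM2l; first exact: pospart_ge0.
- move=> x _; have /andP[_ h] := sqexcess_diff (x0 x) vv.
  by rewrite -mulrBr [leRHS]mulrCA; apply: ler_wpM2l; first exact: pospart_ge0.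
Qed.

Lemma linexcess_sandwich s s' : 0 <= s -> s <= s' ->
  (s' - s) * excess0 (s' ^+ 2) <= linexcess s - linexcess s' <= (s' - s) * excess0 (s ^+ 2).
Proof.
move=> s0 ss.
have bpm w : bmf S (fun x => pospart (x0 x) * Num.max (pospart (x0 x) - w) 0).
  by apply: bmfM => //; apply: bmf_max; [apply: bmfB => //; exact: bmf_cst | exact: bmf_cst].
have bpi w : bmf S (fun x => pospart (x0 x) * (w < pospart (x0 x) ^+ 2)%R%:R) by exact: bmfM.
have bk (k : R) w : bmf S (fun x => k * (pospart (x0 x) * (w < pospart (x0 x) ^+ 2)%R%:R)).
  by apply: bmfM => //; exact: bmf_cst.
rewrite -ExB// -!ExZ//; apply/andP; split; apply: Ex_le => //; try exact: bmfB.
- move=> x _; have /andP[h _] := pospart_diff (x0 x) s0 ss.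
  by rewrite -mulrBr mulrCA; apply: ler_wpM2l; first exact: pospart_ge0.
- move=> x _; have /andP[_ h] := pospart_diff (x0 x) s0 ss.
  by rewrite -mulrBr [leRHS]mulrCA; apply: ler_wpM2l; first exact: pospart_ge0.
Qed.

Lemma excess0_bounds v : 0 <= excess0 v <= mass sigma.
Proof.
apply/andP; split; first by apply: Ex_ge0 => x _; rewrite mulr_ge0 ?pospart_ge0.
rewrite /mass -[leRHS]mul1r -[leRHS](Ex_cst sigma mS).
apply: Ex_le => //; [exact: bmfM | exact: bmf_cst |].
by move=> x Sx; apply: mulr_ile1; rewrite ?pospart_ge0 ?p_le1//; case: (_ < _).
Qed.

Lemma excess1_lip v v' : `|excess1 v' - excess1 v| <= mass sigma * `|v' - v|.
Proof.
wlog vv : v v' / v <= v'.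
  move=> H; have [vv|vv] := leP v v'; first exact: H.
  by rewrite distrC [`|v' - v|]distrC; apply: H; exact: ltW.
have /andP[h1 h2] := excess1_sandwich vv.
have /andP[a1 a2] := excess0_bounds v; have /andP[b1 b2] := excess0_bounds v'.
have d0 : 0 <= v' - v by rewrite subr_ge0.
rewrite distrC ger0_norm; last by apply: le_trans h1; rewrite mulr_ge0.
by rewrite ger0_norm// mulrC; apply: le_trans h2 _; rewrite ler_wpM2l.
Qed.

Lemma excess2_derive v : is_derive v (1 : R) excess2 (- (2 * excess1 v)).
Proof.
apply: (@sandwich_derive R excess2 (fun v => 2 * excess1 v) (v - 1) (v + 1)); try lra.
  by move=> w w' _ ww' _; exact: excess2_sandwich.
apply: cvgM; first exact: cvg_cst.
apply: (lipschitz_cvg (K := mass sigma)) => y; exact: excess1_lip.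
Qed.

(** The equation excess2' = - (n + 3) / (2 (1 - v)) excess2 has the solutions constant times (1 -
    v)^((n + 3) / 2). Squaring makes the exponent a natural number, and the ratio [W] has derivative
    0. *)
Lemma excess2_sqr : exists2 k : R, 0 <= k & forall v : R, 0 < v -> v < 1 -> excess2 v ^+ 2 = k * (1 - v) ^+ (n + 3).
Proof.
pose N := (n + 3)%N.
pose W (v : R) := excess2 v ^+ 2 * ((1 - v) ^+ N)^-1.
have dW (v : R) : 0 < v -> v < 1 -> is_derive v (1 : R) W 0.
  move=> v0 v1.
  have d1 := is_derive_fX N (is_derive_onem v).
  have u0 : 1 - v != 0 by rewrite subr_eq0 gt_eqF.
  have nz : (1 - v) ^+ N != 0 by rewrite expf_neq0.
  have d2 := @is_deriveV R (fun v : R => (1 - v) ^+ N) v _ 1 nz d1.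
  have d3 := is_derive_fX 2 (excess2_derive v).
  have d4 := is_derive_fM d3 d2.
  apply: is_derive_eq d4 _.
  have st := excess2_stein (ltW v0) (ltW v1).
  have b1E : excess1 v = N%:R * excess2 v / (4 * (1 - v)) by rewrite /N -st; field.
  have -> : (1 - v) ^+ N = (1 - v) * (1 - v) ^+ N.-1 by rewrite -exprS /N addn3.
  rewrite expr1.
  have q0 : (1 - v) ^+ N.-1 != 0 by rewrite expf_neq0.
  rewrite /GRing.scale/= b1E.
  field.
  by rewrite u0 q0.
have c12 : 0 < 1 / 2 :> R by lra.
have c12' : 1 / 2 < 1 :> R by lra.
exists (W (1 / 2)).
  by rewrite mulr_ge0 ?sqr_ge0// invr_ge0 exprn_ge0; lra.
move=> v v0 v1; rewrite -(zero_derive_cst dW v0 v1 c12 c12') /W.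
by rewrite divfK// expf_neq0// subr_eq0 gt_eqF.
Qed.

End CapFunctions.

Lemma mvt_closed {R : realType} (f df : R -> R) (a b : R) : a < b ->
  (forall x : R, a <= x -> x <= b -> is_derive x (1 : R) f (df x)) ->
  exists2 c, a < c < b & f b - f a = (b - a) * df c.
Proof.
move=> ab H; have [||c c_in e] := @MVT R f df a b ab _ _.
- by move=> z; rewrite in_itv/= => /andP[az zb]; apply: H; exact: ltW.
- apply: derivable_within_continuous => z; rewrite in_itv/= => /andP[az zb].
  by apply: ex_derive; exact: H.
- by exists c; rewrite ?e 1?mulrC//; rewrite in_itv in c_in.
Qed.

(** * From moments to the indicator, and Wallis integrals *)

Section CapAsymptotics.
Context {R : realType}.
Variable n : nat.
Hypothesis n2 : (2 <= n)%N.
Implicit Types (x u : @vec R n).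
Variable sigma : {measure set (@vec R n) -> \bar R}.
Hypothesis hs : is_surface_measure sigma.
Variable i0 : 'I_n.

Local Notation S := (@sphere R n).
Local Notation E := (Ex sigma S).
Local Notation x0 x := (tnth x i0).
Local Notation excess2 := (excess2 sigma i0).
Local Notation excess1 := (excess1 sigma i0).
Local Notation excess0 := (excess0 sigma i0).
Local Notation linexcess := (linexcess sigma i0).

Let mS : measurable S. Proof. exact: measurable_sphere. Qed.
Let sS : (sigma S < +oo)%E. Proof. exact: sigma_fin. Qed.

(** [excess0] is known to be monotone but not yet continuous, so [sandwich_derive] does not apply to
    [excess1]. Stein's identity, however, expresses [excess1] through [excess2], hence makes it
    differentiable with continuous derivative - [dl]; secants to the left and to the right of v then
    squeeze [excess0 v]. *)
Lemma excess0_Bone (v : R) : 0 < v -> v < 1 -> excess0 v = n.+1%:R / (2 * (1 - v)) * excess1 v.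
Proof.
move=> v0 v1.
pose N := (n + 3)%N.
pose dl (v : R) := n.+1%:R / (2 * (1 - v)) * excess1 v.
pose Bt (v : R) := N%:R / 4 * ((1 - v)^-1 * excess2 v).
have BtE (w : R) : 0 < w -> w < 1 -> excess1 w = Bt w.
  move=> w0 w1; have st := excess2_stein n2 hs i0 (ltW w0) (ltW w1).
  rewrite /Bt mulrCA [N%:R / 4 * _]mulrAC -st; field.
  by rewrite subr_eq0 gt_eqF.
have dBt (w : R) : 0 < w -> w < 1 -> is_derive w (1 : R) Bt (- dl w).
  move=> w0 w1.
  have u0 : 1 - w != 0 by rewrite subr_eq0 gt_eqF.
  have d1 := @is_deriveV R (fun v : R => 1 - v) w _ 1 u0 (is_derive_onem w).
  have d2 := is_derive_fM d1 (excess2_derive hs i0 w).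
  have d3 := is_derive_fM (is_derive_cst (N%:R / 4 : R) w (1 : R)) d2.
  apply: is_derive_eq d3 _.
  have st := excess2_stein n2 hs i0 (ltW w0) (ltW w1).
  have b1E : excess2 w = 4 * (1 - w) * excess1 w / N%:R.
    by rewrite st /N mulrAC mulfV ?mul1r// pnatr_eq0 addn3.
  have n30 : n%:R + 3 != 0 :> R by rewrite -(natrD _ n 3) pnatr_eq0 addn3.
  rewrite mulr0 addr0 b1E /dl /N natrD -natr1 /GRing.scale/=.
  by field; rewrite u0 n30.
have cdl : dl y @[y --> v] --> dl v.
  apply: cvgM; last by apply: (lipschitz_cvg (K := mass sigma)) => y; exact: excess1_lip.
  apply: cvgM; first exact: cvg_cst.
  apply: cvgV; first by rewrite mulf_neq0 ?pnatr_eq0// subr_eq0 gt_eqF.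
  apply: cvgM; first exact: cvg_cst.
  by apply: cvgB; [exact: cvg_cst | exact: cvg_id].
have mvt (w w' : R) : 0 < w -> w < w' -> w' < 1 -> exists2 xi, w < xi < w' &
    excess1 w - excess1 w' = (w' - w) * dl xi.
  move=> w0 ww w1.
  have [|xi xi_in e] := mvt_closed (f := Bt) (df := fun z => - dl z) ww.
    by move=> z wz zw; apply: dBt; [exact: lt_le_trans wz | exact: le_lt_trans w1].
  exists xi => //; rewrite (BtE w) ?(BtE w')//.
  - by rewrite -opprB e mulrN opprK.
  - exact: lt_trans ww.
  - exact: lt_trans w1.
apply/eqP; rewrite eq_le; apply/andP; split.
- apply/ler_addgt0Pl => e e0; rewrite -/(dl v).
  move/cvgrPdist_lt: cdl => /(_ _ e0)/nbhs_ballP[r /= r0 Hr].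
  pose w := Num.max (v / 2) (v - r / 2).
  have wv : w < v by rewrite gt_max; apply/andP; split; lra.
  have w0 : 0 < w by rewrite lt_max; apply/orP; left; lra.
  have [xi /andP[a b] e1] := mvt w v w0 wv v1.
  have /andP[h _] := excess1_sandwich hs i0 (ltW wv).
  rewrite e1 ler_pM2l ?subr_gt0// in h.
  have wr : v - r / 2 <= w by rewrite le_max lexx orbT.
  have := Hr xi; rewrite /ball/= gtr0_norm; last lra.
  move=> /(_ _); rewrite ltr_norml => /(_ _)/andP[|? ?]; lra.
- apply/ler_addgt0Pl => e e0; rewrite -/(dl v).
  move/cvgrPdist_lt: cdl => /(_ _ e0)/nbhs_ballP[r /= r0 Hr].
  pose w := Num.min ((1 + v) / 2) (v + r / 2).
  have wv : v < w by rewrite lt_min; apply/andP; split; lra.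
  have w1 : w < 1 by rewrite gt_min; apply/orP; left; lra.
  have [xi /andP[a b] e1] := mvt v w v0 wv w1.
  have /andP[_ h] := excess1_sandwich hs i0 (ltW wv).
  rewrite e1 ler_pM2l ?subr_gt0// in h.
  have wr : w <= v + r / 2 by rewrite ge_min lexx orbT.
  have := Hr xi; rewrite /ball/= ltr0_norm; last lra.
  move=> /(_ _); rewrite ltr_norml => /(_ _)/andP[|? ?]; lra.
Qed.

Lemma excess0_sqr : exists2 k : R, 0 <= k & forall v : R, 0 < v -> v < 1 ->
  excess0 v ^+ 2 = k * (1 - v) ^+ n.-1.
Proof.
have [k k0 H] := excess2_sqr n2 hs i0.
exists ((n.+1%:R * (n + 3)%:R / 8) ^+ 2 * k); first by rewrite mulr_ge0// sqr_ge0.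
move=> v v0 v1; rewrite excess0_Bone//.
have u0 : 1 - v != 0 by rewrite subr_eq0 gt_eqF.
have st := excess2_stein n2 hs i0 (ltW v0) (ltW v1).
have -> : excess1 v = (n + 3)%:R * excess2 v / (4 * (1 - v)) by rewrite -st; field.
have e : (1 - v) ^+ (n + 3) = (1 - v) ^+ 4 * (1 - v) ^+ n.-1.
  by rewrite -exprD; congr (_ ^+ _); move: n2; case: n => // m _ /=; rewrite addnC.
have -> : n.+1%:R / (2 * (1 - v)) * ((n + 3)%:R * excess2 v / (4 * (1 - v))) =
   n.+1%:R * (n + 3)%:R / 8 * excess2 v / (1 - v) ^+ 2 by field.
rewrite 2!exprMn H// e exprVn -exprM; field.
by [].
Qed.

(** With v = cos^2 phi the right side of [excess0_sqr] is itself a square, so the root is taken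
    within natural powers of sin. *)
Lemma excess0_cos : exists2 c : R, 0 <= c & forall phi : R, 0 < phi -> phi < pi / 2 ->
  excess0 (cos phi ^+ 2) = c * sin phi ^+ n.-1.
Proof.
have [k k0 H] := excess0_sqr; exists (Num.sqrt k); first exact: sqrtr_ge0.
move=> phi p0 p1.
have s0 : 0 < sin phi by apply: sin_gt0_pi; have := pi_gt0 R; lra.
have c0 : 0 < cos phi by apply: cos_gt0_pihalf; apply/andP; split; lra.
have cs := cos2Dsin2 phi.
have := H (cos phi ^+ 2).
have -> : 1 - cos phi ^+ 2 = sin phi ^+ 2 by rewrite -cs; ring.
have s20 : 0 < sin phi ^+ 2 by rewrite exprn_gt0.
move=> /(_ _ _)h; have {}h := h _ _.
have {h} h : excess0 (cos phi ^+ 2) ^+ 2 = k * (sin phi ^+ 2) ^+ n.-1.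
  by apply: h; [rewrite exprn_gt0 | lra].
apply/eqP; rewrite -(@eqrXn2 _ 2)//; last 2 first.
- by case/andP: (excess0_bounds hs i0 (cos phi ^+ 2)).
- by rewrite mulr_ge0 ?sqrtr_ge0// exprn_ge0// ltW.
by rewrite h (exprMn _ (Num.sqrt k)) sqr_sqrtr// -!exprM mulnC.
Qed.

(** The primitive of sin^(2L) vanishing at 0, by the reduction formula; at pi / 2 it is the Wallis
    integral. *)
Fixpoint sinprim (L : nat) (phi : R) : R :=
  if L is L'.+1 then
    (L'.*2.+1%:R * sinprim L' phi - cos phi * sin phi ^+ L'.*2.+1) / L'.*2.+2%:R
  else phi.

Lemma sinprim_derive L (phi : R) : is_derive phi (1 : R) (sinprim L) (sin phi ^+ L.*2).
Proof.
elim: L => [|L IH] /=; first by rewrite expr0; exact: is_derive_id.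
have d1 := is_derive_fM (is_derive_cst (L.*2.+1%:R : R) phi (1 : R)) IH.
have d2 := is_derive_fM (is_derive_cos phi) (is_derive_fX L.*2.+1 (is_derive_sin phi)).
have d3 := @is_deriveB R R R _ _ phi 1 _ _ d1 d2.
have d4 := is_derive_fM (is_derive_cst (L.*2.+2%:R^-1 : R) phi (1 : R)) d3.
under [X in is_derive _ _ X _]funext do rewrite mulrC.
apply: is_derive_eq d4 _.
rewrite mulr0 addr0 mulr0 addr0 /=.
have c2 : cos phi ^+ 2 = 1 - sin phi ^+ 2 by rewrite -(cos2Dsin2 phi); ring.
have n0 : L.*2.+2%:R != 0 :> R by rewrite pnatr_eq0.
have e1 : L.*2.+1%:R = L.*2.+2%:R - 1 :> R by rewrite -[L.*2.+2%:R]natr1 addrK.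
have -> : cos phi * (L.*2.+1%:R * sin phi ^+ L.*2 * cos phi) =
   L.*2.+1%:R * sin phi ^+ L.*2 * (1 - sin phi ^+ 2) by rewrite -c2; ring.
rewrite e1 doubleS; move: L.*2.+2%:R n0 {e1} => M n0.
rewrite !exprS; field; exact: n0.
Qed.

Lemma sinprim0 L : sinprim L 0 = 0.
Proof. by elim: L => //= L ->; rewrite sin0 expr0n mulr0 mulr0 subr0 mul0r. Qed.

Lemma sinprim_pihalf L : sinprim L.+1 (pi / 2) = L.*2.+1%:R / L.*2.+2%:R * sinprim L (pi / 2).
Proof. by rewrite /= cos_pihalf mul0r subr0; rewrite mulrAC. Qed.

End CapAsymptotics.

(** * The constant, and the measure of small caps *)

Section CapMeasure.
Context {R : realType}.
Variable L : nat.
Hypothesis L1 : (1 <= L)%N.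
Local Notation n := (2 * L)%N.
Implicit Types (x u : @vec R n).
Variable sigma : {measure set (@vec R n) -> \bar R}.
Hypothesis hs : is_surface_measure sigma.

Local Notation S := (@sphere R n).
Local Notation E := (Ex sigma S).

Let n2 : (2 <= n)%N. Proof. by rewrite leq_pmulr. Qed.
Let mS : measurable S. Proof. exact: measurable_sphere. Qed.
Let sS : (sigma S < +oo)%E. Proof. exact: sigma_fin. Qed.

Lemma pole_proof : (0 < n)%N. Proof. exact: ltnW. Qed.
Definition pole : 'I_n := Ordinal pole_proof.
Let pole'_proof : (1 < n)%N. Proof. exact: n2. Qed.
Let j1 : 'I_n := Ordinal pole'_proof.
Let j10 : j1 != pole. Proof. by []. Qed.

Local Notation x0 x := (tnth x pole).
Local Notation excess0 := (excess0 sigma pole).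
Local Notation linexcess := (linexcess sigma pole).
Local Notation mass := (mass sigma).

Lemma massE : mass = sphere_area n.-1.
Proof. by rewrite /mass; have [_ [-> _]] := hs. Qed.

(** The exponent L - 1/2 is half the dimension n - 1 of the sphere and the inverse of alpha; its
    square-root nature is handled here once and for all. *)
Lemma powR_pred (a : R) : 0 <= a -> a `^ (L%:R - 1 / 2) ^+ 2 = a ^+ n.-1.
Proof.
move=> a0; rewrite -powR_mulrn ?powR_ge0// -powRrM -powR_mulrn//; congr (_ `^ _).
have e : n%:R = n.-1%:R + 1 :> R by rewrite natr1 (prednK pole_proof).
have : n%:R = 2 * L%:R :> R by rewrite natrM.
lra.
Qed.

Lemma p_gt0 : 0 < L%:R - 1 / 2 :> R.
Proof. have : 1 <= L%:R :> R by rewrite ler1n. lra. Qed.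

Lemma linexcess_lip (s s' : R) : `|linexcess s' - linexcess s| <= mass * `|s' - s|.
Proof.
have b0 : bmf S (fun x => x0 x) by exact: bmf_tnth.
have bp : bmf S (fun x => pospart (x0 x)) by apply: bmf_max b0 _; exact: bmf_cst.
have bpm w : bmf S (fun x => pospart (x0 x) * Num.max (pospart (x0 x) - w) 0).
  by apply: bmfM => //; apply: bmf_max; [apply: bmfB => //; exact: bmf_cst | exact: bmf_cst].
rewrite mulrC -(Ex_cst sigma mS); apply: Ex_dist => //; first exact: bmf_cst.
move=> x Sx; rewrite -mulrBr normrM -[leRHS]mul1r; apply: ler_pM => //.
  by rewrite ger0_norm ?pospart_ge0// p_le1.
set a := pospart _; case: (leP (a - s) 0) => h; case: (leP (a - s') 0) => h'.
- by rewrite subrr normr0.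
- by rewrite subr0 (gtr0_norm h'); have := ler_norm (s - s'); rewrite distrC; lra.
- by rewrite sub0r normrN (gtr0_norm h); have := ler_norm (s' - s); lra.
- by rewrite distrC (_ : _ - _ = s' - s)//; ring.
Qed.

(** Continuity is read off from the explicit square; it is what allows [linexcess] to be
    differentiated. *)
Lemma excess0_cvg (s : R) : 0 < s -> s < 1 -> excess0 (y ^+ 2) @[y --> s] --> excess0 (s ^+ 2).
Proof.
move=> s0 s1; have [k k0 H] := excess0_sqr n2 hs pole.
have HE (y : R) : 0 < y -> y < 1 -> excess0 (y ^+ 2) = Num.sqrt (k * (1 - y ^+ 2) ^+ n.-1).
  move=> y0 y1; rewrite -H ?exprn_gt0// ?expr_lt1 ?ltW//.
  by rewrite sqrtr_sqr ger0_norm//; case/andP: (excess0_bounds hs pole (y ^+ 2)).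
rewrite (HE s)//.
apply: (@cvg_trans _ ((fun y : R => Num.sqrt (k * (1 - y ^+ 2) ^+ n.-1)) @ s)).
  apply: near_eq_cvg; near=> y; rewrite HE//.
    by near: y; exact: lt_nbhsr.
  by near: y; exact: lt_nbhsl.
apply: (@cvg_comp _ _ _ (fun y : R => k * (1 - y ^+ 2) ^+ n.-1) Num.sqrt); last exact: sqrt_continuous.
apply: cvgM; first exact: cvg_cst.
apply: (@cvg_comp _ _ _ (fun y : R => 1 - y ^+ 2) (fun z : R => z ^+ n.-1)); last exact: exprn_continuous.
apply: cvgB; first exact: cvg_cst.
exact: exprn_continuous.
Unshelve. all: by end_near.
Qed.

(** All coordinates have the same second moment mass / (2L), and the symmetry x -> - x halves it. *)
Lemma E_positive_part : E (fun x => pospart (x0 x) ^+ 2) = mass / (4 * L%:R).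
Proof.
have bx i : bmf S (fun x => tnth x i) by exact: bmf_tnth.
have bp : bmf S (fun x => pospart (x0 x)) by apply: bmf_max (bx _) _; exact: bmf_cst.
have bpm : bmf S (fun x => pospart (- x0 x)).
  apply: bmf_max; last exact: bmf_cst.
  exact: bmfN.
have sum1 : \sum_(i < n) E (fun x => tnth x i ^+ 2) = mass.
  rewrite -Ex_sum//; last by move=> i; exact: bmfX.
  rewrite -[RHS]mul1r -(Ex_cst sigma mS); apply: Ex_eq => x; exact: sphere_sum.
have Ej j : E (fun x => tnth x j ^+ 2) = E (fun x => x0 x ^+ 2).
  have [->//|jp] := eqVneq j pole.
  have := @E_plane R n sigma hs pole (fun a _ => a ^+ 2) 0 1 j jp.
  move=> <-; [|by rewrite expr0n expr1n add0r|by rewrite eq_sym oner_eq0|by apply: bmfX].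
  by apply: Ex_eq => x _; rewrite mul0r mul1r add0r.
have Em : E (fun x => pospart (- x0 x) ^+ 2) = E (fun x => pospart (x0 x) ^+ 2).
  have := @E_plane R n sigma hs pole (fun a _ => pospart a ^+ 2) (-1) 0 j1 j10.
  move=> <-; [|by rewrite sqrrN expr1n expr0n addr0|by rewrite lt_eqF//; lra|by apply: bmfX].
  by apply: Ex_eq => x _; rewrite mulN1r mul0r addr0.
have Es : E (fun x => x0 x ^+ 2) = E (fun x => pospart (x0 x) ^+ 2) + E (fun x => pospart (- x0 x) ^+ 2).
  rewrite -ExD//; try exact: bmfX.
  by apply: Ex_eq => x _; rewrite /pospart; case: leP => h; case: leP => h'; nra.
move: sum1; under eq_bigr do rewrite Ej.
rewrite sumr_const card_ord Es Em -(mulr_natl _ n) (natrM _ 2 L) => <-; field.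
by rewrite pnatr_eq0 -lt0n.
Qed.

Lemma sphere_area_gt0 m : 0 < sphere_area m :> R.
Proof.
suff : 0 < sphere_area m :> R /\ 0 < sphere_area m.+1 :> R by case.
have p0 := pi_gt0 R.
elim: m => [|m [IH1 IH2]]; first by split => /=; lra.
by split => //=; rewrite divr_gt0 ?ltr0n// mulr_gt0//; lra.
Qed.

Lemma sinprim_gt0 m : 0 < sinprim m (pi / 2) :> R.
Proof.
elim: m => [|m IH]; first by have := pi_gt0 R; rewrite /=; lra.
by rewrite sinprim_pihalf mulr_gt0// divr_gt0 ?ltr0n.
Qed.

(** The slicing formula: the area of S^(2m+1) is twice that of S^(2m) times the integral of sin^(2m)
    over [0, pi/2], stated with the next Wallis integral. It follows by induction from the two-step
    recursions. *)
Lemma area_Aw m : sphere_area m.*2.+1 * m.*2.+1%:R =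
  4 * m.+1%:R * sinprim m.+1 (pi / 2) * sphere_area m.*2 :> R.
Proof.
elim: m => [|m IH]; first by rewrite sinprim_pihalf double0 /=; field.
rewrite sinprim_pihalf doubleS.
have -> : sphere_area m.*2.+3 = 2 * pi * sphere_area m.*2.+1 / m.*2.+2%:R :> R by [].
have -> : sphere_area m.*2.+2 = 2 * pi * sphere_area m.*2 / m.*2.+1%:R :> R by [].
have n1 : m.*2.+1%:R != 0 :> R by rewrite pnatr_eq0.
have -> : sphere_area m.*2.+1 = 4 * m.+1%:R * sinprim m.+1 (pi / 2) * sphere_area m.*2 / m.*2.+1%:R :> R.
  by rewrite -IH mulfK.
have -> : m.*2.+4%:R = 2 * m.+2%:R :> R by rewrite -natrM mul2n.
have -> : m.*2.+2%:R = 2 * m.+1%:R :> R by rewrite -natrM mul2n.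
have n2' : m.+1%:R != 0 :> R by rewrite pnatr_eq0.
have n3 : m.+2%:R != 0 :> R by rewrite pnatr_eq0.
move: (m.*2.+1%:R) (m.*2.+3%:R) (m.+1%:R) (m.+2%:R) n1 n2' n3 => a b c d a0 c0 d0.
by field; rewrite a0 c0 d0.
Qed.

Definition capK : R := sphere_area (2 * L - 2)%N / (n%:R - 1).

(** The derivative of [linexcess (cos phi)] is sin phi times [excess0], that is c sin^(2L) phi.
    Between phi = 0, where [linexcess 1] vanishes, and phi = pi / 2, where [linexcess 0] is mass /
    (4L), this equates mass / (4L) with c times a Wallis integral, and [area_Aw] identifies c. *)
Lemma excess0_cosE (phi : R) : 0 < phi -> phi < pi / 2 -> excess0 (cos phi ^+ 2) = capK * sin phi ^+ n.-1.
Proof.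
have [c c0 H] := excess0_cos n2 hs pole.
suff -> : capK = c by move=> *; exact: H.
pose W phi := linexcess (cos phi) - c * sinprim L phi.
have p0 := pi_gt0 R.
have dW (phi' : R) : 0 < phi' -> phi' < pi / 2 -> is_derive phi' (1 : R) W 0.
  move=> f0 f1.
  have s0 : 0 < sin phi' by apply: sin_gt0_pi; lra.
  have co0 : 0 < cos phi' by apply: cos_gt0_pihalf; apply/andP; split; lra.
  have co1 : cos phi' < 1.
    rewrite -(@ltr_pXn2r _ 2)// ?nnegrE ?ler01 ?(ltW co0)// expr1n -(cos2Dsin2 phi') ltrDl.
    by rewrite exprn_gt0.
  have d1 : is_derive (cos phi') (1 : R) linexcess (- excess0 (cos phi' ^+ 2)).
    apply: (@sandwich_derive R linexcess (fun y => excess0 (y ^+ 2)) 0 1) => //; last exact: excess0_cvg.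
    by move=> v v' v0 vv _; apply: linexcess_sandwich => //; exact: ltW.
  have d2 := is_derive1_comp d1 (is_derive_cos phi').
  have d3 := is_derive_fM (is_derive_cst (c : R) phi' (1 : R)) (sinprim_derive L phi').
  have d4 := @is_deriveB R R R _ _ phi' 1 _ _ d2 d3.
  apply: is_derive_eq d4 _.
  have -> : L.*2 = n.-1.+1 by rewrite (prednK pole_proof) mul2n.
  by rewrite H// exprS mulr0 addr0 /=; ring.
(* The formula for [excess0] holds inside (0, pi/2) only; the two endpoints are reached by
   continuity of [W]. *)
have cW (z : R) : W y @[y --> z] --> W z.
  apply: cvgB.
    apply: (@cvg_comp _ _ _ cos linexcess); first exact: continuous_cos.
    by apply: (lipschitz_cvg (K := mass)) => y; exact: linexcess_lip.
  apply: cvgM; first exact: cvg_cst.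
  apply: differentiable_continuous; apply/derivable1_diffP.
  by apply: ex_derive; exact: sinprim_derive.
have Wc (y : R) : 0 < y -> y < pi / 2 -> W y = W (pi / 4).
  by move=> y0 y1; apply: (zero_derive_cst dW) => //; lra.
have W0 : W 0 = W (pi / 4).
  apply: (@cvg_unique _ _ (W y @[y --> (0 : R)^'+])) => //.
    exact: cvg_at_right_filter.
  apply: cvg_near_cst; near=> y; apply: Wc; near: y.
    exact: nbhs_right_gt.
  by apply: nbhs_right_lt; lra.
have Wp : W (pi / 2) = W (pi / 4).
  apply: (@cvg_unique _ _ (W y @[y --> (pi / 2 : R)^'-])) => //.
    exact: cvg_at_left_filter.
  apply: cvg_near_cst; near=> y; apply: Wc; near: y.
    by apply: nbhs_left_gt; lra.
  exact: nbhs_left_lt.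
have H1 : linexcess 1 = 0.
  rewrite -[RHS](mul0r (fine (sigma S))) -[RHS](Ex_cst sigma mS); apply: Ex_eq => x Sx.
  by rewrite [Num.max _ _]max_r ?mulr0// subr_le0 p_le1.
have H0 : linexcess 0 = mass / (4 * L%:R).
  rewrite -E_positive_part; apply: Ex_eq => x Sx.
  by rewrite subr0 max_l ?pospart_ge0// expr2.
have L0 : L%:R != 0 :> R by rewrite pnatr_eq0 -lt0n.
have AL := @sinprim_gt0 L.
move: W0; rewrite -Wp /W cos0 sinprim0 cos_pihalf H1 H0 mulr0 subrr massE => /eqP.
rewrite eq_sym subr_eq0 => /eqP e.
have e2 : sphere_area n.-1 * (n%:R - 1) = 4 * L%:R * sinprim L (pi / 2) * sphere_area (2 * L - 2)%N :> R.
  have := area_Aw L.-1; rewrite prednK//.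
  have -> : L.-1.*2 = (2 * L - 2)%N by rewrite -mul2n -subn1 mulnBr muln1.
  have -> : (2 * L - 2).+1 = n.-1 by move: n2; case: n => [|[|m]]//; rewrite subn2.
  by have -> : n.-1%:R = n%:R - 1 :> R by rewrite -[X in _ = X%:R - _](prednK pole_proof) -natr1 addrK.
have n10 : n%:R - 1 != 0 :> R.
  rewrite subr_eq0 -[1](mulr1n) eqr_nat; by rewrite gtn_eqF.
have e3 : sphere_area n.-1 = 4 * L%:R * (c * sinprim L (pi / 2)).
  by rewrite -e; field.
move: e2; rewrite e3 => e2; rewrite /capK.
apply: (mulIf n10); rewrite divfK//.
have k0 : 4 * L%:R * sinprim L (pi / 2) != 0 :> R by rewrite !mulf_neq0 ?pnatr_eq0 ?gt_eqF.
by apply: (mulfI k0); rewrite -e2; ring.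
Unshelve. all: by end_near.
Qed.

Definition cap u (t : R) : set (@vec R n) := [set x | 1 - vdot u x < t].
Definition cap0 (t : R) : set (@vec R n) := [set x | 1 - x0 x < t].
Definition capm (t : R) : R := fine (sigma (cap0 t)).

Lemma measurable_cap0 t : measurable (cap0 t).
Proof.
apply: measurable_setT_lt; last exact: measurable_cst.
apply: measurable_funB; first exact: measurable_cst.
exact: measurable_tnthR.
Qed.

Lemma measurable_cap u t : measurable (cap u t).
Proof.
apply: measurable_setT_lt; last exact: measurable_cst.
apply: measurable_funB; first exact: measurable_cst.
exact: measurable_vdot.
Qed.

Lemma cap_cap0 u t : sphere u -> sigma (cap u t) = sigma (cap0 t).
Proof.
move=> su; have [U UU [U0 _]] := reflection_exists pole su.
have [_ [_ inv]] := hs.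
rewrite -(inv _ UU _ (measurable_cap0 t)); congr (sigma _).
by apply/funext => x; rewrite /cap /cap0 /= U0.
Qed.

Lemma sigma_setI_sphere A : measurable A -> sigma (A `&` S) = sigma A.
Proof.
move=> mA; rewrite -[A in RHS](setUIDK A S) measureU0//.
- exact: measurableI.
- exact: measurableD.
- have [s0 _] := hs; apply: (subset_measure0 _ _ _ s0).
  + exact: measurableD.
  + exact: measurableC.
  + by move=> x [].
Qed.

Lemma sigma_le_mass A : measurable A -> (sigma A <= mass%:E)%E.
Proof.
move=> mA; rewrite -(sigma_setI_sphere mA) /mass fineK ?ge0_fin_numE//.
apply: le_measure; rewrite ?inE//; exact: measurableI.
Qed.

Lemma capm_ge0 t : 0 <= capm t. Proof. exact: fine_ge0. Qed.

Lemma sigma_cap0 t : sigma (cap0 t) = (capm t)%:E.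
Proof.
rewrite /capm fineK// ge0_fin_numE//.
by apply: le_lt_trans (sigma_le_mass (measurable_cap0 t)) _; rewrite ltry.
Qed.

Lemma sigma_cap u t : sphere u -> sigma (cap u t) = (capm t)%:E.
Proof. by move=> su; rewrite (cap_cap0 _ su) sigma_cap0. Qed.

Lemma capm_Ex t : capm t = E (\1_(cap0 t)).
Proof. by rewrite Ex_indic ?sigma_setI_sphere//; exact: measurable_cap0. Qed.

(** On the cap {x0 > s} of the sphere the factor [pospart] of [excess0] lies between s and 1, and s
    tends to 1 at the pole. *)
Lemma capm_Bzero (s : R) : 0 < s -> excess0 (s ^+ 2) <= capm (1 - s) <= s^-1 * excess0 (s ^+ 2).
Proof.
move=> s0.
have bx i : bmf S (fun x => tnth x i) by exact: bmf_tnth.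
have bp : bmf S (fun x => pospart (x0 x)) by apply: bmf_max (bx _) _; exact: bmf_cst.
have bc : bmf S (\1_(cap0 (1 - s)) : _ -> R) by apply: bmf_indic => //; exact: measurable_cap0.
have iE x : (s ^+ 2 < pospart (x0 x) ^+ 2)%R%:R = \1_(cap0 (1 - s)) x :> R.
  rewrite ltr_pXn2r ?nnegrE ?pospart_ge0 ?(ltW s0)// indicE; congr ((nat_of_bool _)%:R).
  have -> : (s < pospart (x0 x)) = (s < x0 x).
    by rewrite /pospart lt_max [s < 0]ltNge (ltW s0) orbF.
  apply/idP/idP => [h|]; first by rewrite inE /cap0 /=; lra.
  by rewrite inE /cap0/=; lra.
have BE : excess0 (s ^+ 2) = E (fun x => pospart (x0 x) * \1_(cap0 (1 - s)) x).
  by apply: Ex_eq => x _; rewrite iE.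
rewrite BE capm_Ex -ExZ//; last exact: bmfM.
apply/andP; split; apply: Ex_le => //; try (apply: bmfM => //; exact: bmf_cst).
- by move=> x Sx; rewrite -[leRHS]mul1r; apply: ler_wpM2r => //; exact: p_le1.
- by apply: bmfM; [exact: bmf_cst | exact: bmfM].
- move=> x Sx; rewrite mulrA indicE.
  case: (boolP (x \in _)) => [|_]; last by rewrite !mulr0.
  rewrite inE /cap0 /= !mulr1 => h; rewrite mulrC ler_pdivlMr// mul1r /pospart le_max.
  by apply/orP; left; lra.
Qed.

Definition capC : R := 2 `^ (L%:R - 1 / 2) * capK.

Lemma capK_gt0 : 0 < capK.
Proof.
rewrite divr_gt0 ?sphere_area_gt0// subr_gt0 -[1](mulr1n) ltr_nat; exact: n2.
Qed.

Lemma capC_gt0 : 0 < capC. Proof. by rewrite mulr_gt0 ?powR_gt0 ?capK_gt0. Qed.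

Lemma capm_powR (t : R) : 0 < t -> t < 1 ->
  capK * (t * (2 - t)) `^ (L%:R - 1 / 2) <= capm t <= (1 - t)^-1 * (capK * (t * (2 - t)) `^ (L%:R - 1 / 2)).
Proof.
move=> t0 t1; have s0 : 0 < 1 - t by lra.
have := capm_Bzero s0; rewrite subKr.
suff -> : excess0 ((1 - t) ^+ 2) = capK * (t * (2 - t)) `^ (L%:R - 1 / 2) by [].
(* The cap of height t has angular radius phi, with sin^2 phi = t (2 - t). *)
pose phi := acos (1 - t).
have cp : cos phi = 1 - t by apply: acosK; rewrite in_itv/=; apply/andP; split; lra.
have phi0 : 0 < phi by apply: acos_gt0; apply/andP; split; lra.
have phipi : phi < pi by apply: acos_ltpi; apply/andP; split; lra.
have phi1 : phi < pi / 2.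
  have p0 := pi_gt0 R.
  by rewrite -ltr_cos ?in_itv/= ?cos_pihalf ?cp//; apply/andP; split; lra.
rewrite -cp excess0_cosE//; congr (_ * _).
have sp : 0 < sin phi by apply: sin_gt0_pi; rewrite phi0 phipi.
have st : t * (2 - t) = sin phi ^+ 2.
  have := cos2Dsin2 phi; rewrite cp; lra.
apply/eqP; rewrite -(@eqrXn2 _ 2)// ?powR_ge0 ?exprn_ge0 ?(ltW sp)//.
by rewrite powR_pred ?st ?sqr_ge0// -!exprM mulnC.
Qed.

(** The relative error is linear in t: the factor (2 - t)^p differs from 2^p by at most the factor 1
    - L t, and 1 / (1 - t) <= 1 + 2 t for t <= 1/2. *)
Lemma capm_equiv (t : R) : 0 < t -> t <= 1 / 2 ->
  `|capm t - capC * t `^ (L%:R - 1 / 2)| <= capC * (L%:R + 2) * t * t `^ (L%:R - 1 / 2).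
Proof.
move=> t0 t1; have t11 : t < 1 by lra.
have := capm_powR t0 t11; rewrite powRM; [|lra|lra].
set p := L%:R - 1 / 2; set T := t `^ p => /andP[h1 h2].
have T0 : 0 <= T by exact: powR_ge0.
have C0 := capC_gt0; have K0 := capK_gt0.
have p0 : 0 <= p by rewrite ltW// p_gt0.
have L0 : 1 <= L%:R :> R by rewrite ler1n.
have up : (2 - t) `^ p <= 2 `^ p.
  by apply: ge0_ler_powR; rewrite ?nnegrE//; lra.
pose b := 1 - t / 2.
have b0 : 0 < b by rewrite /b; lra.
have b1 : b <= 1 by rewrite /b; lra.
have lo : 2 `^ p * (1 - L%:R * t) <= (2 - t) `^ p.
  have -> : 2 - t = 2 * b by rewrite /b; field.
  rewrite powRM//; last exact: ltW.
  apply: ler_wpM2l; first exact: powR_ge0.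
  (* As b <= 1, raising the exponent from L - 1/2 to L lowers the power, and Bernoulli's inequality
     applies to the natural exponent. *)
  apply: (@le_trans _ _ (b ^+ L)).
    rewrite -[X in 1 - X * _](mulr1 L%:R).
    have : 1 - L%:R * (t / 2) <= b ^+ L.
      elim: (L) => [|m IH]; first by rewrite mul0r subr0 expr0.
      rewrite exprS -natr1.
      have : b * (1 - m%:R * (t / 2)) <= b * b ^+ m by rewrite ler_pM2l.
      have : 0 <= m%:R * (t / 2) * (t / 2) by rewrite !mulr_ge0//; lra.
      by rewrite /b; lra.
    have : 0 <= L%:R * t by rewrite mulr_ge0//; lra.
    lra.
  rewrite -powR_mulrn; last exact: ltW.
  have -> : L%:R = p + 2^-1 by rewrite /p; field.
  rewrite powRD; last by rewrite (gt_eqF b0) implybT.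
  rewrite -[leRHS]mulr1; apply: ler_wpM2l; first exact: powR_ge0.
  by rewrite powR12_sqrt ?(ltW b0)// -sqrtr1 ler_wsqrtr.
have inv : (1 - t)^-1 <= 1 + 2 * t.
  rewrite -[leLHS]mul1r ler_pdivrMr; last lra.
  have : 0 <= t * (1 - 2 * t) by rewrite mulr_ge0//; lra.
  lra.
have CT : 0 <= capK * T by rewrite mulr_ge0// ltW.
have j1' : capC * T * (1 - L%:R * t) <= capm t.
  apply: le_trans h1; rewrite /capC.
  have := ler_wpM2l CT lo; lra.
have j2 : capm t <= capC * T * (1 + 2 * t).
  apply: le_trans h2 _.
  apply: (@le_trans _ _ ((1 - t)^-1 * (capC * T))).
    apply: ler_wpM2l; first by rewrite invr_ge0; lra.
    by have := ler_wpM2l CT up; rewrite /capC; lra.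
  rewrite mulrC; apply: ler_wpM2l => //; rewrite mulr_ge0//; exact: ltW.
have CTt : 0 <= capC * T * t by exact: mulr_ge0 (mulr_ge0 (ltW C0) T0) (ltW t0).
have CTL : 0 <= capC * T * t * L%:R by apply: mulr_ge0 CTt _.
by rewrite ler_norml; apply/andP; split; lra.
Qed.

Lemma capm_le : exists2 K : R, 0 < K & forall t : R, 0 <= t -> capm t <= K * t `^ (L%:R - 1 / 2).
Proof.
set p := L%:R - 1 / 2; have p0 : 0 < p := p_gt0.
have C0 := capC_gt0; have M0 : 0 <= mass := mass_ge0 sigma.
have P0 : 0 < 2 `^ p :> R by rewrite powR_gt0.
(* The first summand serves t <= 1/2 through [capm_equiv]; the second serves t > 1/2, where (2 t)^p
   >= 1 and the total mass is a bound. *)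
exists (capC * (L%:R + 3) + mass * 2 `^ p).
  have h3 : 0 < L%:R + 3 :> R by apply: ltr_wpDl.
  exact: ltr_pwDl (mulr_gt0 C0 h3) (mulr_ge0 M0 (ltW P0)).
move=> t; rewrite le_eqVlt => /predU1P[<-|t0].
  rewrite powR0 ?gt_eqF// mulr0 capm_Ex.
  rewrite -[leRHS](mul0r (fine (sigma S))) -[leRHS](Ex_cst sigma mS) le_eqVlt; apply/orP; left.
  apply/eqP; apply: Ex_eq => x Sx; rewrite indicE memNset// /cap0/=.
  by apply/negP; rewrite -leNgt; have := sphere_tnth_norm pole Sx; rewrite ler_norml; lra.
have T0 : 0 <= t `^ p by exact: powR_ge0.
have [t1|t1] := leP t (1 / 2).
  have := capm_equiv t0 t1; rewrite -/p ler_norml => /andP[_ h].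
  have : capC * (L%:R + 2) * t * t `^ p <= capC * (L%:R + 2) * t `^ p.
    apply: ler_wpM2r => //; rewrite -[leRHS]mulr1; apply: ler_wpM2l; last lra.
    exact: mulr_ge0 (ltW C0) (addr_ge0 (ler0n _ _) (ler0n _ _)).
  have : 0 <= mass * 2 `^ p * t `^ p by apply: mulr_ge0 (mulr_ge0 M0 (ltW P0)) T0.
  lra.
have : mass <= mass * 2 `^ p * t `^ p.
  rewrite -mulrA -[leLHS]mulr1; apply: ler_wpM2l => //.
  rewrite -powRM//; last by exact: ltW.
  apply: (@le_trans _ _ (1 `^ p)); first by rewrite powR1.
  apply: ge0_ler_powR; rewrite ?nnegrE//; lra.
have : 0 <= capC * (L%:R + 3) * t `^ p.
  by apply: mulr_ge0 T0; exact: mulr_ge0 (ltW C0) (addr_ge0 (ler0n _ _) (ler0n _ _)).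
have : capm t <= mass.
  by rewrite -lee_fin -sigma_cap0; exact: sigma_le_mass (measurable_cap0 t).
lra.
Qed.

End CapMeasure.

(** * Rotations, orbits and Haar averages *)

Section SupDistance.
Context {R : realType}.
Variable n : nat.
Hypothesis n0 : (0 < n)%N.
Implicit Types (x y z : @vec R n).

Lemma vdist_coord x y (e : R) (i : 'I_n) : vdist x y < e -> `|tnth x i - tnth y i| < e.
Proof.
apply: le_lt_trans; rewrite -sqrtr_sqr; apply: ler_wsqrtr.
by rewrite (bigD1 i)//= lerDl; apply: sumr_ge0 => j _; exact: sqr_ge0.
Qed.

Lemma vdist_lt_coord x y (e : R) : 0 < e ->
  (forall i, `|tnth x i - tnth y i| < e / n%:R) -> vdist x y < e.
Proof.
move=> e0 H; have nR : 1 <= n%:R :> R by rewrite ler1n.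
rewrite -[ltRHS](ger0_norm (ltW e0)) -sqrtr_sqr ltr_sqrt ?exprn_gt0//.
apply: (@lt_le_trans _ _ (\sum_(i < n) (e / n%:R) ^+ 2)).
  apply: ltr_sum; first by apply/hasP; exists (Ordinal n0); rewrite ?mem_index_enum.
  move=> i _; rewrite -[ltLHS]real_normK ?num_real// ltr_pXn2r// nnegrE//.
  by rewrite divr_ge0// ltW.
rewrite sumr_const card_ord -(mulr_natl (_ ^+ 2)) exprMn exprVn.
have -> : n%:R * (e ^+ 2 / n%:R ^+ 2) = e ^+ 2 / n%:R.
  by field; rewrite pnatr_eq0 -lt0n.
by rewrite ler_pdivrMr ?(lt_le_trans ltr01)// ler_peMr// sqr_ge0.
Qed.

Lemma vdist_xx x : vdist x x = 0.
Proof. by rewrite /vdist big1 ?sqrtr0// => i _; rewrite subrr expr0n. Qed.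

Lemma vdist_sphere x y : sphere x -> sphere y -> vdist x y = Num.sqrt (2 * (1 - vdot x y)).
Proof.
move=> sx sy; rewrite /vdist; congr Num.sqrt.
transitivity (\sum_(i < n) (tnth x i ^+ 2 - 2 * (tnth x i * tnth y i) + tnth y i ^+ 2)).
  by apply: eq_bigr => i _; ring.
rewrite big_split/= sumrB (sphere_sum sx) (sphere_sum sy) -mulr_sumr -/(vdot x y); ring.
Qed.

End SupDistance.

Section TrigPeriod.
Context {R : realType}.
Implicit Types (a b : R) (m : int).

Lemma sin_lip a b : `|sin b - sin a| <= `|b - a|.
Proof.
wlog ab : a b / a < b.
  move=> H; case: (ltgtP a b) => [|ba|->]; first exact: H.
    by rewrite distrC [`|b - a|]distrC; exact: H.
  by rewrite !subrr.
have [c _ ->] := mvt_closed ab (fun x _ _ => is_derive_sin x).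
by rewrite normrM ler_piMr// ler_norml cos_geN1 cos_le1.
Qed.

Lemma cos_lip a b : `|cos b - cos a| <= `|b - a|.
Proof.
rewrite -!sinDpihalf; apply: le_trans (sin_lip _ _) _.
by rewrite opprD addrACA subrr addr0.
Qed.

Lemma sinDint a m : sin (a + 2 * pi * m%:~R) = sin a.
Proof.
have e : 2 * pi = pi *+ 2 :> R by rewrite mulr_natl.
case: m => k; rewrite e.
  by rewrite mulr_natr (periodicn (@sinD2pi R)).
rewrite NegzE mulrNz mulrN mulr_natr -[in RHS](subrK (pi *+ 2 *+ k.+1) a).
by rewrite (periodicn (@sinD2pi R)).
Qed.

Lemma cosDint a m : cos (a + 2 * pi * m%:~R) = cos a.
Proof. by rewrite -!sinDpihalf addrAC sinDint. Qed.

Lemma fracR_ge0 a : 0 <= fracR a.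
Proof. by rewrite /fracR subr_ge0 ge_floor. Qed.

Lemma fracR_lt1 a : fracR a < 1.
Proof. by rewrite /fracR ltrBlDl -intrD1 lt_succ_floor. Qed.

Lemma fracRDint a m : fracR (a + m%:~R) = fracR a.
Proof. by rewrite /fracR floorDrz ?intr_int// intrKfloor intrD opprD addrACA subrr addr0. Qed.

Lemma distZDint a m : distZ (a + m%:~R) = distZ a.
Proof. by rewrite /distZ fracRDint. Qed.

Lemma fracR_int a : exists m, fracR a = a + m%:~R.
Proof. by exists (- Num.floor a); rewrite mulrNz. Qed.

Lemma distZ_lt a (e : R) : distZ a < e -> exists m, `|a + m%:~R| < e.
Proof.
rewrite /distZ gt_min => /orP[h|h].
  exists (- Num.floor a); rewrite mulrNz ger0_norm//; exact: fracR_ge0.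
exists (- Num.floor a - 1); rewrite intrD mulrNz addrA ler0_norm ?opprB; last first.
  by rewrite subr_le0 ltW// fracR_lt1.
by move: h; rewrite /fracR opprB.
Qed.

Lemma trig_close a b (e : R) : distZ (a - b) < e ->
  `|cos (2 * pi * a) - cos (2 * pi * b)| <= 2 * pi * e /\
  `|sin (2 * pi * a) - sin (2 * pi * b)| <= 2 * pi * e.
Proof.
move=> /distZ_lt[m me]; have p0 := pi_gt0 R.
rewrite -(cosDint (2 * pi * a) m) -(sinDint (2 * pi * a) m).
have h : `|(2 * pi * a + 2 * pi * m%:~R) - 2 * pi * b| <= 2 * pi * e.
  have -> : 2 * pi * a + 2 * pi * m%:~R - 2 * pi * b = 2 * pi * (a - b + m%:~R) by ring.
  rewrite normrM (@gtr0_norm _ (2 * pi)); last by rewrite mulr_gt0.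
  by rewrite ler_pM2l ?mulr_gt0// ltW.
by split; apply: le_trans h; [exact: cos_lip | exact: sin_lip].
Qed.

End TrigPeriod.

(** * Rotated vectors and the torus action *)

Section Rotations.
Context {R : realType}.
Variable L : nat.
Hypothesis L1 : (1 <= L)%N.
Local Notation n := (2 * L)%N.
Variable th : L.-tuple R.
Variable q : @vec R n.
Hypothesis hq : sphere q.
Implicit Types (f g : nat -> R) (z : @vec R L) (i j : int).

Lemma half_ord_lt (i : 'I_n) : (i %/ 2 < L)%N.
Proof. by have := ltn_ord i; rewrite ltn_divLR// [(L * 2)%N]mulnC. Qed.

Lemma sum_pairs (F : nat -> R) : \sum_(k < n) F k = \sum_(l < L) (F (2 * l)%N + F (2 * l).+1).
Proof.
elim: (L) => [|m IH]; first by rewrite muln0 !big_ord0.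
by rewrite mulnS !big_ord_recr /= IH addrA.
Qed.

Lemma rot2_orth (p : R) a b : (a < 2)%N -> (b < 2)%N ->
  rot2 p 0 a * rot2 p 0 b + rot2 p 1 a * rot2 p 1 b = (a == b)%:R.
Proof.
have e := cos2Dsin2 p.
by case: a => [|[|]]//; case: b => [|[|]]// _ _ /=; rewrite ?mulrN ?mulNr ?opprK -?expr2 ?e//;
  rewrite 1?[cos p * _]mulrC ?addNr// ?subrr// addrC e.
Qed.

Lemma blockrot_orthogonal f : orthogonal_mx (blockrot L f).
Proof.
apply/matrixP => i j; rewrite !mxE.
under eq_bigr do rewrite !mxE.
pose b k a := if (k %/ 2 == a %/ 2)%N then rot2 (f (k %/ 2)%N) (k %% 2)%N (a %% 2)%N else 0.
rewrite (sum_pairs (fun k => b k i * b k j)) /b.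
have il : (i %/ 2 < L)%N by exact: half_ord_lt.
have e1 l : (2 * l %/ 2 = l)%N by rewrite mulKn.
have e2 l : ((2 * l).+1 %/ 2 = l)%N by rewrite -addn1 mulnC divnMDl// addn0.
have m1 l : (2 * l %% 2 = 0)%N by rewrite modnMr.
have m2 l : ((2 * l).+1 %% 2 = 1)%N by rewrite -addn1 mulnC modnMDl.
under eq_bigr do rewrite e1 e2 m1 m2.
rewrite (bigD1 (Ordinal il))//= eqxx big1 ?addr0; last first.
  move=> l; rewrite -val_eqE /= => /negbTE ->; by rewrite !mul0r addr0.
case: (eqVneq (i %/ 2)%N (j %/ 2)%N) => [e|e].
  have l2 k : (k %% 2 < 2)%N by rewrite ltn_mod.
  have := rot2_orth (f (i %/ 2)%N) (l2 i) (l2 j); rewrite /= => ->.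
  congr ((nat_of_bool _)%:R); rewrite -val_eqE /=.
  by rewrite [X in _ = (X == _)](divn_eq i 2) [X in _ = (_ == X)](divn_eq j 2) e eqn_add2l.
rewrite !mulr0 addr0 (_ : (i == j) = false)//.
by apply/negbTE; apply: contraNneq e => ->.
Qed.

(** The common form of [uvec] and [Phi], with the angle of each block as parameter; the transpose in
    [uvec] becomes a change of sign of the angle. *)
Definition bl f : @vec R n := mapply (blockrot L f) q.

Lemma bl_sphere f : sphere (bl f).
Proof. by rewrite /sphere/= vdot_mapply//; exact: blockrot_orthogonal. Qed.

Lemma bl_close f g (e : R) : 0 <= e ->
  (forall l, (l < L)%N -> `|cos (f l) - cos (g l)| <= e /\ `|sin (f l) - sin (g l)| <= e) ->
  forall k, `|tnth (bl f) k - tnth (bl g) k| <= n%:R * e.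
Proof.
move=> e0 H k; rewrite /bl !tnth_mktuple -sumrB.
apply: le_trans (ler_norm_sum _ _ _) _.
rewrite -[n in n%:R]card_ord mulr_natl -sumr_const; apply: ler_sum => j _.
rewrite -mulrBl normrM -[leRHS]mulr1; apply: ler_pM => //; last exact: sphere_tnth_norm.
rewrite !mxE; case: ifP => _; last by rewrite subrr normr0.
have kl : (k %/ 2 < L)%N by exact: half_ord_lt.
have [hc hs] := H _ kl.
case: (k %% 2)%N => [|a]; case: (j %% 2)%N => [|b] //=.
by rewrite -opprD normrN.
Qed.

Lemma bl_eq f g : (forall l, (l < L)%N -> cos (f l) = cos (g l) /\ sin (f l) = sin (g l)) -> bl f = bl g.
Proof.
move=> H; apply/eq_from_tnth => k; apply/eqP; rewrite -subr_eq0 -normr_le0.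
have := @bl_close f g 0 (lexx _); rewrite mulr0; apply => l lL.
by have [-> ->] := H l lL; rewrite !subrr normr0.
Qed.

Lemma uvecE i : uvec th q i = bl (fun l => - (i%:~R * nth 0 (tval th) l)).
Proof.
rewrite /uvec /bl; congr mapply; apply/matrixP => a b; rewrite !mxE.
rewrite eq_sym; case: eqP => // ->.
by case: (a %% 2)%N => [|c]; case: (b %% 2)%N => [|d] /=; rewrite ?cosN ?sinN ?opprK.
Qed.

Lemma uvec_sphere i : sphere (uvec th q i).
Proof. by rewrite uvecE; exact: bl_sphere. Qed.

Lemma Phi_sphere z : sphere (Phi q z).
Proof. exact: bl_sphere. Qed.

Definition tshift i : @vec R L := [tuple fracR (i%:~R * tnth (theta th) l) | l < L].

Lemma tnth_tshift i l : tnth (tshift i) l = fracR (i%:~R * tnth (theta th) l).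
Proof. by rewrite [LHS]tnth_mktuple. Qed.

Lemma tnth_torus_add i z l :
  tnth (torus_add (tshift i) z) l = fracR (tnth z l + fracR (i%:~R * tnth (theta th) l)).
Proof. by rewrite [LHS]tnth_mktuple tnth_tshift. Qed.

Lemma theta_mul l (lL : (l < L)%N) i :
  2 * pi * (i%:~R * tnth (theta th) (Ordinal lL)) = i%:~R * nth 0 (tval th) l.
Proof.
have p0 : pi != 0 :> R by rewrite gt_eqF// pi_gt0.
rewrite tnth_mktuple (tnth_nth 0) /=; move: (th`_l) i%:~R (pi : R) p0 => x y p p0.
by field.
Qed.

Lemma Phi_torus_add_close z i j (e : R) :
  (forall l, distZ (tnth z l - j%:~R * tnth (theta th) l) < e) ->
  forall k, `|tnth (Phi q (torus_add (tshift i) z)) k - tnth (uvec th q (i + j)) k|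
     <= n%:R * (2 * pi * e).
Proof.
move=> H; rewrite uvecE.
have e0 : 0 <= e.
  have := H (Ordinal L1); set a := _ - _ => h; apply/ltW; apply: le_lt_trans h.
  by rewrite /distZ le_min fracR_ge0 subr_ge0 ltW// fracR_lt1.
apply: bl_close; first by rewrite mulr_ge0// mulr_ge0// ltW// pi_gt0.
move=> l lL; rewrite !cosN !sinN -(theta_mul lL).
have -> : Defs.coord (torus_add (tshift i) z) l = tnth (torus_add (tshift i) z) (Ordinal lL).
  by rewrite (tnth_nth 0).
rewrite -[X in _ /\ `|X| <= _]opprD normrN.
apply: (@trig_close R _ _ e).
rewrite tnth_torus_add; set t := tnth (theta th) _; set x := tnth z _.
have [m ->] := fracR_int (i%:~R * t).
have [m' ->] := fracR_int (x + (i%:~R * t + m%:~R)).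
have -> : x + (i%:~R * t + m%:~R) + m'%:~R - (i + j)%:~R * t = x - j%:~R * t + (m + m')%:~R.
  by rewrite !intrD; ring.
by rewrite distZDint; exact: H.
Qed.

Lemma tshift_Hq i : Hq th (tshift i).
Proof.
split => [l|e e0]; first by rewrite tnth_mktuple fracR_ge0 fracR_lt1.
exists i => l; rewrite tnth_tshift; have [m ->] := fracR_int (i%:~R * tnth (theta th) l).
rewrite addrAC subrr distZDint /distZ /fracR floor0 subrr subr0.
by rewrite min_l.
Qed.

Lemma torus_add_Hq i z : Hq th z -> Hq th (torus_add (tshift i) z).
Proof.
move=> [_ H]; split => [l|e e0]; first by rewrite tnth_mktuple fracR_ge0 fracR_lt1.
have [j Hj] := H e e0; exists (i + j) => l; rewrite tnth_torus_add.
have := Hj l; set t := tnth (theta th) _; set x := tnth z _.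
have [m ->] := fracR_int (i%:~R * t).
have [m' ->] := fracR_int (x + (i%:~R * t + m%:~R)).
have -> : x + (i%:~R * t + m%:~R) + m'%:~R - (i + j)%:~R * t = x - j%:~R * t + (m + m')%:~R.
  by rewrite !intrD; ring.
by rewrite distZDint.
Qed.

Lemma Phi_shift0 z : Phi q (torus_add (tshift 0) z) = Phi q z.
Proof.
apply: bl_eq => l lL; rewrite !cosN !sinN.
have -> : Defs.coord (torus_add (tshift 0) z) l = tnth (torus_add (tshift 0) z) (Ordinal lL).
  by rewrite (tnth_nth 0).
have -> : Defs.coord z l = tnth z (Ordinal lL) by rewrite (tnth_nth 0).
rewrite tnth_torus_add mul0r /fracR floor0 subrr addr0 mulrBr -mulrN -mulrNz.
by rewrite cosDint sinDint.
Qed.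

Lemma n_gt0 : (0 < n)%N. Proof. by rewrite muln_gt0. Qed.

Lemma orbit_uvec i : orbit_closure th q (uvec th q i).
Proof. by move=> e e0; exists i; rewrite vdist_xx. Qed.

(** The bound d is uniform in i: if z is close to j theta, then z + i theta is equally close to (i +
    j) theta, since translations of the torus are isometries. *)
Lemma Phi_close (e : R) : 0 < e -> exists2 d : R, 0 < d & forall z i j,
  (forall l, distZ (tnth z l - j%:~R * tnth (theta th) l) < d) ->
  vdist (Phi q (torus_add (tshift i) z)) (uvec th q (i + j)) < e.
Proof.
move=> e0; have nR : 0 < n%:R :> R by rewrite ltr0n n_gt0.
have p0 := pi_gt0 R.
exists (e / n%:R / (n%:R * (2 * pi)) / 2).
  by rewrite divr_gt0// divr_gt0 ?divr_gt0 ?mulr_gt0.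
move=> z i j H; apply: vdist_lt_coord => // [|k]; first exact: n_gt0.
apply: le_lt_trans (Phi_torus_add_close i H k) _.
have -> : n%:R * (2 * pi * (e / n%:R / (n%:R * (2 * pi)) / 2)) = e / n%:R / 2.
  by move: (n%:R : R) (pi : R) nR p0 => N p N0 p0; field; rewrite !gt_eqF.
have : 0 < e / n%:R by rewrite divr_gt0.
lra.
Qed.

Lemma Phi_orbit z : Hq th z -> orbit_closure th q (Phi q z).
Proof.
move=> [_ H] e /Phi_close[d d0 Hd]; have [j Hj] := H d d0.
by exists (0 + j); rewrite -Phi_shift0; exact: Hd.
Qed.

Lemma orbit_sphere y : orbit_closure th q y -> sphere y.
Proof.
move=> H; apply/eqP; rewrite -subr_eq0 -normr_le0.
apply/ler_addgt0Pl => e e0; rewrite addr0.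
have nR : 0 < n%:R :> R by rewrite ltr0n n_gt0.
pose d := Num.min 1 (e / (3 * n%:R)).
have d0 : 0 < d by rewrite lt_min ltr01/= divr_gt0// mulr_gt0.
have d1 : d <= 1 by rewrite ge_min lexx.
have de : d <= e / (3 * n%:R) by rewrite ge_min lexx orbT.
have [i yi] := H d d0.
rewrite -(uvec_sphere i) /vdot -sumrB.
apply: le_trans (ler_norm_sum _ _ _) _.
apply: (@le_trans _ _ (\sum_(k < n) (3 * d))); last first.
  rewrite sumr_const card_ord -(mulr_natl (3 * d)) mulrA [n%:R * 3]mulrC [_ * d]mulrC.
  by rewrite -ler_pdivlMr// mulr_gt0.
apply: ler_sum => k _.
have h := vdist_coord k yi; have u1 := sphere_tnth_norm k (uvec_sphere i).
set a := tnth y k in h *; set b := tnth (uvec th q i) k in h u1 *.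
have -> : a * a - b * b = (a - b) * (a - b + 2 * b) by ring.
rewrite normrM [3 * d]mulrC; apply: ler_pM => //; first exact: ltW.
apply: le_trans (ler_normD _ _) _; rewrite normrM (@ger0_norm _ 2)//; lra.
Qed.

End Rotations.

Lemma compact_bounded_above {R : realType} (V : normedModType R) (A : set V) (f : V -> R) :
  compact A -> (forall a, A a -> exists M h : R, 0 < h /\
     forall z, A z -> `|z - a| < h -> f z <= M) ->
  exists M : R, forall a, A a -> f a <= M.
Proof.
move=> cA H.
have := (compact_near_coveringP A).1 cA _ (pinfty_nbhs R) (fun M a => A a -> f a <= M) _.
case.
- move=> a Aa; have [M [h [h0 Hh]]] := H a Aa.
  exists ([set x | `|x - a| < h], [set r | M < r]) => /=.
    split => /=; last by exists M; split => //; exact: num_real.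
    apply/nbhs_ballP; exists h => //= x; by rewrite -ball_normE /= distrC.
  by move=> [x r] /= [xa Mr] Ax; apply: le_trans (Hh _ Ax xa) (ltW Mr).
- move=> M [Mr HM]; exists (M + 1) => a Aa; by apply: (HM (M + 1)) => //; rewrite ltrDl.
Qed.

Section ExCvg.
Context {d} {X : measurableType d} {R : realType}.
Variable mu : {measure set X -> \bar R}.
Variable D : set X.
Hypotheses (mD : measurable D) (muD : (mu D < +oo)%E).

Lemma Ex_cvg (f_ : nat -> X -> R) (f : X -> R) (M : R) :
  (forall n, measurable_fun D (f_ n)) -> measurable_fun D f ->
  (forall n x, D x -> `|f_ n x| <= M) ->
  {ae mu, forall x, D x -> f_ n x @[n --> \oo] --> f x} ->
  bmf D f -> (fun n => Ex mu D (f_ n)) @ \oo --> Ex mu D f.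
Proof.
move=> mf_ mf fM fc bf.
have [] := @dominated_convergence _ _ _ mu D mD
   (fun n x => (f_ n x)%:E) (fun x => (f x)%:E) (cst M%:E).
- by move=> n; exact/measurable_EFinP.
- exact/measurable_EFinP.
- apply: filterS fc => x H Dx; apply: cvg_EFin; [exact: nearW | exact: H].
- by apply: (bmf_int mD muD); exact: bmf_cst.
- by apply: aeW => x n Dx; rewrite lee_fin fM.
move=> _ _; rewrite -ExE// => H.
exact: (fine_cvg H).
Qed.

End ExCvg.

(** * The density near the orbit closure *)

Section NearOrbit.
Context {R : realType}.
Variable L : nat.
Hypothesis L1 : (1 <= L)%N.
Local Notation n := (2 * L)%N.
Variable th : L.-tuple R.
Variable q : @vec R n.
Hypothesis hq : sphere q.
Variable rho : @vec R n -> R.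
Hypothesis hnear : cont_pos_near (orbit_closure th q) rho.
Implicit Types (x y : @vec R n) (v : 'rV[R]_n).

Local Notation O := (orbit_closure th q).

(** Row vectors carry the topology in which compactness is used, tuples the sigma-algebra; [tup] and
    [row] pass between them. *)
Let tup v : @vec R n := [tuple v 0 i | i < n].
Let row y : 'rV[R]_n := \row_i tnth y i.

Let tupK y : tup (row y) = y.
Proof. by apply/eq_from_tnth => i; rewrite tnth_mktuple mxE. Qed.

Let A := [set v | O (tup v)].

Let tup_norm v w (e : R) : 0 < e -> `|v - w| < e / n%:R -> vdist (tup v) (tup w) < e.
Proof.
move=> e0 H; apply: vdist_lt_coord => // [|i]; first exact: n_gt0.
by rewrite !tnth_mktuple; apply: le_lt_trans H; have := rV_norm_ge (v - w) i; rewrite !mxE.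
Qed.

Let nR : 0 < n%:R :> R. Proof. by rewrite ltr0n n_gt0. Qed.

Let compact_A : compact A.
Proof.
apply: bounded_closed_compact.
  exists 1; split; first exact: num_real.
  move=> r r1 v /= /(orbit_sphere L1 hq) sv.
  have r0 : 0 < r by apply: lt_trans r1.
  rewrite -[v]subr0; apply/ltW/rV_norm_lt => // i; rewrite mxE subr0; apply: le_lt_trans r1.
  by have := sphere_tnth_norm i sv; rewrite tnth_mktuple.
move=> v clv e e0 /=.
have e1 : 0 < e / n%:R / 2 by rewrite !divr_gt0.
have [w [sinprim vw]] := clv (ball v (e / n%:R / 2)) (nbhsx_ballx _ _ e1).
have [i yi] := sinprim _ e1.
exists i; apply: vdist_lt_coord => // [|k]; first exact: n_gt0.
have h1 := vdist_coord k yi; rewrite tnth_mktuple in h1; rewrite tnth_mktuple.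
have h2 : `|v 0 k - w 0 k| < e / n%:R / 2.
  apply: le_lt_trans (_ : `|v - w| < _); first by have := rV_norm_ge (v - w) k; rewrite !mxE.
  by move: vw; rewrite -ball_normE.
apply: le_lt_trans (ler_distD (w 0 k) _ _) _; lra.
Qed.

(** The point x lies on the sphere but possibly off the orbit closure, as the points of a cap around
    some u_i do; h is uniform along the orbit. *)
Lemma rho_unif (e : R) : 0 < e -> exists2 h : R, 0 < h &
  forall y x, O y -> sphere x -> vdist x y < h -> `|rho x - rho y| < e.
Proof.
move=> e0; have [dl dl0 Hd] := hnear.
pose U := [set v | (nbhd_set O dl `&` @sphere R n) (tup v)].
have AU : A `<=` U.
  move=> v Av; split; last exact: orbit_sphere Av.
  by exists (tup v) => //; rewrite vdist_xx.
have [] := @compact_unif R _ A U (fun v => rho (tup v)) compact_A AU _ e e0.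
  move=> a Aa r r0; have [_ /(_ _ r0)[h h0 Hh]] := Hd _ (AU _ Aa).
  exists (h / n%:R); first by rewrite divr_gt0.
  by move=> z Uz za; apply: Hh => //; exact: tup_norm.
move=> h h0 H; exists (Num.min h dl); first by rewrite lt_min h0.
move=> y x Oy sx; rewrite lt_min => /andP[xy1 xy2].
have := H (row y) (row x); rewrite /A /U /= !tupK; apply => //.
  by split => //; exists y.
by apply: rV_norm_lt => // i; rewrite !mxE; exact: vdist_coord.
Qed.

Let rho_pos y : O y -> 0 < rho y.
Proof.
move=> Oy; have [dl dl0 Hd] := hnear; apply: (Hd y _).1.
by split; [exists y; rewrite ?vdist_xx | exact: orbit_sphere Oy].
Qed.

Lemma rho_bounded : exists2 M : R, 0 < M & forall y, O y -> 0 <= rho y <= M.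
Proof.
have [h h0 Hh] := rho_unif ltr01.
have [|M HM] := compact_bounded_above (f := fun v => rho (tup v)) compact_A.
  move=> a Aa; exists (rho (tup a) + 1), (h / n%:R); split; first by rewrite divr_gt0.
  move=> z Az za; have sz : sphere (tup z) by exact: orbit_sphere Az.
  have := Hh _ _ Aa sz (tup_norm h0 za); rewrite ltr_norml; lra.
exists (Num.max M 1); first by rewrite lt_max ltr01 orbT.
move=> y Oy; rewrite ltW ?rho_pos//= le_max; apply/orP; left.
by rewrite -(tupK y); apply: HM; rewrite /A/= tupK.
Qed.

Lemma rho_lower : exists2 c : R, 0 < c & forall y, O y -> c <= rho y.
Proof.
have [|M HM] := compact_bounded_above (f := fun v => (rho (tup v))^-1) compact_A.
  move=> a Aa; have ra := rho_pos Aa.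
  have r2 : 0 < rho (tup a) / 2 by rewrite divr_gt0.
  have [h h0 Hh] := rho_unif r2.
  exists (rho (tup a) / 2)^-1, (h / n%:R); split; first by rewrite divr_gt0.
  move=> z Az za; have sz : sphere (tup z) by exact: orbit_sphere Az.
  rewrite lef_pV2 ?posrE ?rho_pos//.
  have := Hh _ _ Aa sz (tup_norm h0 za); rewrite ltr_norml; lra.
have M0 : 0 < Num.max M 1 by rewrite lt_max ltr01 orbT.
exists (Num.max M 1)^-1; first by rewrite invr_gt0.
move=> y Oy; rewrite -[leRHS]invrK lef_pV2 ?posrE ?invr_gt0 ?rho_pos//.
rewrite le_max; apply/orP; left.
by rewrite -(tupK y); apply: HM; rewrite /A/= tupK.
Qed.

End NearOrbit.

(** * Orbit averages converge to the Haar integral *)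

Section Averages.
Context {R : realType}.
Variable L : nat.
Hypothesis L1 : (1 <= L)%N.
Local Notation n := (2 * L)%N.
Variable th : L.-tuple R.
Variable q : @vec R n.
Hypothesis hq : sphere q.
Variable rho : @vec R n -> R.
Hypothesis hnear : cont_pos_near (orbit_closure th q) rho.
Hypotheses (mrho : measurable_fun setT rho) (rho0 : forall y, 0 <= rho y).
Variable mH : probability (@vec R L) R.
Hypothesis hmH : is_Haar_Hq th mH.
Implicit Types (z : @vec R L).

Local Notation O := (orbit_closure th q).
Local Notation H := (Hq th).

Lemma measurable_fracR : measurable_fun setT (@fracR R).
Proof.
apply: measurable_funB; first exact: measurable_id.
apply: nondecreasing_measurable => // x y xy.
by rewrite ler_int; exact: le_floor.
Qed.

Lemma measurable_distZ : measurable_fun setT (@distZ R).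
Proof.
apply: measurable_minr; first exact: measurable_fracR.
by apply: measurable_funB; [exact: measurable_cst | exact: measurable_fracR].
Qed.

Lemma measurable_torus_add (h : @vec R L) : measurable_fun setT (torus_add h).
Proof.
apply/measurable_fun_tnthP => l.
rewrite (_ : _ \o _ = (@fracR R) \o (fun z => tnth z l + tnth h l)).
  apply: (measurableT_comp measurable_fracR); apply: measurable_funD; last exact: measurable_cst.
  exact: measurable_tnthR.
by apply/funext => z /=; rewrite tnth_mktuple.
Qed.

Lemma measurable_forall_ord k (F : 'I_k -> set (@vec R L)) :
  (forall l, measurable (F l)) -> measurable [set z | forall l, F l z].
Proof.
move=> mF; rewrite (_ : [set z | _] = \bigcap_(l in [set: 'I_k]) F l).
  by apply: fin_bigcap_measurable => //; exact: finite_finset.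
by apply/seteqP; split => z Hz l; [move=> _; exact: Hz | exact: Hz].
Qed.

Lemma measurable_Hq : measurable H.
Proof.
apply: measurableI.
  apply: (measurable_forall_ord (F := fun l => [set z | 0 <= tnth z l < 1])) => l.
  by apply: measurable_setT_itv; exact: measurable_tnthR.
rewrite (_ : (fun z => _) = \bigcap_k \bigcup_(i in [set: int])
   [set z | forall l, distZ (tnth z l - i%:~R * tnth (theta th) l) < k.+1%:R^-1]); last first.
  apply/seteqP; split => z Hz.
    move=> k _; have k0 : 0 < k.+1%:R^-1 :> R by rewrite invr_gt0.
    by have [i Hi] := Hz _ k0; exists i.
  move=> e e0; have [k] := ltr_add_invr e0; rewrite add0r => ke.
  have [i _ Hi] := Hz k Logic.I; exists i => l; exact: lt_trans (Hi l) ke.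
apply: bigcapT_measurable => k; apply: countable_bigcupT_measurable => [|i].
  exact: countableP.
apply: (measurable_forall_ord (F := fun l => [set z | distZ _ < _])) => l.
apply: measurable_setT_lt; last exact: measurable_cst.
apply: (measurableT_comp measurable_distZ); apply: measurable_funB; last exact: measurable_cst.
exact: measurable_tnthR.
Qed.

Lemma measurable_Phi : measurable_fun setT (Phi q).
Proof.
apply/measurable_fun_tnthP => k.
pose ol : 'I_L := Ordinal (half_ord_lt k).
rewrite (_ : _ \o _ = fun z => \sum_(j < n) (if (k %/ 2 == j %/ 2)%N
     then rot2 (- (2 * pi * tnth z ol)) (k %% 2)%N (j %% 2)%N else 0) * tnth q j); last first.
  apply/funext => z /=; rewrite tnth_mktuple; apply: eq_bigr => j _; rewrite mxE.
  by have -> : Defs.coord z (k %/ 2) = tnth z ol by rewrite (tnth_nth 0).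
apply: measurable_fun_sumr => j; apply: measurable_funM; last exact: measurable_cst.
case: (_ == _); last exact: measurable_cst.
have ma : measurable_fun setT (fun z => - (2 * pi * tnth z ol) : R).
  apply: measurableT_comp; first exact: oppr_measurable.
  by apply: measurable_funM; [exact: measurable_cst | exact: measurable_tnthR].
have ms : measurable_fun setT (fun z => sin (- (2 * pi * tnth z ol)) : R).
  apply: (measurableT_comp _ ma); apply: continuous_measurable_fun; exact: continuous_sin.
have mc : measurable_fun setT (fun z => cos (- (2 * pi * tnth z ol)) : R).
  apply: (measurableT_comp _ ma); apply: continuous_measurable_fun; exact: continuous_cos.
case: (k %% 2)%N => [|a]; case: (j %% 2)%N => [|b] //=.
by apply: (measurableT_comp _ ms); exact: oppr_measurable.
Qed.

(** Moving the window by one step exchanges one boundary term for another, so the sum changes by at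
    most M; j steps cost M |j|, independently of m. *)
Lemma shift_sum (r : int -> R) (M : R) (m : nat) (j : int) :
  (forall i, 0 <= r i <= M) ->
  `|\sum_(i < m) r (i.+1%:Z + j) - \sum_(i < m) r i.+1%:Z| <= M * `|j|%N%:R.
Proof.
move=> rM; pose Sj (j : int) := \sum_(i < m) r (i.+1%:Z + j).
have step (j' : int) : `|Sj (j' + 1) - Sj j'| <= M.
  suff -> : Sj (j' + 1) - Sj j' = r (m.+1%:Z + j') - r (1%:Z + j').
    have := rM (m.+1%:Z + j'); have := rM (1%:Z + j'); rewrite ler_norml.
    by move=> /andP[? ?] /andP[? ?]; apply/andP; split; lra.
  rewrite /Sj -sumrB.
  rewrite -(telescope_sumr (fun i => r (i.+1%:Z + j')) (leq0n m)) big_mkord.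
  apply: eq_bigr => i _; congr (r _ - _).
  by rewrite [j' + 1]addrC addrA -PoszD addn1.
have -> : \sum_(i < m) r i.+1%:Z = Sj 0 by apply: eq_bigr => i _; rewrite addr0.
rewrite -/(Sj j).
have pos (p : nat) (j0 : int) : `|Sj (j0 + p%:Z) - Sj j0| <= M * p%:R.
  elim: p => [|p IH]; first by rewrite addr0 subrr normr0 mulr0.
  apply: le_trans (ler_distD (Sj (j0 + p%:Z)) _ _) _.
  rewrite -natr1 mulrDr mulr1 addrC; apply: lerD => //.
  by rewrite -addn1 PoszD addrA; exact: step.
case: j => p; first by have := pos p 0; rewrite add0r.
have := pos p.+1 (- p.+1%:Z); rewrite addNr distrC NegzE abszN; exact.
Qed.

(** The density is controlled only near the orbit closure, which [Phi] reaches from H_q; restricting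
    to H_q makes the integrand bounded everywhere and changes nothing up to a null set. *)
Let g := (rho \o Phi q) \_ H.

Let gE z : H z -> g z = rho (Phi q z).
Proof. by move=> Hz; rewrite /g patchE mem_set. Qed.

Let mg : measurable_fun setT g.
Proof.
apply/(measurable_restrictT _ measurable_Hq); apply: measurable_funTS.
exact: measurableT_comp mrho measurable_Phi.
Qed.

Let g_bounds M : (forall y, O y -> 0 <= rho y <= M) -> 0 < M -> forall z, 0 <= g z <= M.
Proof.
move=> HM M0 z; rewrite /g patchE; case: ifPn => [|_]; last by rewrite lexx ltW.
by rewrite inE => Hz; apply: HM; exact: Phi_orbit.
Qed.

Let bg : bmf setT g.
Proof.
split => //; have [M M0 HM] := rho_bounded L1 hq hnear; exists M => z _.
by have /andP[a b] := g_bounds HM M0 z; rewrite ger0_norm.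
Qed.

Lemma mHqC : mH (~` H) = 0%E.
Proof. by rewrite probability_setC ?(hmH.1) ?subee//; exact: measurable_Hq. Qed.

Lemma integral_rho_Phi : (\int[mH]_z (rho (Phi q z))%:E = (Ex mH setT g)%:E)%E.
Proof.
have mr : measurable_fun setT (fun z => (rho (Phi q z))%:E).
  by apply/measurable_EFinP; exact: measurableT_comp mrho measurable_Phi.
rewrite (ge0_negligible_integral _ _ _ _ mHqC)//; last 2 first.
- by apply: measurableC; exact: measurable_Hq.
- by move=> z _; rewrite lee_fin.
rewrite setTD setCK ExE//; last exact: PfinT.
rewrite integral_mkcond; apply: eq_integral => z _.
by rewrite /g !patchE; case: ifP.
Qed.

Lemma Ex_torus_add i : Ex mH setT (fun z => g (torus_add (tshift th i) z)) = Ex mH setT g.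
Proof.
apply: (Ex_invariant (phi := torus_add (tshift th i))) => //.
- exact: PfinT.
- exact: measurable_torus_add.
- by move=> A mA; apply: hmH.2 => //; exact: tshift_Hq.
Qed.

(** [A m] averages g over the translates of z by i theta, and by invariance its Haar integral is
    that of g for every m > 0. As A m z - a m tends to 0 for z in H_q, bounded by 2M, integration
    identifies the limit of the constants a m. *)
Lemma orbit_average :
  (fun m : nat => (\sum_(i < m) rho (uvec th q i.+1%:Z)) / m%:R) @ \oo -->
  fine (\int[mH]_z (rho (Phi q z))%:E)%E.
Proof.
rewrite integral_rho_Phi /=.
have [M M0 HM] := rho_bounded L1 hq hnear.
have gb := g_bounds HM M0.
pose a m := (\sum_(i < m) rho (uvec th q i.+1%:Z)) / m%:R.
pose A m z := (\sum_(i < m) g (torus_add (tshift th i.+1%:Z) z)) / m%:R.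
have avg_le m (r : nat -> R) : (forall i, 0 <= r i <= M) -> 0 <= (\sum_(i < m) r i) / m%:R <= M.
  move=> rM; apply/andP; split.
    by rewrite divr_ge0//; apply: sumr_ge0 => i _; case/andP: (rM i).
  case: m => [|m]; first by rewrite big_ord0 mul0r ltW.
  rewrite ler_pdivrMr// -[m.+1 in leRHS]card_ord mulr_natr -sumr_const.
  by apply: ler_sum => i _; case/andP: (rM i).
have bgi i : bmf setT (fun z => g (torus_add (tshift th i) z)).
  split; first by apply: measurableT_comp; [exact: mg | exact: measurable_torus_add].
  by exists M => z _; have /andP[x y] := gb (torus_add (tshift th i) z); rewrite ger0_norm.
have bA m : bmf setT (A m) by apply: bmfM; [exact: bmf_sum | exact: bmf_cst].
have EA m : (0 < m)%N -> Ex mH setT (A m) = Ex mH setT g.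
  move=> m0; have nz : m%:R != 0 :> R by rewrite pnatr_eq0 -lt0n.
  transitivity (Ex mH setT (fun z => m%:R^-1 * \sum_(i < m) g (torus_add (tshift th i.+1%:Z) z))).
    by apply: Ex_eq => z _; rewrite mulrC.
  rewrite ExZ//; [|exact: PfinT|exact: bmf_sum].
  rewrite Ex_sum//; last exact: PfinT.
  under eq_bigr do rewrite Ex_torus_add.
  by rewrite sumr_const card_ord -(mulr_natl (Ex _ _ _)) mulKf.
have lim0 : (fun m => Ex mH setT (fun z => A m z - a m)) @ \oo --> Ex mH setT (fun=> 0 : R).
  apply: (@Ex_cvg _ _ _ mH setT measurableT (PfinT _) _ _ (2 * M)) => //.
  - move=> m; apply: measurable_funB; last exact: measurable_cst.
    by case: (bA m).
  - move=> m z _; have := avg_le m (fun i => rho (uvec th q i.+1%:Z)).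
    have := avg_le m (fun i => g (torus_add (tshift th i.+1%:Z) z)).
    move=> /(_ (fun i => gb _))/andP[h1 h2] /(_ (fun i => HM _ (orbit_uvec _ _ _)))/andP[h3 h4].
    by rewrite ler_norml /A /a; apply/andP; split; lra.
  - exists (~` H); split.
    + by apply: measurableC; exact: measurable_Hq.
    + exact: mHqC.
    + move=> z /= nz Hz; apply: nz => _.
      apply/cvgrPdist_le => e e0.
      have e20 : 0 < e / 2 by rewrite divr_gt0.
      have [h h0 Hh] := rho_unif L1 hq hnear e20.
      have [d d0 Hd] := Phi_close L1 th hq h0.
      (* Up to d, the point z is j theta. Its orbit then follows that of 0 with delay j, and the
         delay costs at most M |j| in the sum, which is negligible after division by m. *)
      have [j Hj] := Hz.2 d d0.
      near=> m.
      have m0 : (0 < m)%N by near: m; exact: nbhs_infty_gt.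
      have mR : 0 < m%:R :> R by rewrite ltr0n.
      rewrite sub0r normrN /A /a -mulrBl normrM (@gtr0_norm _ m%:R^-1) ?invr_gt0//.
      rewrite ler_pdivrMr//.
      have := @shift_sum (fun i => rho (uvec th q i)) M m j (fun i => HM _ (orbit_uvec _ _ _)).
      set S1 := \sum_(i < m) g _; set S2 := \sum_(i < m) rho (uvec th q (_ + _)).
      set S3 := \sum_(i < m) _ => hS.
      have h12 : `|S1 - S2| <= e / 2 * m%:R.
        rewrite /S1 /S2 -sumrB; apply: le_trans (ler_norm_sum _ _ _) _.
        rewrite (mulr_natr (e / 2)) -[m in _ *+ m]card_ord -sumr_const; apply: ler_sum => i _.
        apply/ltW; rewrite gE; last exact: torus_add_Hq.
        apply: Hh; [exact: orbit_uvec | exact: Phi_sphere | exact: Hd].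
      have mj : M * `|j|%N%:R <= e / 2 * m%:R.
        rewrite mulrC -ler_pdivrMl// mulrC; near: m; exact: nbhs_infty_ger.
      apply: le_trans (ler_distD S2 _ _) _; lra.
  - exact: bmf_cst.
have e0 : Ex mH setT (fun=> 0 : R) = 0 by rewrite Ex_cst ?mul0r.
rewrite e0 in lim0.
have -> : Ex mH setT g = Ex mH setT g - 0 by rewrite subr0.
have : (fun m => Ex mH setT g - Ex mH setT (fun z => A m z - a m)) @ \oo --> Ex mH setT g - 0.
  by apply: cvgB => //; exact: cvg_cst.
apply: cvg_trans; apply: near_eq_cvg; near=> m.
have m0 : (0 < m)%N by near: m; exact: nbhs_infty_gt.
rewrite ExB//; [|exact: PfinT|exact: bmf_cst].
have ca : Ex mH setT (fun=> a m) = a m.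
  rewrite (Ex_cst mH measurableT (a m)).
  by have := prT mH; rewrite /pr => e1; rewrite -[RHS]mulr1 -[in RHS]e1.
by rewrite EA// ca subKr.
Unshelve. all: by end_near.
Qed.

(** The averages inherit the positive lower bound of the density on the orbit closure. This makes
    the intensity unbounded, so that the initial block of cells is eventually occupied with high
    probability. *)
Lemma integral_rho_gt0 : 0 < fine (\int[mH]_z (rho (Phi q z))%:E)%E.
Proof.
have [c c0 Hc] := rho_lower L1 hq hnear.
apply: lt_le_trans c0 _; rewrite -(cvg_lim _ orbit_average)//.
apply: limr_ge; first by apply/cvg_ex; eexists; exact: orbit_average.
near=> m; have m0 : (0 < m)%N by near: m; exact: nbhs_infty_gt.
rewrite ler_pdivlMr ?ltr0n// -[m in m%:R]card_ord mulr_natr -sumr_const.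
by apply: ler_sum => i _; apply: Hc; exact: orbit_uvec.
Unshelve. all: by end_near.
Qed.

End Averages.

(** * Hitting probabilities of an m-dependent sequence *)

Section MDependentEvents.
Context {R : realType} {dT} {T : measurableType dT} (P : probability T R).
Variables (E : nat -> set T) (m : nat) (eta kappa : R).
Hypothesis mE : forall i, measurable (E i).

Definition none s : set T := [set w | forall i, (i < s)%N -> ~ E i w].

Local Notation p i := (pr P (E i)).

Hypothesis none_indep : forall s, (m <= s)%N ->
  pr P (none (s - m) `&` E s) = pr P (none (s - m)) * p s.
Hypothesis pair_le : forall a b, (a < b)%N -> pr P (E a `&` E b) <= eta.
Hypothesis pair_indep : forall a b, (a + m < b)%N -> pr P (E a `&` E b) = p a * p b.
Hypothesis p_le : forall a, p a <= kappa.

Let eta0 : 0 <= eta. Proof. exact: le_trans (pr_ge0 _ _) (pair_le (ltnSn 0)). Qed.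
Let kappa0 : 0 <= kappa. Proof. exact: le_trans (pr_ge0 _ _) (p_le 0). Qed.

Lemma measurable_none s : measurable (none s).
Proof.
rewrite (_ : none s = \bigcap_(i in [set` iota 0 s]) ~` E i).
  by apply: fin_bigcap_measurable => // i _; exact: measurableC.
by apply/seteqP; split => w H i /=; [rewrite mem_iota add0n; exact: H |
  move=> il; apply: H; rewrite /= mem_iota add0n].
Qed.

Lemma noneS s : pr P (none s.+1) = pr P (none s) - pr P (none s `&` E s).
Proof.
rewrite (prD P (measurable_none s) (mE s)) addrAC subrr add0r; congr (pr P _).
apply/seteqP; split => w.
  by move=> H; split => [i il|]; [exact/H/ltnW | exact: H].
by move=> [H Es] i; rewrite ltnS leq_eqVlt => /predU1P[->//|]; exact: H.
Qed.

Let iota_sum_le s' s (F : nat -> R) (c : R) : (s - s' <= m)%N -> (forall i, (i < s)%N -> F i <= c) -> 0 <= c ->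
  \sum_(i <- iota s' (s - s')) F i <= m%:R * c.
Proof.
move=> sm Fc c0; apply: (@le_trans _ _ (\sum_(i <- iota s' (s - s')) c)).
  rewrite big_seq [leRHS]big_seq; apply: ler_sum => i; rewrite mem_iota => /andP[a b].
  apply: Fc; have [ss|ss] := leqP s' s; first by rewrite subnKC in b.
  by move: b; rewrite (eqP (ltnW ss : s - s' == 0)%N) addn0 ltnNge a.
rewrite big_const_seq count_predT size_iota iter_addr_0 -(mulr_natl c).
by rewrite ler_wpM2r// ler_nat.
Qed.

(** Forgetting the last m events before s gives exact independence. The forgotten events cost at
    most m eta jointly with E s, and m kappa times kappa in the product. *)
Lemma none_step s : `|pr P (none s.+1) - pr P (none s) * (1 - p s)| <= m%:R * (eta + kappa ^+ 2).
Proof.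
pose s' := (s - m)%N.
have ss' : (s - s' <= m)%N by rewrite leq_subCl.
(* For s < m the truncated difference is 0 and [none 0] is the whole space, so the factorisation is
   trivial. *)
have h : pr P (none s' `&` E s) = pr P (none s') * p s.
  have [ms|sm] := leqP m s; first exact: none_indep.
  have e0 : s' = 0%N by apply/eqP; rewrite subn_eq0 ltnW.
  rewrite e0 (_ : none 0 = setT) ?setTI ?prT ?mul1r//.
  by apply/seteqP; split.
have mN := measurable_none.
have sub : none s `<=` none s'.
  by move=> w H i il; apply: H; apply: leq_trans il (leq_subr _ _).
have mB : measurable [set w | exists2 i, i \in iota s' (s - s') & E i w].
  exact: (@fin_bigcup_measurable _ _ _ [set` iota s' (s - s')]).
have cov w : none s' w -> ~ none s w -> exists2 i, i \in iota s' (s - s') & E i w.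
  move=> H Hn; apply: contrapT => K; apply: Hn => i il Ei.
  have [si|i_s] := leqP s' i; last exact: (H i).
  by apply: K; exists i => //; rewrite mem_iota si subnKC// leq_subr.
have d1 : 0 <= pr P (none s') - pr P (none s) <= m%:R * kappa.
  rewrite (prD P (mN s') (mN s)) (_ : none s' `&` none s = none s); last first.
    by apply/seteqP; split => [w []|w Hw] //; split => //; exact: sub.
  rewrite addrAC subrr add0r pr_ge0/=.
  apply: le_trans (_ : pr P [set w | exists2 i, i \in iota s' (s - s') & E i w] <= _).
    by apply: pr_le => //; [exact: measurableD | move=> w [a b]; exact: cov].
  by apply: le_trans (pr_bigU _ _ mE) _; exact: iota_sum_le.
have d2 : 0 <= pr P (none s' `&` E s) - pr P (none s `&` E s) <= m%:R * eta.
  have m1 : measurable (none s' `&` E s) by exact: measurableI.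
  have m2 : measurable (none s `&` E s) by exact: measurableI.
  rewrite (prD P m1 m2) (_ : (none s' `&` E s) `&` (none s `&` E s) = none s `&` E s); last first.
    by apply/seteqP; split => [w []|w [Hw Ew]] //; split => //; split => //; exact: sub.
  rewrite addrAC subrr add0r pr_ge0/=.
  have mEs i : measurable (E i `&` E s) by exact: measurableI.
  have mBs : measurable [set w | exists2 i, i \in iota s' (s - s') & (E i `&` E s) w].
    exact: (@fin_bigcup_measurable _ _ _ [set` iota s' (s - s')]).
  apply: le_trans (_ : pr P [set w | exists2 i, i \in iota s' (s - s') & (E i `&` E s) w] <= _).
    apply: pr_le => //; first exact: measurableD.
    move=> w [[a b] c]; have [|i il Ei] := cov w a; last by exists i.
    by move=> nw; apply: c.
  by apply: le_trans (pr_bigU _ _ mEs) _; apply: iota_sum_le => // i; exact: pair_le.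
have p0 : 0 <= p s by exact: pr_ge0.
have pk := p_le s.
rewrite noneS.
have -> : pr P (none s) - pr P (none s `&` E s) - pr P (none s) * (1 - p s) =
   (pr P (none s' `&` E s) - pr P (none s `&` E s)) -
   (pr P (none s') - pr P (none s)) * p s by rewrite h; ring.
move: d1 d2 => /andP[d1 d1'] /andP[d2 d2'].
have d3 : 0 <= (pr P (none s') - pr P (none s)) * p s by rewrite mulr_ge0.
have d4 : (pr P (none s') - pr P (none s)) * p s <= m%:R * kappa * kappa by exact: ler_pM.
have d5 : 0 <= m%:R * eta by rewrite mulr_ge0.
have d6 : 0 <= m%:R * kappa ^+ 2 by rewrite mulr_ge0 ?sqr_ge0.
by rewrite ler_norml; apply/andP; split; lra.
Qed.

Lemma expR_quadratic (x : R) : 0 <= x -> `|1 - x - expR (- x)| <= x ^+ 2.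
Proof.
move=> x0; have := expR_ge1Dx (- x); have := expR_ge1Dx x => h1 h2.
have x1 : 0 < 1 + x by lra.
have h3 : expR (- x) <= (1 + x)^-1.
  by rewrite expRN lef_pV2 ?posrE ?expR_gt0.
have h4 : (1 + x)^-1 <= 1 - x + x ^+ 2.
  rewrite -[leLHS]mul1r ler_pdivrMr//.
  have : 0 <= x ^+ 3 by rewrite exprn_ge0.
  lra.
by rewrite ler_norml; apply/andP; split; lra.
Qed.

(** The errors of the steps add up without amplification, since each is multiplied by later factors
    1 - p_i in [0, 1]; replacing 1 - p by exp (- p) costs kappa^2 per step. *)
Lemma none_approx s :
  `|pr P (none s) - expR (- \sum_(i < s) p i)| <= s%:R * (m%:R * (eta + kappa ^+ 2) + kappa ^+ 2).
Proof.
elim: s => [|s IH].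
  rewrite big_ord0 oppr0 expR0 mul0r (_ : none 0 = setT) ?prT ?subrr ?normr0//.
  by apply/seteqP; split.
rewrite big_ord_recr/= opprD expRD.
set e := expR (- \sum_(i < s) p i) in IH *.
have e0 : 0 <= e by exact: expR_ge0.
have e1 : e <= 1.
  by rewrite -expR0 ler_expR oppr_le0; apply: sumr_ge0 => i _; exact: pr_ge0.
have p0 : 0 <= p s by exact: pr_ge0.
have p1 : p s <= 1 by exact: pr_le1.
have h1 := none_step s.
have h2 : `|(pr P (none s) - e) * (1 - p s)| <= `|pr P (none s) - e|.
  by rewrite normrM ler_piMr// ger0_norm; lra.
have h3 : `|e * (1 - p s - expR (- p s))| <= kappa ^+ 2.
  rewrite normrM (ger0_norm e0); apply: le_trans (_ : p s ^+ 2 <= _).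
    rewrite -[leRHS]mul1r; apply: ler_pM => //; exact: expR_quadratic.
  by rewrite ler_pXn2r ?nnegrE.
have -> : pr P (none s.+1) - e * expR (- p s) =
   (pr P (none s.+1) - pr P (none s) * (1 - p s)) + (pr P (none s) - e) * (1 - p s) +
   e * (1 - p s - expR (- p s)) by ring.
set X := m%:R * (eta + kappa ^+ 2) + kappa ^+ 2 in IH *.
have -> : s.+1%:R * X = s%:R * X + X by rewrite -[s.+1%:R]natr1 mulrDl mul1r.
apply: le_trans (ler_normD _ _) _; apply: le_trans (lerD (ler_normD _ _) (lexx _)) _.
rewrite /X in IH *; lra.
Qed.

(** Pairs at distance more than m factorise and sum to at most the square of the mean; at most m s
    pairs are closer, each of probability at most eta. *)
Lemma pairs_approx s :
  \sum_(c <- pairs s) pr P (E c.1 `&` E c.2) <= (\sum_(i < s) p i) ^+ 2 + s%:R * (m%:R * eta).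
Proof.
rewrite big_filter big_mkcond big_allpairs_dep/=.
rewrite -(big_mkord xpredT (fun i => p i)) /index_iota subn0.
set S := \sum_(i <- iota 0 s) p i.
have -> : s%:R * (m%:R * eta) = \sum_(a <- iota 0 s) m%:R * eta.
  by rewrite big_const_seq count_predT size_iota iter_addr_0 mulr_natl.
rewrite expr2 {1}/S mulr_suml -big_split/=; apply: ler_sum => a _.
rewrite /S mulr_sumr.
apply: (@le_trans _ _ (\sum_(b <- iota 0 s) (p a * p b + (if (a < b <= a + m)%N then eta else 0)))).
  apply: ler_sum => b _; have pp0 : 0 <= p a * p b by rewrite mulr_ge0 ?pr_ge0.
  case: ltnP => ab /=; last by rewrite addr0.
  have [bm|bm] := leqP b (a + m).
    by apply: le_trans (pair_le ab) _; rewrite lerDr.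
  by rewrite pair_indep// addr0.
rewrite big_split/= lerD2l -big_mkcond big_const_seq iter_addr_0 -(mulr_natl eta).
rewrite ler_wpM2r// ler_nat -size_filter -[leqRHS](size_iota a.+1 m).
apply: uniq_leq_size; first by rewrite filter_uniq ?iota_uniq.
by move=> b; rewrite mem_filter !mem_iota addSn ltnS => /andP[].
Qed.

End MDependentEvents.

(* The integral of a nonnegative function is a supremum over simple functions, so it is
   monotone even without measurability. *)
Lemma ge0_integral_mono {d} {X : measurableType d} {R : realType}
  (mu : {measure set X -> \bar R}) (D : set X) (f g : X -> \bar R) :
  (forall x, D x -> (0 <= f x)%E) -> (forall x, D x -> (f x <= g x)%E) ->
  (\int[mu]_(x in D) f x <= \int[mu]_(x in D) g x)%E.
Proof.
move=> f0 fg; have g0 x : D x -> (0 <= g x)%E by move=> Dx; exact: le_trans (f0 x Dx) (fg x Dx).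
rewrite !ge0_integralE//; apply: ereal_sup_le => _ /= [h hf <-].
exists h => // x; apply: le_trans (hf x) _.
rewrite !patchE; case: ifPn => // xD; apply: fg; exact: set_mem.
Qed.

(** * Probabilities that the sequence hits small caps *)

Section HittingProbabilities.
Context {R : realType}.
Variable L : nat.
Hypothesis L1 : (1 <= L)%N.
Local Notation n := (2 * L)%N.
Variable th : L.-tuple R.
Variable q : @vec R n.
Hypothesis hq : sphere q.
Variable sigma : {measure set (@vec R n) -> \bar R}.
Hypothesis hs : is_surface_measure sigma.
Context {dT : measure_display} {T : measurableType dT} (P : probability T R).
Variable x : int -> T -> @vec R n.
Hypothesis hxm : forall i, measurable_fun setT (x i).
Hypothesis hxS : forall i w, sphere (x i w).
Hypothesis hstat : stationary P x.
Variable rho : @vec R n -> R.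
Hypothesis hrho : is_density P sigma (x 0) rho.
Hypothesis hnear : cont_pos_near (orbit_closure th q) rho.

Local Notation S := (@sphere R n).
Local Notation O := (orbit_closure th q).
Local Notation u := (uvec th q).
Local Notation p := (L%:R - 1 / 2).
Local Notation capm := (capm L1 sigma).

Definition hits i (t : R) : set T := x i @^-1` cap (u i) t.

Let mS : measurable S. Proof. exact: measurable_sphere. Qed.

Lemma measurable_preim i A : measurable A -> measurable (x i @^-1` A).
Proof. by move=> mA; rewrite -[X in measurable X]setTI; exact: hxm. Qed.

Lemma measurable_hits i t : measurable (hits i t).
Proof. apply: measurable_preim; exact: measurable_cap. Qed.

Lemma law_x i A : measurable A -> P (x i @^-1` A) = P (x 0 @^-1` A).
Proof.
move=> mA; have := @hstat i 1 (fun=> 0) (fun=> A) (fun=> mA).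
have e (j : int) : [set w | forall _ : 'I_1, A (x j w)] = x j @^-1` A.
  by apply/seteqP; split => w; [move=> /(_ ord0) | move=> H _].
by rewrite add0r !e.
Qed.

Lemma law_x2 i l A B : measurable A -> measurable B ->
  P (x i @^-1` A `&` x (i + l) @^-1` B) = P (x 0 @^-1` A `&` x l @^-1` B).
Proof.
move=> mA mB.
pose idx (j : 'I_2) : int := if val j == 0%N then 0 else l.
pose C (j : 'I_2) := if val j == 0%N then A else B.
have mC j : measurable (C j) by rewrite /C; case: ifP.
have := @hstat i 2 idx C mC.
have e (a : int) : [set w | forall j : 'I_2, C j (x (idx j + a) w)] =
    x a @^-1` A `&` x (l + a) @^-1` B.
  apply/seteqP; split => w /= H.
    have := H ord0; have := H ord_max; rewrite /C /idx /= add0r => hb ha; by split.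
  move=> [[|[|//]] jl]; rewrite /C /idx /= ?add0r; by case: H.
have e0 : [set w | forall j : 'I_2, C j (x (idx j) w)] = x 0 @^-1` A `&` x l @^-1` B.
  by rewrite -[l in RHS]addr0 -e; apply/seteqP; split => w /= H j; have := H j; rewrite addr0.
by rewrite e e0 [l + i]addrC.
Qed.

Let capS i t : set (@vec R n) := cap (u i) t `&` S.

Let mcapS i t : measurable (capS i t).
Proof. by apply: measurableI => //; exact: measurable_cap. Qed.

Let sigma_capS i t : sigma (capS i t) = (capm t)%:E.
Proof.
rewrite sigma_setI_sphere//; last exact: measurable_cap.
by apply: sigma_cap => //; exact: uvec_sphere.
Qed.

Let preim_capS i j t : x i @^-1` cap (u j) t = x i @^-1` capS j t.
Proof. by apply/seteqP; split => w /=; [move=> H; split => // | case]. Qed.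

Lemma vdotC (y z : @vec R n) : vdot y z = vdot z y.
Proof. by apply: eq_bigr => i _; rewrite mulrC. Qed.

Lemma cap_vdist i t h y : 0 < h -> t <= h ^+ 2 / 2 -> cap (u i) t y -> S y -> vdist y (u i) < h.
Proof.
move=> h0 th2 yc Sy; rewrite vdist_sphere//; last exact: uvec_sphere.
rewrite -[ltRHS](ger0_norm (ltW h0)) -sqrtr_sqr ltr_sqrt ?exprn_gt0// vdotC.
move: yc; rewrite /cap /=; lra.
Qed.

(** On a small cap around u_i the density is within e of its value at u_i, uniformly in i. Since |y
    - u|^2 = 2 (1 - <u, y>) on the sphere, height at most h^2 / 2 puts the cap within distance h. *)
Lemma hits_prob (e : R) : 0 < e -> exists2 t0 : R, 0 < t0 & forall i (t : R), t <= t0 ->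
  `|pr P (hits i t) - rho (u i) * capm t| <= e * capm t.
Proof.
move=> e0; have [h h0 Hh] := rho_unif L1 hq hnear e0.
exists (h ^+ 2 / 2); first by rewrite divr_gt0 ?exprn_gt0.
move=> i t th2; have [mr [r0 Pr]] := hrho.
have near y : capS i t y -> rho (u i) - e <= rho y <= rho (u i) + e.
  move=> [yc Sy]; have := Hh (u i) y (orbit_uvec _ _ _) Sy (cap_vdist h0 th2 yc Sy).
  by rewrite ltr_norml => /andP[a b]; apply/andP; split; lra.
have sc : (sigma (capS i t) < +oo)%E by rewrite sigma_capS ltry.
have pE : pr P (hits i t) = Ex sigma (capS i t) rho.
  rewrite /pr /hits preim_capS (law_x _ (mcapS i t)) Pr; last exact: mcapS.
  by [].
have br : bmf (capS i t) rho.
  split; first exact: measurable_funTS.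
  exists (rho (u i) + e) => y /near/andP[_]; by rewrite ger0_norm.
have cE (c : R) : Ex sigma (capS i t) (fun=> c) = c * capm t.
  by rewrite Ex_cst ?sigma_capS//; exact: mcapS.
have mC := mcapS i t.
have h1 : (rho (u i) - e) * capm t <= pr P (hits i t).
  by rewrite pE -cE; apply: Ex_le => //; [exact: bmf_cst | move=> y /near/andP[]].
have h2 : pr P (hits i t) <= (rho (u i) + e) * capm t.
  by rewrite pE -cE; apply: Ex_le => //; [exact: bmf_cst | move=> y /near/andP[]].
by rewrite ler_norml; apply/andP; split; lra.
Qed.

(** The bound is extended to all t >= 0, as the tail estimate needs: beyond t0 a probability is at
    most 1 <= (t / t0)^p. *)
Lemma hits_le : exists2 K : R, 0 < K & forall i (t : R), 0 <= t -> pr P (hits i t) <= K * t `^ p.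
Proof.
have [t0 t00 H] := hits_prob ltr01.
have [M M0 HM] := rho_bounded L1 hq hnear.
have [K K0 HK] := capm_le L1 hs.
have p0 := @p_gt0 R L L1.
have T0 : 0 < t0 `^ p by rewrite powR_gt0.
exists ((M + 1) * K + (t0 `^ p)^-1).
  by apply: ltr_pwDl; [rewrite mulr_gt0// ltr_wpDl// ltW | rewrite invr_ge0 ltW].
move=> i t tge; have Tp : 0 <= t `^ p by exact: powR_ge0.
have [tt|tt] := leP t t0.
  have := H i t tt; rewrite ler_norml => /andP[_ h].
  have c0 := capm_ge0 L1 sigma t; have kt := HK t tge.
  have /andP[r0 rM] := HM _ (orbit_uvec th q i).
  have h1 : rho (u i) * capm t <= M * capm t by exact: ler_wpM2r.
  have h2 : (M + 1) * capm t <= (M + 1) * (K * t `^ p) by apply: ler_wpM2l => //; lra.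
  have h3 : 0 <= (t0 `^ p)^-1 * t `^ p by rewrite mulr_ge0// invr_ge0 ltW.
  lra.
have h1 : 1 <= (t0 `^ p)^-1 * t `^ p.
  by rewrite ler_pdivlMl// mulr1; apply: ge0_ler_powR; rewrite ?nnegrE; lra.
have h2 : 0 <= (M + 1) * K * t `^ p by rewrite !mulr_ge0//; lra.
have := pr_le1 P (measurable_hits i t); lra.
Qed.

Section PairHits.
Variables (l : int) (f : @vec R n -> @vec R n -> R).
Hypothesis hf : is_joint_density P sigma (x 0) (x l) f.
Hypothesis fbnd : bounded_on_nbhd O f.

(** Small caps around u_i and u_(i+l) lie in the neighbourhood where the joint density is bounded,
    so the probability is at most M times the product of the two cap measures. *)
Lemma pair_hits_le : exists M t0 : R, [/\ 0 <= M, 0 < t0 & forall i (t : R), t <= t0 ->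
  pr P (hits i t `&` hits (i + l) t) <= M * capm t ^+ 2].
Proof.
have [dl dl0 [M HM]] := fbnd; have [mf [f0 Pf]] := hf.
exists (Num.max M 0), (dl ^+ 2 / 2); split.
- by rewrite le_max lexx orbT.
- by rewrite divr_gt0 ?exprn_gt0.
move=> i t tt; set M' := Num.max M 0.
have M'0 : 0 <= M' by rewrite le_max lexx orbT.
have nb j y : capS j t y -> (nbhd_set O dl `&` S) y.
  move=> [yc Sy]; split => //; exists (u j); first exact: orbit_uvec.
  exact: cap_vdist dl0 tt yc Sy.
rewrite -lee_fin /hits !preim_capS prE; last by apply: measurableI; apply: measurable_preim; exact: mcapS.
rewrite law_x2; [|exact: mcapS|exact: mcapS].
rewrite Pf; [|exact: mcapS|exact: mcapS].
have inner y : capS i t y -> (\int[sigma]_(z in capS (i + l) t) (f y z)%:E <= (M' * capm t)%:E)%E.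
  move=> yc; rewrite EFinM -(sigma_capS (i + l) t) -integral_cst; last exact: mcapS.
  apply: ge0_integral_mono => z zc; first by rewrite lee_fin.
  by rewrite lee_fin le_max; apply/orP; left; apply: HM; [exact: (nb i) | exact: (nb (i + l))].
have := @ge0_integral_mono _ _ _ sigma (capS i t)
  (fun y => \int[sigma]_(z in capS (i + l) t) (f y z)%:E)%E (cst (M' * capm t)%:E).
move=> /(_ _ inner) H.
apply: le_trans (H _) _; first by move=> y _; apply: integral_ge0 => z _; rewrite lee_fin.
rewrite integral_cst; last exact: mcapS.
by rewrite sigma_capS -EFinM lee_fin expr2 mulrA.
Qed.

End PairHits.

Variable mdep : nat.
Hypothesis hmdep : m_dependent P mdep x.
Hypothesis hjoint : forall l : nat, (1 <= l <= mdep)%N ->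
     exists2 f, is_joint_density P sigma (x 0) (x l%:Z) f & bounded_on_nbhd O f.

Lemma far_indep i j A B : measurable A -> measurable B -> i + mdep%:Z + 1 <= j ->
  pr P (x i @^-1` A `&` x j @^-1` B) = pr P (x i @^-1` A) * pr P (x j @^-1` B).
Proof.
move=> mA mB ij.
have := @hmdep i 1 1 (fun=> i) (fun=> A) (fun=> j) (fun=> B).
have e (a : int) C : [set w | forall _ : 'I_1, C (x a w)] = x a @^-1` C.
  by apply/seteqP; split => w; [move=> /(_ ord0) | move=> H _].
rewrite !e => /(_ (fun=> lexx _) (fun=> ij) (fun=> mA) (fun=> mB)) H.
by rewrite /pr H fineM// fin_num_measure//; exact: measurable_preim.
Qed.

(** Lags up to mdep are handled by the joint densities, larger lags by independence; both give the
    square of the one-point order t^p. *)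
Lemma pair_hits : exists K2 t0 : R, [/\ 0 <= K2, 0 < t0 & forall (i : int) (l : nat) (t : R),
  (0 < l)%N -> 0 <= t -> t <= t0 ->
  pr P (hits i t `&` hits (i + l%:Z) t) <= K2 * (t `^ p) ^+ 2].
Proof.
have [K K0 HK] := capm_le L1 hs.
have [K1 K10 HK1] := hits_le.
(* Each lag has its own constant and threshold. The induction merges them one lag at a time, by a
   maximum and a minimum, starting from the independent lags alone. *)
suff : forall m : nat, (m <= mdep)%N -> exists K2 t0 : R, [/\ 0 <= K2, 0 < t0 &
    forall (i : int) (l : nat) (t : R), (0 < l)%N -> (l <= m)%N || (mdep < l)%N -> 0 <= t -> t <= t0 ->
    pr P (hits i t `&` hits (i + l%:Z) t) <= K2 * (t `^ p) ^+ 2].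
  move=> /(_ _ (leqnn _))[K2 [t0 [a b H]]]; exists K2, t0; split => // i l t l0; apply: H => //.
  by rewrite leqNgt orNb.
elim=> [_|m IH mm].
  exists (K1 ^+ 2), 1; split; rewrite ?sqr_ge0// => i l t l0 h t0 _.
  have {}h : (mdep < l)%N by case/orP: h => //; rewrite leqn0 => /eqP e; rewrite e in l0.
  rewrite /hits far_indep; [|exact: measurable_cap|exact: measurable_cap|]; last first.
    by rewrite -addrA lerD2l -PoszD lez_nat addn1.
  rewrite -exprMn expr2; apply: ler_pM; rewrite ?pr_ge0//; exact: HK1.
have [K2 [t0 [K20 t00 H]]] := IH (ltnW mm).
have [f hf fb] := hjoint (l := m.+1) mm.
have [M [t1 [M0 t10 HM]]] := pair_hits_le hf fb.
exists (Num.max K2 (M * K ^+ 2)), (Num.min t0 t1); split.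
- by rewrite le_max K20.
- by rewrite lt_min t00.
move=> i l t l0 h tge; rewrite le_min => /andP[tt0 tt1].
have s0 : 0 <= (t `^ p) ^+ 2 by exact: sqr_ge0.
have [e|lm] := eqVneq l m.+1.
  rewrite e; apply: le_trans (HM i t tt1) _.
  apply: (@le_trans _ _ (M * K ^+ 2 * (t `^ p) ^+ 2)); last by rewrite ler_wpM2r// le_max lexx orbT.
  rewrite -mulrA; apply: ler_wpM2l => //; rewrite -exprMn ler_pXn2r ?nnegrE ?capm_ge0//.
    exact: HK.
  by rewrite mulr_ge0 ?powR_ge0// ltW.
apply: (@le_trans _ _ (K2 * (t `^ p) ^+ 2)); last by rewrite ler_wpM2r// le_max lexx.
apply: H => //; case/orP: h => [|->]; last by rewrite orbT.
by rewrite leq_eqVlt (negbTE lm) /= ltnS => ->.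
Qed.

End HittingProbabilities.

Section PowerContinuity.
Context {R : realType}.
Variable p : R.
Hypothesis p0 : 0 < p.

Lemma powR_continuous_pos (a : R) : 0 < a -> z `^ p @[z --> a] --> a `^ p.
Proof.
move=> a0; have ai : a \in `]0, +oo[ by rewrite in_itv/= a0.
by have /derivable1_diffP/differentiable_continuous := @derivable_powR R 1 p a ai.
Qed.

Lemma powR_root_lt (e z : R) : 0 < e -> 0 <= z -> z < e `^ p^-1 -> z `^ p < e.
Proof.
move=> e0 z0 ze; apply: (@lt_le_trans _ _ ((e `^ p^-1) `^ p)).
  by apply: gt0_ltr_powR; rewrite ?nnegrE ?powR_ge0.
by rewrite -powRrM mulVf ?gt_eqF// powRr1// ltW.
Qed.

Lemma powR_near (a e : R) : 0 <= a -> 0 < e -> exists2 h : R, 0 < h &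
  forall z : R, 0 <= z -> `|z - a| < h -> `|z `^ p - a `^ p| < e.
Proof.
rewrite le_eqVlt => /predU1P[<-|a0] e0.
  exists (e `^ p^-1); first by rewrite powR_gt0.
  move=> z z0; rewrite subr0 ger0_norm// => ze.
  by rewrite powR0 ?gt_eqF// subr0 ger0_norm ?powR_ge0//; exact: powR_root_lt.
have /cvgrPdist_lt/(_ _ e0)/nbhs_ballP[h /= h0 H] := powR_continuous_pos a0.
exists h => // z z0 za; rewrite distrC; apply: H; by rewrite /ball/= distrC.
Qed.

Lemma powR_unif (K : nat) (e : R) : 0 < e -> exists2 h : R, 0 < h &
  forall a b : R, 0 <= a -> a <= b -> b <= K%:R -> b - a <= h -> b `^ p - a `^ p <= e.
Proof.
move=> e0; pose A : set R := `[0, K%:R]%classic.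
have [] := @compact_unif R R A A (fun z => z `^ p) (@segment_compact _ _ _) _ _ e e0.
- by [].
- move=> a; rewrite /A /= in_itv/= => /andP[a0 _] r r0.
  have [h h0 H] := powR_near a0 r0; exists h => // z; rewrite in_itv/= => /andP[z0 _].
  exact: H.
move=> h h0 H; exists (h / 2); first by rewrite divr_gt0.
move=> a b a0 ab bK bah; have ba : `|b - a| < h by rewrite ger0_norm ?subr_ge0//; lra.
apply/ltW/(le_lt_trans (ler_norm _)); apply: H => //; rewrite /A /= in_itv/=.
  by rewrite a0 (le_trans ab).
by rewrite (le_trans a0).
Qed.

End PowerContinuity.

(** * Scaling, and the limiting mean number of hits *)

Section ScaledHits.
Context {R : realType}.
Variable L : nat.
Hypothesis L1 : (1 <= L)%N.
Local Notation n := (2 * L)%N.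
Variable th : L.-tuple R.
Variable q : @vec R n.
Hypothesis hq : sphere q.
Variable sigma : {measure set (@vec R n) -> \bar R}.
Hypothesis hs : is_surface_measure sigma.
Variable mH : probability (@vec R L) R.
Hypothesis hmH : is_Haar_Hq th mH.
Context {dT : measure_display} {T : measurableType dT} (P : probability T R).
Variable x : int -> T -> @vec R n.
Hypothesis hxm : forall i, measurable_fun setT (x i).
Hypothesis hxS : forall i w, sphere (x i w).
Hypothesis hstat : stationary P x.
Variable rho : @vec R n -> R.
Hypothesis hrho : is_density P sigma (x 0) rho.
Hypothesis hnear : cont_pos_near (orbit_closure th q) rho.
Variables (beta : nat -> R) (gamma : R).
Hypothesis hgamma : 0 < gamma.
Hypothesis hbeta : (fun m : nat => beta m * m%:R `^ (- @alphaL R L)) @ \oo --> gamma.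

Local Notation u := (uvec th q).
Local Notation p := (L%:R - 1 / 2).
Local Notation capm := (capm L1 sigma).
Local Notation hits := (hits th q x).
Local Notation capC := (@capC R L).

Definition Fcap (t : R) : R := Cbar q mH rho * (t / gamma) `^ p.

Let r m : R := beta m * m%:R `^ (- @alphaL R L).
Let p0 : 0 < p :> R. Proof. exact: p_gt0. Qed.

Lemma alphaL_inv : (alphaL L)^-1 = p :> R.
Proof.
by rewrite /alphaL invf_div natrM; field.
Qed.

Let alpha_p : @alphaL R L * p = 1.
Proof.
rewrite -alphaL_inv mulfV// -invr_eq0 alphaL_inv gt_eqF//.
Qed.

Lemma r_bounds : \forall m \near \oo, [/\ (0 < m)%N, gamma / 2 <= r m & 0 < beta m].
Proof.
have g2 : gamma / 2 < gamma by rewrite ltr_pdivrMr// ltr_pMr// ltr1n.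
have H := cvgr_ge _ hbeta _ g2.
near=> m.
have m0 : (0 < m)%N by near: m; exact: nbhs_infty_gt.
have rm : gamma / 2 <= r m.
  by near: m; exact: H.
split => //; have mp : 0 < m%:R `^ (- @alphaL R L) by rewrite powR_gt0 ?ltr0n.
by rewrite -(pmulr_lgt0 _ mp); apply: lt_le_trans rm; rewrite divr_gt0.
Unshelve. all: by end_near.
Qed.

(** This is where alpha enters: alpha p = 1 turns the factor m into (m^alpha)^p, and only the ratio
    r m, which tends to gamma, is left. *)
Lemma scale_pow m (s : R) : (0 < m)%N -> 0 < beta m -> 0 <= s ->
  m%:R * (s / beta m) `^ p = (s / r m) `^ p.
Proof.
move=> m0 b0 s0; have mR : 0 < m%:R :> R by rewrite ltr0n.
have e : s / r m = s / beta m * m%:R `^ (@alphaL R L).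
  by rewrite /r invfM powRN invrK mulrA.
have sb : 0 <= s / beta m by rewrite divr_ge0// ltW.
rewrite e [in RHS]powRM ?powR_ge0//.
by rewrite -powRrM alpha_p powRr1 1?mulrC// ltW.
Qed.

Lemma scale_pow_le m (s : R) : (0 < m)%N -> gamma / 2 <= r m -> 0 < beta m -> 0 <= s ->
  m%:R * (s / beta m) `^ p <= (2 / gamma) `^ p * s `^ p.
Proof.
move=> m0 rm b0 s0; rewrite scale_pow// -powRM//; last by rewrite divr_ge0// ltW.
have g2 : 0 < gamma / 2 by rewrite divr_gt0.
have r0 : 0 < r m by exact: lt_le_trans rm.
apply: ge0_ler_powR; rewrite ?nnegrE ?(ltW p0)//.
- by rewrite divr_ge0// ltW.
- by rewrite mulr_ge0// divr_ge0// ltW.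
rewrite mulrC; apply: ler_wpM2r => //.
by rewrite -invf_div lef_pV2.
Qed.

(** If s / beta m exceeded t0, then m t0^p would be less than m (s / beta m)^p, which is bounded; so
    this fails once m is large. *)
Lemma scale_small (s t0 : R) : 0 <= s -> 0 < t0 -> \forall m \near \oo, s / beta m <= t0.
Proof.
move=> s0 t00; have T0 : 0 < t0 `^ p by rewrite powR_gt0.
set c := (2 / gamma) `^ p * s `^ p.
near=> m.
have [m0 rm b0] : [/\ (0 < m)%N, gamma / 2 <= r m & 0 < beta m] by near: m; exact: r_bounds.
rewrite leNgt; apply/negP => h.
have h1 : t0 `^ p < (s / beta m) `^ p.
  by apply: gt0_ltr_powR; rewrite ?nnegrE ?divr_ge0// ltW.
have := scale_pow_le m0 rm b0 s0; rewrite -/c leNgt => /negP; apply.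
have mc : c / t0 `^ p <= m%:R by near: m; exact: nbhs_infty_ger.
rewrite ler_pdivrMr// in mc; apply: le_lt_trans mc _.
by rewrite ltr_pM2l// ltr0n.
Unshelve. all: by end_near.
Qed.

Lemma scale_cvg (s : R) : 0 < s ->
  (fun m => m%:R * (s / beta m) `^ p) @ \oo --> (s / gamma) `^ p.
Proof.
move=> s0; apply: (@cvg_trans _ ((fun m => (s / r m) `^ p) @ \oo)).
  apply: near_eq_cvg; near=> m.
  have [m0 rm b0] : [/\ (0 < m)%N, gamma / 2 <= r m & 0 < beta m] by near: m; exact: r_bounds.
  by rewrite scale_pow// ltW.
apply: (@cvg_comp _ _ _ (fun m => s / r m) (fun z => z `^ p)); last first.
  by apply: powR_continuous_pos; rewrite divr_gt0.
apply: cvgM; first exact: cvg_cst.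
by apply: cvgV; [rewrite gt_eqF | exact: hbeta].
Unshelve. all: by end_near.
Qed.

Let mrho : measurable_fun setT rho. Proof. by case: hrho. Qed.
Let rho0 y : 0 <= rho y. Proof. by case: hrho => _ []. Qed.

Lemma CbarE : Cbar q mH rho = capC * fine (\int[mH]_z (rho (Phi q z))%:E)%E.
Proof. by rewrite /Cbar /capC /capK alphaL_inv !mulrA. Qed.

Lemma Cbar_gt0 : 0 < Cbar q mH rho.
Proof. rewrite CbarE; exact: mulr_gt0 (capC_gt0 L1) (integral_rho_gt0 L1 hq hnear mrho rho0 hmH). Qed.

Lemma Fcap0 : Fcap 0 = 0.
Proof. by rewrite /Fcap mul0r powR0 ?mulr0// gt_eqF. Qed.

(** Each hitting probability is rho (u_i) times capC tau^p, up to an error o(tau^p) uniform in i.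
    The sum is therefore the orbit average of rho times capC times m tau^p, and the last two factors
    converge by the scaling. *)
Lemma sum_hits_cvg (s : R) : 0 <= s ->
  (fun m => \sum_(i < m) pr P (hits i.+1%:Z (s / beta m))) @ \oo --> Fcap s.
Proof.
rewrite le_eqVlt => /predU1P[<-|s0].
  rewrite Fcap0; have [K K0 HK] := hits_le L1 hq hs hxm hxS hstat hrho hnear.
  apply: cvg_near_cst; apply: nearW => m; apply: big1 => i _.
  apply/eqP; rewrite mul0r eq_le pr_ge0 andbT.
  by apply: le_trans (HK i.+1%:Z 0 (lexx _)) _; rewrite powR0 ?mulr0// gt_eqF.
have [M M0 HM] := rho_bounded L1 hq hnear.
have [K K0 HK] := capm_le L1 hs.
pose tau m := s / beta m.
pose a m := (\sum_(i < m) rho (u i.+1%:Z)) / m%:R.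
pose mn m := a m * (capC * (m%:R * tau m `^ p)).
have mnc : mn @ \oo --> Fcap s.
  rewrite /Fcap CbarE mulrAC [_ * fine _]mulrC.
  have ca := orbit_average L1 hq hnear mrho rho0 hmH.
  exact: cvgM ca (cvgM (cvg_cst capC) (scale_cvg s0)).
set Sm := fun m : nat => _.
suff d0 : (fun m => Sm m - mn m) @ \oo --> (0 : R).
  have e m : Sm m - mn m + mn m = Sm m by rewrite subrK.
  by rewrite -(funext e) -[Fcap s]add0r; exact: cvgD d0 mnc.
have [B B0 BE] : exists2 B, 0 < B & B = (2 / gamma) `^ p * s `^ p.
  by eexists; last reflexivity; rewrite mulr_gt0 ?powR_gt0// divr_gt0.
have C0 := @capC_gt0 R L L1.
apply/cvgrPdist_le => e e0.
(* B bounds m tau^p. The variation of rho over a cap and the error of the cap asymptotics, the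
   latter controlled through t1 below, receive e / 2 each. *)
pose e1 := e / (2 * B * K).
have e10 : 0 < e1 by rewrite divr_gt0// !mulr_gt0.
have [t0 t00 H] := hits_prob L1 hq hs hxS hstat hrho hnear e10.
have [D D0 DE] : exists2 D : R, 0 < D & D = capC * (L%:R + 2).
  by eexists; last reflexivity; apply: mulr_gt0 => //; apply: ltr_wpDl.
pose t1 := e / (2 * B * M * D).
have t10 : 0 < t1 by rewrite divr_gt0// !mulr_gt0.
have half : 0 < 1 / 2 :> R by rewrite divr_gt0.
near=> m.
have [m0 rm b0] : [/\ (0 < m)%N, gamma / 2 <= r m & 0 < beta m] by near: m; exact: r_bounds.
have ta : tau m <= t0 by near: m; apply: scale_small => //; exact: ltW.
have tb : tau m <= t1 by near: m; apply: scale_small => //; exact: ltW.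
have tc : tau m <= 1 / 2 by near: m; apply: scale_small => //; exact: ltW.
have tpos : 0 < tau m by rewrite divr_gt0.
have Tp : 0 < tau m `^ p by rewrite powR_gt0.
have nT : m%:R * tau m `^ p <= B by rewrite BE; apply: scale_pow_le => //; exact: ltW.
have mR : 0 < m%:R :> R by rewrite ltr0n.
have term (i : int) : `|pr P (hits i (tau m)) - rho (u i) * (capC * tau m `^ p)| <=
    (e1 * K + M * D * tau m) * tau m `^ p.
  have h1 := H i (tau m) ta; have h2 := capm_equiv L1 hs tpos tc.
  have /andP[r0 rM] := HM _ (orbit_uvec th q i).
  have -> : pr P (hits i (tau m)) - rho (u i) * (capC * tau m `^ p) =
     (pr P (hits i (tau m)) - rho (u i) * capm (tau m)) +
     rho (u i) * (capm (tau m) - capC * tau m `^ p) by ring.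
  apply: le_trans (ler_normD _ _) _; rewrite mulrDl; apply: lerD.
    apply: le_trans h1 _; rewrite -mulrA; apply: ler_wpM2l; first exact: ltW.
    by apply: HK; exact: ltW.
  have -> : M * D * tau m * tau m `^ p = M * (D * tau m * tau m `^ p) by ring.
  by rewrite normrM (ger0_norm r0) DE; apply: ler_pM.
rewrite sub0r normrN.
have -> : mn m = \sum_(i < m) rho (u i.+1%:Z) * (capC * tau m `^ p).
  by rewrite /mn /a -mulr_suml; field; rewrite gt_eqF.
rewrite /Sm -sumrB; apply: le_trans (ler_norm_sum _ _ _) _.
apply: (@le_trans _ _ (\sum_(i < m) ((e1 * K + M * D * tau m) * tau m `^ p))).
  by apply: ler_sum => i _; exact: term.
rewrite sumr_const card_ord -(mulr_natl (_ * tau m `^ p)) mulrCA.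
have E0 : 0 <= e1 * K + M * D * tau m.
  apply: addr_ge0; first exact: mulr_ge0 (ltW e10) (ltW K0).
  exact: mulr_ge0 (mulr_ge0 (ltW M0) (ltW D0)) (ltW tpos).
apply: le_trans (ler_wpM2l E0 nT) _.
have k1 : e1 * K * B = e / 2 by rewrite /e1; field; rewrite !gt_eqF.
have k2 : M * D * tau m * B <= e / 2.
  have -> : e / 2 = M * D * t1 * B by rewrite /t1; field; rewrite !gt_eqF.
  by apply: ler_wpM2r; [exact: ltW | apply: ler_wpM2l => //; exact: mulr_ge0 (ltW M0) (ltW D0)].
by rewrite mulrDl k1; lra.
Unshelve. all: by end_near.
Qed.

End ScaledHits.

Lemma vdot_le1 {R : realType} n (y z : @vec R n) : sphere y -> sphere z -> vdot y z <= 1.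
Proof.
move=> sy sz.
have : 0 <= \sum_(j < n) (tnth y j - tnth z j) ^+ 2 by apply: sumr_ge0 => j _; exact: sqr_ge0.
rewrite (eq_bigr (fun j => tnth y j ^+ 2 + tnth z j ^+ 2 - 2 * (tnth y j * tnth z j))); last first.
  by move=> j _; ring.
rewrite sumrB big_split/= (sphere_sum sy) (sphere_sum sz) -mulr_sumr -/(vdot y z); lra.
Qed.

(** * The array of scaled points *)

Section PointArray.
Context {R : realType}.
Variable L : nat.
Hypothesis L1 : (1 <= L)%N.
Local Notation n := (2 * L)%N.
Variable th : L.-tuple R.
Variable q : @vec R n.
Hypothesis hq : sphere q.
Variable sigma : {measure set (@vec R n) -> \bar R}.
Hypothesis hs : is_surface_measure sigma.
Variable mH : probability (@vec R L) R.
Hypothesis hmH : is_Haar_Hq th mH.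
Context {dT : measure_display} {T : measurableType dT} (P : probability T R).
Variable x : int -> T -> @vec R n.
Hypothesis hxm : forall i, measurable_fun setT (x i).
Hypothesis hxS : forall i w, sphere (x i w).
Hypothesis hstat : stationary P x.
Variable rho : @vec R n -> R.
Hypothesis hrho : is_density P sigma (x 0) rho.
Hypothesis hnear : cont_pos_near (orbit_closure th q) rho.
Variable mdep : nat.
Hypothesis hmdep : m_dependent P mdep x.
Hypothesis hjoint : forall l : nat, (1 <= l <= mdep)%N ->
     exists2 f, is_joint_density P sigma (x 0) (x l%:Z) f &
                bounded_on_nbhd (orbit_closure th q) f.
Variables (beta : nat -> R) (gamma : R).
Hypothesis hgamma : 0 < gamma.
Hypothesis hbeta : (fun m : nat => beta m * m%:R `^ (- @alphaL R L)) @ \oo --> gamma.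

Local Notation u := (uvec th q).
Local Notation p := (L%:R - 1 / 2).
Local Notation hits := (hits th q x).
Local Notation F := (Fcap q mH rho gamma).
Let r m : R := beta m * m%:R `^ (- @alphaL R L).
Let p0 : 0 < p :> R. Proof. exact: p_gt0. Qed.

(** Arrays are indexed from 0 and the weights from 1, hence the successors. *)
Definition scaled m i w : R := beta m * Uvar th q (x i.+1%:Z w) i.+1%:Z.

Lemma measurable_scaled m i : measurable_fun setT (scaled m i).
Proof.
apply: measurable_funM; first exact: measurable_cst.
apply: measurable_funB; first exact: measurable_cst.
exact: measurableT_comp (measurable_vdot _) (hxm _).
Qed.

Lemma scaled_lt m i (s : R) : 0 < beta m -> [set w | scaled m i w < s] = hits i.+1%:Z (s / beta m).
Proof.
move=> b0; apply/seteqP; split => w; rewrite /hits /cap /scaled /= ltr_pdivlMr// mulrC //.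
Qed.

Lemma scaled_ge0 m i w : 0 < beta m -> 0 <= scaled m i w.
Proof.
move=> b0; rewrite /scaled pmulr_rge0// /Uvar.
by rewrite subr_ge0; apply: vdot_le1 => //; exact: uvec_sphere.
Qed.

Lemma pr_incell m i (d : R) j : 0 < beta m -> 0 < d ->
  pr P [set w | incell d j (scaled m i w)] =
  pr P (hits i.+1%:Z (d * j.+1%:R / beta m)) - pr P (hits i.+1%:Z (d * j%:R / beta m)).
Proof.
move=> b0 d0; rewrite -!scaled_lt//.
have my := measurable_scaled m i.
have mlt (s : R) : measurable [set w | scaled m i w < s] by exact: measurable_setT_lt.
rewrite (prD P (mlt (d * j.+1%:R)) (mlt (d * j%:R))).
have -> : [set w | scaled m i w < d * j.+1%:R] `&` [set w | scaled m i w < d * j%:R] =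
    [set w | scaled m i w < d * j%:R].
  apply/seteqP; split => [w []//|w h]; split => //=; apply: lt_trans h _.
  by rewrite ltr_pM2l// ltr_nat.
rewrite addrAC subrr add0r; congr (pr P _).
apply/seteqP; split => w /=.
  by move=> /andP[a b]; split => //; apply/negP; rewrite -leNgt.
by move=> [a /negP]; rewrite -leNgt => b; apply/andP.
Qed.

Lemma incell_disj (d y : R) j j' : 0 < d -> incell d j y -> incell d j' y -> j = j'.
Proof.
move=> d0 /andP[a b] /andP[a' b'].
apply/eqP; rewrite eqn_leq; apply/andP; split; rewrite -ltnS -(ltr_nat R) -(ltr_pM2l d0).
  exact: le_lt_trans b'.
exact: le_lt_trans b.
Qed.

Definition occupies (d : R) k (B : {set 'I_k}) m i : set T :=
  [set w | exists2 j : 'I_k, j \in B & incell d j (scaled m i w)].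

Let measurable_incell_set d j m i : measurable [set w | incell d j (scaled m i w)].
Proof. apply: measurable_setT_itv; exact: measurable_scaled. Qed.

Lemma measurable_occupies d k (B : {set 'I_k}) m i : measurable (occupies d B m i).
Proof.
by apply: (@fin_bigcup_measurable _ _ _ [set` B]) => // j _; exact: measurable_incell_set.
Qed.

Lemma pr_occupies d k (B : {set 'I_k}) m i : 0 < d ->
  pr P (occupies d B m i) = \sum_(j in B) pr P [set w | incell d (nat_of_ord j) (scaled m i w)].
Proof.
move=> d0; rewrite pr_Ex; last exact: measurable_occupies.
transitivity (\sum_(j in B) Ex P setT (\1_[set w | incell d (nat_of_ord j) (scaled m i w)] : T -> R)).
  rewrite -Ex_sum//; [|exact: PfinT|by move=> j; apply: bmf_indic => //; exact: measurable_incell_set].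
  apply: Ex_eq => w _; rewrite indicE.
  case: (boolP (w \in _)) => [/set_mem[j jB ij]|/negP h].
    rewrite (bigD1 j)//= indicE mem_set//= big1 ?addr0// => j' /andP[_ jj'].
    rewrite indicE memNset//= => ij'; move/negP: jj'; apply; apply/eqP/val_inj.
    exact: incell_disj ij' ij.
  rewrite big1// => j jB; rewrite indicE memNset//= => ij; apply: h.
  by apply: mem_set; exists j.
by apply: eq_bigr => j _; rewrite pr_Ex//; exact: measurable_incell_set.
Qed.

Lemma occupies_hits d k (B : {set 'I_k}) m i : 0 < beta m -> 0 < d ->
  occupies d B m i `<=` hits i.+1%:Z (d * k%:R / beta m).
Proof.
move=> b0 d0; rewrite -scaled_lt// => w [j jB /andP[_ h]] /=; apply: lt_le_trans h _.
by rewrite ler_pM2l// ler_nat.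
Qed.

Lemma sum_occupies_cvg d k (B : {set 'I_k}) : 0 < d ->
  (fun m => \sum_(i < m) pr P (occupies d B m i)) @ \oo -->
  \sum_(j in B) (F (d * j.+1%:R) - F (d * j%:R)).
Proof.
move=> d0.
have cv (s : R) : 0 <= s -> (fun m => \sum_(i < m) pr P (hits i.+1%:Z (s / beta m))) @ \oo --> F s.
  exact: (sum_hits_cvg L1 hq hs hmH hxm hxS hstat hrho hnear hgamma hbeta).
have : (fun m => \sum_(j in B) (\sum_(i < m) pr P (hits i.+1%:Z (d * j.+1%:R / beta m)) -
      \sum_(i < m) pr P (hits i.+1%:Z (d * j%:R / beta m)))) @ \oo -->
    \sum_(j in B) (F (d * j.+1%:R) - F (d * j%:R)).
  by apply: cvgr_sum => j _; apply: cvgB; apply: cv; rewrite mulr_ge0// ltW.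
apply: cvg_trans; apply: near_eq_cvg; near=> m.
have [_ _ b0] : [/\ (0 < m)%N, gamma / 2 <= r m & 0 < beta m] by near: m; exact: r_bounds.
under [RHS]eq_bigr => i _ do rewrite pr_occupies//.
rewrite exchange_big/=; apply: eq_bigr => j _; rewrite -sumrB; apply: eq_bigr => i _.
by rewrite pr_incell.
Unshelve. all: by end_near.
Qed.

(** The event [occupies] as a condition on the position of the sequence at one index, the form in
    which m-dependence is stated. *)
Let cellset (d : R) k (B : {set 'I_k}) m i : set (@vec R n) :=
  [set v | exists2 j : 'I_k, j \in B & incell d j (beta m * (1 - vdot (u i.+1%:Z) v))].

Let measurable_cellset d k (B : {set 'I_k}) m i : measurable (cellset d B m i).
Proof.
apply: (@fin_bigcup_measurable _ _ _ [set` B]) => // j _; apply: measurable_setT_itv.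
apply: measurable_funM; first exact: measurable_cst.
apply: measurable_funB; first exact: measurable_cst.
exact: measurable_vdot.
Qed.

Lemma occupies_none_indep d k (B : {set 'I_k}) m s : (mdep <= s)%N ->
  pr P (none (occupies d B m) (s - mdep) `&` occupies d B m s) =
  pr P (none (occupies d B m) (s - mdep)) * pr P (occupies d B m s).
Proof.
move=> ms; pose G i := cellset d B m i.
(* Array positions below s - mdep carry the indices 1 to s - mdep, and position s carries s + 1: the
   gap is exactly mdep + 1. *)
have := @hmdep (s - mdep)%N%:Z (s - mdep)%N 1%N (fun j => (nat_of_ord j).+1%:Z)
  (fun j => ~` G j) (fun=> s.+1%:Z) (fun=> G s).
have e1 : [set w | forall j : 'I_(s - mdep), (~` G j) (x (nat_of_ord j).+1%:Z w)] =
    none (occupies d B m) (s - mdep).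
  apply/seteqP; split => w /= H.
    by move=> i il; exact: (H (Ordinal il)).
  by move=> j; exact: H.
have e2 : [set w | forall _ : 'I_1, G s (x s.+1%:Z w)] = occupies d B m s.
  by apply/seteqP; split => w; [move=> /(_ ord0) | move=> H _].
rewrite e1 e2 => H; rewrite /pr H.
- rewrite fineM// fin_num_measure//; last exact: measurable_occupies.
  by apply: measurable_none => i; exact: measurable_occupies.
- by move=> j; rewrite lez_nat.
- by move=> _; rewrite -!PoszD lez_nat subnK// addn1.
- by move=> j; apply: measurableC; exact: measurable_cellset.
- by move=> _; exact: measurable_cellset.
Qed.

Lemma occupies_pair_indep d k (B : {set 'I_k}) m a b : (a + mdep < b)%N ->
  pr P (occupies d B m a `&` occupies d B m b) =
  pr P (occupies d B m a) * pr P (occupies d B m b).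
Proof.
move=> ab; apply: (far_indep hxm hmdep (i := a.+1%:Z) (j := b.+1%:Z)
  (measurable_cellset d B m a) (measurable_cellset d B m b)).
by rewrite -!PoszD lez_nat addn1 addSn ltnS.
Qed.

(* With T the p-th power of the scaled cap height, eta and kappa^2 are of order T^2, while
   m T stays bounded. *)
Lemma occupies_bounds d k (B : {set 'I_k}) : 0 < d -> exists C : R, 0 <= C /\
  \forall m \near \oo, exists eta kappa : R,
   [/\ (forall a b, (a < b)%N -> pr P (occupies d B m a `&` occupies d B m b) <= eta),
       (forall a, pr P (occupies d B m a) <= kappa),
       m%:R * eta <= C / m%:R & m%:R * kappa ^+ 2 <= C / m%:R].
Proof.
move=> d0.
have [K1 K10 HK1] := hits_le L1 hq hs hxm hxS hstat hrho hnear.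
have [K2 [t0 [K20 t00 HK2]]] := pair_hits L1 hq hs hxm hxS hstat hrho hnear hmdep hjoint.
have s0 : 0 <= d * k%:R by rewrite mulr_ge0// ltW.
pose B0 : R := (2 / gamma) `^ p * (d * k%:R) `^ p.
have B00 : 0 <= B0 by rewrite mulr_ge0 ?powR_ge0.
exists (Num.max K2 (K1 ^+ 2) * B0 ^+ 2); split; first by rewrite mulr_ge0 ?sqr_ge0// le_max K20.
near=> m.
have [m0 rm b0] : [/\ (0 < m)%N, gamma / 2 <= r m & 0 < beta m] by near: m; exact: r_bounds.
have tt : d * k%:R / beta m <= t0.
  by near: m; exact: (scale_small L1 hgamma hbeta s0 t00).
have mR : 0 < m%:R :> R by rewrite ltr0n.
have tau0 : 0 <= d * k%:R / beta m by rewrite divr_ge0// ltW.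
set tau := d * k%:R / beta m in tt tau0.
have mT : m%:R * tau `^ p <= B0 by exact: (scale_pow_le L1 hgamma m0 rm b0 s0).
have T0 : 0 <= tau `^ p by exact: powR_ge0.
have mT2 : m%:R * (tau `^ p) ^+ 2 <= B0 ^+ 2 / m%:R.
  rewrite ler_pdivlMr//.
  have -> : m%:R * (tau `^ p) ^+ 2 * m%:R = (m%:R * tau `^ p) ^+ 2 by ring.
  by rewrite ler_pXn2r ?nnegrE// mulr_ge0// ltW.
have key (c : R) : 0 <= c -> c <= Num.max K2 (K1 ^+ 2) ->
    m%:R * (c * (tau `^ p) ^+ 2) <= Num.max K2 (K1 ^+ 2) * B0 ^+ 2 / m%:R.
  move=> c0 cK; rewrite mulrCA -mulrA; apply: ler_pM => //.
  by rewrite mulr_ge0 ?sqr_ge0.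
exists (K2 * (tau `^ p) ^+ 2), (K1 * tau `^ p); split.
- move=> a b ab.
  have e : b.+1%:Z = a.+1%:Z + (b - a)%N%:Z by rewrite -PoszD addSn subnKC// ltnW.
  apply: le_trans (HK2 a.+1%:Z (b - a)%N tau _ tau0 tt); last by rewrite subn_gt0.
  rewrite -e; apply: pr_le.
  + by apply: measurableI; exact: measurable_occupies.
  + by apply: measurableI; exact: measurable_hits.
  + by move=> w [wa wb]; split; [exact: (occupies_hits b0 d0 wa) | exact: (occupies_hits b0 d0 wb)].
- move=> a; apply: le_trans (HK1 a.+1%:Z tau tau0); apply: pr_le.
  + exact: measurable_occupies.
  + exact: measurable_hits.
  + exact: occupies_hits.
- by apply: key => //; rewrite le_max lexx.
- by rewrite exprMn; apply: key; rewrite ?sqr_ge0// le_max lexx orbT.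
Unshelve. all: by end_near.
Qed.

Lemma inv_small (C e : R) : 0 < e -> \forall m \near \oo, C / m%:R <= e.
Proof.
move=> e0; near=> m.
have m0 : (0 < m)%N by near: m; exact: nbhs_infty_gt.
rewrite ler_pdivrMr ?ltr0n// mulrC -ler_pdivrMr//.
by near: m; exact: nbhs_infty_ger.
Unshelve. all: by end_near.
Qed.

Lemma scaled_avoids (d : R) k (B : {set 'I_k}) : 0 < d ->
  (fun m => pr P (avoids (scaled m) m d B)) @ \oo -->
  expR (- \sum_(j in B) (F (d * j.+1%:R) - F (d * j%:R))).
Proof.
move=> d0.
have ave m : avoids (scaled m) m d B = none (occupies d B m) m.
  apply/seteqP; split => w /= H.
    by move=> i im [j jB ij]; have := H i; rewrite mem_iota /= add0n => /(_ im j jB); rewrite ij.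
  move=> i; rewrite mem_iota /= add0n => im j jB; apply/negP => ij.
  by apply: (H i im); exists j.
have lim : (fun m => expR (- \sum_(i < m) pr P (occupies d B m i))) @ \oo -->
    expR (- \sum_(j in B) (F (d * j.+1%:R) - F (d * j%:R))).
  apply: (@cvg_comp _ _ _ (fun m => - \sum_(i < m) pr P (occupies d B m i)) (@expR R)).
    by apply: cvgN; exact: sum_occupies_cvg.
  exact: continuous_expR.
have [C [C0 HC]] := occupies_bounds B d0.
suff diff0 : (fun m => pr P (avoids (scaled m) m d B) -
    expR (- \sum_(i < m) pr P (occupies d B m i))) @ \oo --> (0 : R).
  have e m : pr P (avoids (scaled m) m d B) - expR (- \sum_(i < m) pr P (occupies d B m i)) +
     expR (- \sum_(i < m) pr P (occupies d B m i)) = pr P (avoids (scaled m) m d B) by rewrite subrK.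
  by rewrite -(funext e) -[expR (- \sum_(j in B) _)]add0r; exact: cvgD diff0 lim.
apply/cvgrPdist_le => e e0; near=> m.
have [eta [kappa [h1 h2 h3 h4]]] : exists eta kappa : R,
   [/\ (forall a b, (a < b)%N -> pr P (occupies d B m a `&` occupies d B m b) <= eta),
       (forall a, pr P (occupies d B m a) <= kappa),
       m%:R * eta <= C / m%:R & m%:R * kappa ^+ 2 <= C / m%:R] by near: m; exact: HC.
rewrite sub0r normrN ave.
apply: le_trans (none_approx (fun i => measurable_occupies d B m i)
  (fun s => @occupies_none_indep d k B m s) h1 h2 m) _.
have -> : m%:R * (mdep%:R * (eta + kappa ^+ 2) + kappa ^+ 2) =
  mdep%:R * (m%:R * eta + m%:R * kappa ^+ 2) + m%:R * kappa ^+ 2 by ring.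
have md0 : 0 <= mdep%:R :> R by [].
apply: (@le_trans _ _ (mdep%:R * (C / m%:R + C / m%:R) + C / m%:R)).
  by apply: lerD => //; apply: ler_wpM2l => //; exact: lerD.
have -> : mdep%:R * (C / m%:R + C / m%:R) + C / m%:R = (mdep%:R * (C + C) + C) / m%:R.
  by rewrite mulrDl -mulrA mulrDl.
by near: m; exact: inv_small.
Unshelve. all: by end_near.
Qed.

Lemma scaled_doubles (d : R) j (e : R) : 0 < d -> 0 < e -> \forall m \near \oo,
  pr P (doubles (scaled m) m d j) <= (F (d * j.+1%:R) - F (d * j%:R)) ^+ 2 + e.
Proof.
move=> d0 e0.
(* A single cell, viewed as the last of the first j + 1 cells, so that the results on sets of cells
   apply. *)
pose B : {set 'I_j.+1} := [set ord_max]%SET.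
have [C [C0 HC]] := occupies_bounds B d0.
have lim : (fun m => (\sum_(i < m) pr P (occupies d B m i)) ^+ 2) @ \oo -->
    (F (d * j.+1%:R) - F (d * j%:R)) ^+ 2.
  have := @sum_occupies_cvg d _ B d0; rewrite big_set1 /= => lim.
  exact: cvg_comp lim (@exprn_continuous _ _ _).
have e20 : 0 < e / 2 by rewrite divr_gt0.
have small : \forall m \near \oo, mdep%:R * C / m%:R <= e / 2 by exact: inv_small.
have lim2 : \forall m \near \oo, (\sum_(i < m) pr P (occupies d B m i)) ^+ 2 <=
    (F (d * j.+1%:R) - F (d * j%:R)) ^+ 2 + e / 2.
  by apply: (cvgr_le _ lim); rewrite ltrDl.
near=> m.
have [eta [kappa [h1 h2 h3 h4]]] : exists eta kappa : R,
   [/\ (forall a b, (a < b)%N -> pr P (occupies d B m a `&` occupies d B m b) <= eta),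
       (forall a, pr P (occupies d B m a) <= kappa),
       m%:R * eta <= C / m%:R & m%:R * kappa ^+ 2 <= C / m%:R] by near: m; exact: HC.
have -> : doubles (scaled m) m d j =
    [set w | exists2 c, c \in pairs m & (occupies d B m c.1 `&` occupies d B m c.2) w].
  have oE i w : occupies d B m i w <-> incell d j (scaled m i w).
    by split => [[j' /set1P -> //]|h]; exists ord_max => //; exact: set11.
  by apply/seteqP; split => w [c cp] => [/andP[a b]|[/oE a /oE b]]; exists c => //;
    [split; exact/oE | apply/andP].
apply: le_trans (pr_bigU _ _ _) _.
  by move=> c; apply: measurableI; exact: measurable_occupies.
apply: le_trans (pairs_approx h1 (@occupies_pair_indep d _ B m) m) _.
have b1 : (\sum_(i < m) pr P (occupies d B m i)) ^+ 2 <=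
    (F (d * j.+1%:R) - F (d * j%:R)) ^+ 2 + e / 2 by near: m; exact: lim2.
have b2 : m%:R * (mdep%:R * eta) <= e / 2.
  apply: (@le_trans _ _ (mdep%:R * C / m%:R)); last by near: m; exact: small.
  by rewrite mulrCA -mulrA; apply: ler_wpM2l.
lra.
Unshelve. all: by end_near.
Qed.

Lemma scaled_tail (e : R) : 0 < e -> exists K0 : nat, forall K, (K0 <= K)%N -> \forall m \near \oo,
  pr P [set w | e <= tailsum m K (scaled m ^~ w)] <= e.
Proof.
have [K1 K10 HK1] := hits_le L1 hq hs hxm hxS hstat hrho hnear.
have G0 : 0 <= (2 / gamma) `^ p by exact: powR_ge0.
apply: (tail_of_counts (C := K1 * (2 / gamma) `^ p) (L := L)).
- exact: measurable_scaled.
- by rewrite mulr_ge0// ltW.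
near=> m => l.
have [m0 rm b0] : [/\ (0 < m)%N, gamma / 2 <= r m & 0 < beta m] by near: m; exact: r_bounds.
under eq_bigr do rewrite scaled_lt//.
have t0 : 0 <= l.+1%:R / beta m by rewrite divr_ge0// ltW.
apply: (@le_trans _ _ (\sum_(i <- iota 0 m) K1 * (l.+1%:R / beta m) `^ p)).
  by apply: ler_sum => i _; exact: HK1.
rewrite big_const_seq count_predT size_iota iter_addr_0 -(mulr_natl (K1 * _)) mulrCA -mulrA.
apply: ler_wpM2l; first exact: ltW.
apply: le_trans (scale_pow_le L1 hgamma m0 rm b0 _) _ => //.
(* The exponent is rounded up from L - 1/2 to L, which is allowed because the base is at least 1. *)
apply: ler_wpM2l => //; rewrite -powR_mulrn//; apply: ler_powR; first by rewrite ler1n.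
by rewrite gerBl.
Unshelve. all: by end_near.
Qed.

Lemma scaled_good_array : good_array P scaled F.
Proof.
split.
- exact: measurable_scaled.
- have [N _ HN] := r_bounds hgamma hbeta; exists N => m i w Nm.
  by have [_ _ b0] := HN m Nm; exact: scaled_ge0.
- by move=> d k B d0; exact: scaled_avoids.
- exact: scaled_doubles.
- exact: scaled_tail.
Qed.

End PointArray.

(** * Convergence of the top weights *)

Section CapIntensity.
Context {R : realType}.
Variables (L : nat) (c gamma : R).
Hypotheses (L1 : (1 <= L)%N) (c0 : 0 < c) (g0 : 0 < gamma).
Local Notation p := (L%:R - 1 / 2).
Local Notation F := (fun t : R => c * (t / gamma) `^ p).

Let p0 : 0 < p :> R. Proof. exact: p_gt0. Qed.

Lemma power_intensity_nd (a b : R) : 0 <= a -> a <= b -> F a <= F b.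
Proof.
move=> a0 ab; apply: ler_wpM2l; first exact: ltW.
apply: ge0_ler_powR; rewrite ?nnegrE ?divr_ge0 ?(ltW p0) ?(ltW g0)//.
  exact: le_trans ab.
by rewrite ler_pM2r ?invr_gt0.
Qed.

Lemma power_intensity_cont (K : nat) (e : R) : 0 < e -> exists2 h : R, 0 < h &
  forall a b : R, 0 <= a -> a <= b -> b <= K%:R -> b - a <= h -> F b - F a <= e.
Proof.
move=> e0; have k0 : 0 < c * gamma^-1 `^ p by rewrite mulr_gt0// powR_gt0 ?invr_gt0.
have e1 : 0 < e / (c * gamma^-1 `^ p) by rewrite divr_gt0.
have [h h0 H] := powR_unif p0 K e1; exists h => // a b a0 ab bK bah.
have b0 : 0 <= b by exact: le_trans ab.
have g1 : 0 <= gamma^-1 by rewrite invr_ge0 ltW.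
have -> : F b - F a = (b `^ p - a `^ p) * (c * gamma^-1 `^ p) by rewrite !powRM//; ring.
by rewrite -ler_pdivlMr//; exact: H.
Qed.

(** K is chosen so large that F K >= |ln e| + 1, by inverting the power at A = (|ln e| + 1) / c. *)
Lemma power_intensity_infty (e : R) : 0 < e -> exists K : nat, expR (- F K%:R) < e.
Proof.
move=> e0; pose A := (`|ln e| + 1) / c.
have A0 : 0 < A by rewrite divr_gt0// ltr_wpDl.
pose y := gamma * A `^ p^-1.
have y0 : 0 < y by rewrite mulr_gt0// powR_gt0.
have yK := archi_boundP (ltW y0); set K := Num.bound y in yK.
exists K; rewrite -[ltRHS](lnK e0) ltr_expR.
have h : A <= (K%:R / gamma) `^ p.
  apply: (@le_trans _ _ ((A `^ p^-1) `^ p)).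
    by rewrite -powRrM mulVf ?gt_eqF// powRr1// ltW.
  apply: ge0_ler_powR; rewrite ?nnegrE ?powR_ge0 ?(ltW p0) ?divr_ge0 ?(ltW g0)//.
  by rewrite ler_pdivlMr// mulrC ltW.
have h2 : `|ln e| + 1 <= c * (K%:R / gamma) `^ p by rewrite mulrC -ler_pdivrMr.
have := ler_norm (- ln e); rewrite normrN; lra.
Qed.

Lemma power_intensity_poly (l : nat) : F l.+1%:R <= c * gamma^-1 `^ p * l.+1%:R ^+ L.
Proof.
have g1 : 0 <= gamma^-1 by rewrite invr_ge0 ltW.
rewrite powRM// [_ `^ p * _]mulrC mulrA; apply: ler_wpM2l; first by rewrite mulr_ge0 ?powR_ge0// ltW.
rewrite -powR_mulrn//; apply: ler_powR; first by rewrite ler1n.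
by rewrite gerBl.
Qed.

End CapIntensity.

Lemma top_k_weights {R : realType} (L : nat) (th : L.-tuple R) (q : @vec R (2 * L))
  {dT} {T : measurableType dT} (x : int -> T -> @vec R (2 * L)) (beta : nat -> R) (k n : nat) (w : T) :
  top_k k (weights th q (beta n) n (fun i => x i w)) =
  wrow k (points n (fun i => scaled th q x beta n i w)).
Proof.
rewrite /wrow; congr (top_k k _); rewrite /weights /wts /points.
have e i : expR (- scaled th q x beta n i w) =
    expR (- beta n * Uvar th q (x i.+1%:Z w) i.+1%:Z) by rewrite /scaled mulNr.
have -> : \sum_(1 <= j < n.+1) expR (- beta n * Uvar th q (x j%:Z w) j%:Z) =
    \sum_(z <- [seq scaled th q x beta n i w | i <- iota 0 n]) expR (- z).
  rewrite big_map big_add1 /= /index_iota subn0; apply: eq_bigr => i _; by rewrite e.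
rewrite (iotaDl 1 0) -!map_comp; apply: eq_map => i /=.
by rewrite e add1n.
Qed.

Theorem mainTheorem19
  (R : realType) (L : nat) (hL : (1 <= L)%N)
  (th : L.-tuple R) (q : @vec R (2 * L)) (hq : sphere q)
  (sigma : {measure set (@vec R (2 * L)) -> \bar R})
  (hsigma : is_surface_measure sigma)
  (mH : probability (@vec R L) R) (hmH : is_Haar_Hq th mH)
  (dT : measure_display) (T : measurableType dT) (P : probability T R)
  (x : int -> T -> @vec R (2 * L))
  (hxm : forall i, measurable_fun setT (x i))
  (hxS : forall i w, sphere (x i w))
  (hstat : stationary P x)
  (mdep : nat) (hmdep : m_dependent P mdep x)
  (rho : @vec R (2 * L) -> R) (hrho : is_density P sigma (x 0) rho)
  (hrho_near : cont_pos_near (orbit_closure th q) rho)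
  (hjoint : forall l : nat, (1 <= l <= mdep)%N ->
     exists2 f, is_joint_density P sigma (x 0) (x l%:Z) f &
                bounded_on_nbhd (orbit_closure th q) f)
  (beta : nat -> R) (gamma : R) (hgamma : 0 < gamma)
  (hbeta : (fun n : nat => beta n * n%:R `^ (- @alphaL R L)) @ \oo --> gamma)
  (Lam : {measure set R -> \bar R})
  (hLam0 : Lam `]-oo, 0[%classic = 0%E)
  (hLam : forall y : R, 0 <= y ->
     Lam `[0, y]%classic = (Cbar q mH rho * (y / gamma) `^ (@alphaL R L)^-1)%:E)
  (dT' : measure_display) (T' : measurableType dT') (Q : probability T' R)
  (Y : nat -> T' -> R) (hY : is_PPP_atoms Q Lam Y)
  (k : nat) (hk : (1 <= k)%N) :
  forall f : 'rV[R]_k -> R, continuous f ->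
    (exists M : R, forall v, `|f v| <= M) ->
    (fun n : nat =>
       (\int[P]_w (f (top_k k (weights th q (beta n) n (fun i => x i w))))%:E)%E)
      @ \oo --> (\int[Q]_w (f (Wvec k Y w))%:E)%E.
Proof.
move=> f cf [M fM].
pose F := Fcap q mH rho gamma.
have C0 : 0 < Cbar q mH rho := Cbar_gt0 hL hq hmH hrho hrho_near.
have hLamF (y : R) : 0 <= y -> Lam `[0, y]%classic = (F y)%:E.
  by move=> y0; rewrite hLam// alphaL_inv.
have F0 : F 0 = 0 by exact: Fcap0.
have Fnd := power_intensity_nd hL C0 hgamma.
have Fcont := power_intensity_cont hL C0 hgamma.
have Finf := power_intensity_infty hL C0 hgamma.
have Fpoly := power_intensity_poly L C0 hgamma.
have K0 : 0 <= Cbar q mH rho * gamma^-1 `^ (L%:R - 1 / 2) by rewrite mulr_ge0 ?powR_ge0// ltW.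
(* The two arrays live on different probability spaces and share only F; their expectations are
   compared as numbers. *)
have gP := scaled_good_array hL hq hsigma hmH hxm hxS hstat hrho hrho_near hmdep hjoint hgamma hbeta.
have gQ := ppp_good_array hY hLamF F0 Fnd Fcont K0 Fpoly.
have cmp := good_arrays_compare gP gQ F0 Fnd Fcont Finf cf fM.
have my i : measurable_fun setT (Y i) by case: hY.
have Yinc w i : Y i w < Y i.+1 w by case: hY => _ [_ []].
have lim := @Ex_Wvec_cvg _ _ _ Q Y k f M my Yinc cf fM.
have mW : measurable_fun setT (fun w => f (Wvec k Y w)).
  have mf n : measurable_fun setT (fun w => f (wrow k (points n (Y ^~ w)))) by exact: measurable_wrow.
  by apply: (measurable_fun_cvg mf) => w _; exact: wrow_Wvec_cvg.
have bW : bmf setT (fun w => f (Wvec k Y w)) by split => //; exists M.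
have bP n : bmf setT (fun w => f (wrow k (points n (scaled th q x beta n ^~ w)))).
  split; last by exists M.
  by apply: measurable_wrow => // i; exact: measurable_scaled.
rewrite -(ExE measurableT (PfinT Q) bW) in lim *.
pose eP n := Ex P setT (fun w => f (wrow k (points n (scaled th q x beta n ^~ w)))).
pose eQ n := Ex Q setT (fun w => f (wrow k (points n (Y ^~ w)))).
(* The expectation for the scaled points is that for the first n atoms plus a difference tending to
   0. *)
have limP : eP @ \oo --> Ex Q setT (fun w => f (Wvec k Y w)).
  have e n : eP n - eQ n + eQ n = eP n by rewrite subrK.
  have limQ : eQ @ \oo --> Ex Q setT (fun w => f (Wvec k Y w)) by exact: fine_cvg lim.
  by rewrite -(funext e) -[X in _ --> X]add0r; exact: cvgD cmp limQ.
rewrite (_ : (fun n => _) = EFin \o eP); first by apply: cvg_EFin; [exact: nearW | exact: limP].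
apply/funext => n /=; rewrite (ExE measurableT (PfinT P) (bP n)).
by apply: eq_integral => w _; rewrite top_k_weights.
Qed.
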